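(* Let $\lambda=\lambda'$ be a self-conjugate partition of $n$, let $h(\lambda)=(h_1,\dots,h_{d(\lambda)})$ and let $w\in\mathfrak S_n$. Then there exists a polynomial $a^\lambda_w(q)\in\mathbb Z[q-q^{-1}]$, that is, $a^\lambda_w(q)=P(q-q^{-1})$ for some $P\in\mathbb Z[x]$, such that $\deg_q a^\lambda_w(q)\le \ell(w)-\ell(w_{h(\lambda)})$ (that is, $\deg P\le\ell(w)-\ell(w_{h(\lambda)})$, with the zero polynomial having degree $-\infty$) and $$\chi^\lambda(T_w\tau)=(-\sqrt{-1})^{\frac12(n-d(\lambda))}\,a^\lambda_w(q)\,q^{-\frac n2}\prod_{i=1}^{d(\lambda)}\sqrt{[h_i]}.$$ Moreover, $a^\lambda_w(q)\neq0$ (as a polynomial) only if there exists a composition $\kappa$ of $n$ such that $w\rightsquigarrow w_\kappa$ and $\vec\kappa=h(\lambda)$.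
   Context: **Field.** $\mathbb F$ is a field and $q\in\mathbb F$ is nonzero. For $k\ge0$ put $[k]=q+q^3+\dots+q^{2k-1}$ and $[-k]=-q^{-2k}[k]$. Assume that $-1$ and $[k]$, $1\le k\le n$, are nonzero and have square roots in $\mathbb F$, and fix square roots $\sqrt{-1}$, $\sqrt{[k]}$; put $\sqrt{[0]}=0$. Write $q^{1/2}=\sqrt{[1]}$, so $q^{-n/2}=(\sqrt{[1]})^{-n}$. An element of $\mathbb Z[q-q^{-1}]$ is regarded as a polynomial and evaluated at $q\in\mathbb F$ in the displayed equation. **Hecke algebra.** $\mathfrak S_n$ is the symmetric group, $s_i=(i,i+1)$, $S=\{s_1,\dots,s_{n-1}\}$, $\ell$ the Coxeter length. $\mathcal H_q(\mathfrak S_n)$ is the unital associative $\mathbb F$-algebra with generators $T_1,\dots,T_{n-1}$ and relations $(T_i-q)(T_i+q^{-1})=0$, $T_iT_j=T_jT_i$ for $|i-j|>1$, $T_iT_{i+1}T_i=T_{i+1}T_iT_{i+1}$. For a reduced expression $w=s_{i_1}\cdots s_{i_k}$ put $T_w=T_{i_1}\cdots T_{i_k}$. **Compositions.** For a composition $\kappa=(\kappa_1,\dots,\kappa_d)$ of $n$ (positive parts), $\vec\kappa$ is the partition obtained by sorting its parts, and $w_\kappa$ is the product, in increasing order of $i$, of all $s_i$ with $1\le i<n$ and $i\notin\{\kappa_1,\kappa_1+\kappa_2,\dots,\kappa_1+\dots+\kappa_{d-1}\}$. **Relations.** For $x,y\in\mathfrak S_n$ and $s\in S$ write $x\xrightarrow{s}y$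 if $y=sxs$ and $\ell(y)\le\ell(x)$; $\longrightarrow$ is the reflexive and transitive closure of these relations. $\rightsquigarrow$ is the transitive relation on $\mathfrak S_n$ generated by: $w\rightsquigarrow v$ if either $w\longrightarrow v$, or there exists $s\in S$ with $\ell(w)=\ell(sws)$, $v\in\{sw,ws\}$ and $\ell(v)=\ell(w)-1$. **Partitions and Specht modules.** $\lambda'$ is the conjugate of $\lambda$. If $\lambda=\lambda'$, $d(\lambda)=\max\{i:\lambda_i\ge i\}$ and $h_i=\lambda_i+\lambda_i'-2i+1$. $\mathrm{Std}(\lambda)$ is the set of standard $\lambda$-tableaux; $\mathfrak t'$ is the conjugate (transposed) tableau; $\mathfrak t s_i$ swaps $i$ and $i+1$ in $\mathfrak t$. If $i$ is in row $r$, column $c$ of $\mathfrak t$, then $c_{\mathfrak t}(i)=c-r$; $\rho_{\mathfrak t}(i)=c_{\mathfrak t}(i)-c_{\mathfrak t}(i+1)$. For $k>0$ put $\alpha_k=\sqrt{-1}\sqrt{[k+1]}\sqrt{[k-1]}/[k]$, $\alpha_{-k}=-\alpha_k$; $\alpha_{\mathfrak t}(i)=\alpha_{\rho_{\mathfrak t}(i)}$ if $\mathfrak t s_i$ is standard and $0$ otherwise. $S(\lambda)$ is the right $\mathcal H_q(\mathfrak S_n)$-module with basis $\{v_{\mathfrak t}:\mathfrak t\in\mathrm{Std}(\lambda)\}$ and $v_{\mathfrak t}T_i=\frac{-1}{[\rho_{\mathfrak t}(i)]}v_{\mathfrak t}+\alpha_{\mathfrak t}(i)v_{\mathfrak ts_i}$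 for $1\le i<n$. For $\lambda=\lambda'$, $\tau$ is the linear endomorphism of $S(\lambda)$ with $v_{\mathfrak t}\mapsto v_{\mathfrak t'}$, and $\chi^\lambda(h\tau)$ is the trace on $S(\lambda)$ of the composite of right multiplication by $h$ and $\tau$. *)

(* Defs.v *)
From HB Require Import structures.
From mathcomp Require Import all_boot all_order all_algebra all_fingroup.
From mathcomp Require Import generic_quotient boolp ring zify.
From Stdlib Require Import Relation_Operators.

Set Implicit Arguments.
Unset Strict Implicit.
Unset Printing Implicit Defensive.

Import Order.TTheory GRing.Theory Num.Theory.

(* Indices are 0-based throughout: [simple_refl i] is the simple transposition
   (i+1, i+2) of the usual 1-based notation.  The product of ['S_n] composes
   permutations from left to right; everything below depends only on words in
   the simple transpositions, so it is insensitive to that convention. *)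

Section Coxeter.
Variable n : nat.
Implicit Types (w x y v s : 'S_n) (u : seq 'I_n.-1).

Lemma ord_pred_ltn (i : 'I_n.-1) : i < n.
Proof. by rewrite (leq_trans (ltn_ord i)) ?leq_pred. Qed.

Lemma ord_pred_ltnS (i : 'I_n.-1) : i.+1 < n.
Proof. by rewrite -ltn_predRL. Qed.

Definition simple_refl (i : 'I_n.-1) : 'S_n :=
  tperm (Ordinal (ord_pred_ltn i)) (Ordinal (ord_pred_ltnS i)).

Definition word_perm u : 'S_n := (\prod_(i <- u) simple_refl i)%g.

Lemma word_perm_cat u1 u2 :
  word_perm (u1 ++ u2) = (word_perm u1 * word_perm u2)%g.
Proof. by rewrite /word_perm big_cat. Qed.

Lemma tperm_word (k : nat) (a b : 'I_n) :
  b = a + k :> nat -> exists u, word_perm u = tperm a b.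
Proof.
elim: k b => [|k IHk] b.
  rewrite addn0 => /ord_inj ->; exists [::].
  by rewrite /word_perm big_nil tperm1.
case: b => [[|c] lt_c] //=; rewrite addnS // => -[def_c].
have lt_c' : c < n by apply: ltn_trans lt_c.
have /IHk [u def_u] : Ordinal lt_c' = a + k :> nat by [].
have lt_i : c < n.-1 by rewrite ltn_predRL.
pose i := Ordinal lt_i.
have def_i : simple_refl i = tperm (Ordinal lt_c') (Ordinal lt_c).
  by congr tperm; apply: val_inj.
have [k0 | k_gt0] := posnP k.
  exists [:: i]; rewrite /word_perm big_seq1 def_i; congr tperm.
  by apply: val_inj; rewrite /= def_c k0 addn0.
exists (i :: u ++ [:: i]).
rewrite -cat1s !word_perm_cat def_u /word_perm !big_seq1 def_i.
have := tpermJ a (Ordinal lt_c') (tperm (Ordinal lt_c') (Ordinal lt_c)).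
rewrite tpermL tpermD; first by rewrite /conjg tpermV => <-.
  by rewrite -val_eqE /= def_c -[X in _ != X]addn0 eqn_add2l -lt0n.
by rewrite -val_eqE /= def_c -addnS -[X in _ != X]addn0 eqn_add2l.
Qed.

Lemma word_perm_surj w : exists u, word_perm u = w.
Proof.
have [ts -> _] := prod_tpermP w; elim: ts => [|[a b] ts [u def_u]].
  by exists [::]; rewrite /word_perm !big_nil.
have [u2 def_u2] : exists u2, word_perm u2 = tperm a b.
  have [le_ab | /ltnW le_ba] := leqP a b.
    by apply: (@tperm_word (b - a)); rewrite subnKC.
  by rewrite tpermC; apply: (@tperm_word (a - b)); rewrite subnKC.
by exists (u2 ++ u); rewrite word_perm_cat def_u def_u2 big_cons.
Qed.

Definition has_word w k := [exists u : k.-tuple 'I_n.-1, word_perm u == w].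

Lemma has_word_ex w : exists k, has_word w k.
Proof.
have [u def_u] := word_perm_surj w; exists (size u).
by apply/existsP; exists (in_tuple u); rewrite /= def_u.
Qed.

Definition cox_len w := ex_minn (has_word_ex w).

Lemma reduced_word_ex w :
  exists u : (cox_len w).-tuple 'I_n.-1, word_perm u == w.
Proof. by rewrite /cox_len; case: ex_minnP => k /existsP. Qed.

Definition reduced_word w : seq 'I_n.-1 := xchoose (reduced_word_ex w).

Definition is_simple s := [exists i, s == simple_refl i].

Definition arrow_step x y :=
  [exists s, [&& is_simple s, y == (s * x * s)%g & cox_len y <= cox_len x]].

Definition arrow x y := connect arrow_step x y.

Definition leads_step w v : Prop :=
  arrow w v \/
  exists s, [/\ is_simple s, cox_len w = cox_len (s * w * s)%g,
                v \in [:: (s * w)%g; (w * s)%g] &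
                (cox_len v).+1 = cox_len w].

Definition leads : 'S_n -> 'S_n -> Prop := clos_trans 'S_n leads_step.

End Coxeter.

Definition is_composition (n : nat) (kappa : seq nat) : bool :=
  (0 \notin kappa) && (sumn kappa == n).

Definition is_partition (n : nat) (lam : seq nat) : bool :=
  is_composition n lam && sorted geq lam.

Definition partition_of (kappa : seq nat) : seq nat := sort geq kappa.

Definition proper_partial_sums (kappa : seq nat) : seq nat :=
  [seq sumn (take k kappa) | k <- iota 1 (size kappa).-1].

Definition w_comp (n : nat) (kappa : seq nat) : 'S_n :=
  (\prod_(i < n.-1 | i.+1 \notin proper_partial_sums kappa) simple_refl i)%g.

Definition conj_part (lam : seq nat) : seq nat :=
  mkseq (fun j => count (fun r => j < r) lam) (head 0 lam).

Definition diag_len (lam : seq nat) : nat :=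
  \max_(i < size lam | i.+1 <= nth 0 lam i) i.+1.

Definition diag_hook (lam : seq nat) (i : nat) : nat :=
  (nth 0 lam i + nth 0 (conj_part lam) i).+1 - i.+1.*2.

Definition diag_hooks (lam : seq nat) : seq nat :=
  mkseq (diag_hook lam) (diag_len lam).

(* A tableau is encoded by the box (row, column) of each of its entries. *)
Definition tableau (n : nat) := {ffun 'I_n -> 'I_n * 'I_n}.

Section Tableaux.
Variables (n : nat) (lam : seq nat).
Implicit Type t : tableau n.

(* For a partition [lam] of [n], an injective map from the [n] entries to the
   [n] boxes of the diagram is a bijection. *)
Definition standard t : bool :=
  [&& injectiveb t,
      [forall i, (t i).2 < nth 0 lam (t i).1],
      [forall i, forall j,
         ((t i).1 == (t j).1) && ((t i).2 < (t j).2) ==> (i < j)] &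
      [forall i, forall j,
         ((t i).2 == (t j).2) && ((t i).1 < (t j).1) ==> (i < j)]].

Definition Std : {set tableau n} := [set t | standard t].

End Tableaux.

Definition conj_tab n (t : tableau n) : tableau n :=
  [ffun i => ((t i).2, (t i).1)].

Definition swap_tab n (t : tableau n) (i : 'I_n.-1) : tableau n :=
  [ffun j => t (simple_refl i j)].

Definition content n (t : tableau n) (j : 'I_n) : int :=
  ((t j).2%:Z - (t j).1%:Z)%R.

Definition axial n (t : tableau n) (i : 'I_n.-1) : int :=
  (content t (Ordinal (ord_pred_ltn i)) -
   content t (Ordinal (ord_pred_ltnS i)))%R.

Section QuantumIntegers.
Local Open Scope ring_scope.
Variables (F : fieldType) (q : F).

Definition qnat (k : nat) : F := \sum_(j < k) q ^+ j.*2.+1.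

Definition qint (k : int) : F :=
  match k with
  | Posz m => qnat m
  | Negz m => - q ^- m.+1.*2 * qnat m.+1
  end.

(* [im] is the chosen square root of -1 and [sq k] the one of [k]. *)
Record field_data (n : nat) (im : F) (sq : nat -> F) : Prop := FieldData {
  fd_q : q != 0;
  fd_im : im ^+ 2 = -1;
  fd_qnat : forall k, (1 <= k <= n)%N -> qnat k != 0;
  fd_sq : forall k, (1 <= k <= n)%N -> sq k ^+ 2 = qnat k;
  fd_sq0 : sq 0%N = 0
}.

Variables (im : F) (sq : nat -> F).

Definition alpha_nat (k : nat) : F := im * sq k.+1 * sq k.-1 / qnat k.

Definition alpha (k : int) : F :=
  match k with
  | Posz m => alpha_nat m
  | Negz m => - alpha_nat m.+1
  end.

End QuantumIntegers.

(* The Hecke algebra is the algebra presented by the generators [HGen i]: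
   terms in the generators and the scalars, modulo the smallest congruence
   containing the axioms of unital associative algebras and the defining
   relations. *)
Section Hecke.
Local Open Scope ring_scope.
Variables (F : fieldType) (q : F) (n : nat).

Inductive hterm : Type :=
| HGen of 'I_n.-1
| HScal of F
| HAdd of hterm & hterm
| HMul of hterm & hterm.

Inductive heq : hterm -> hterm -> Prop :=
| heq_refl x : heq x x
| heq_sym x y : heq x y -> heq y x
| heq_trans x y z : heq x y -> heq y z -> heq x z
| heq_addl x x' y : heq x x' -> heq (HAdd x y) (HAdd x' y)
| heq_mull x x' y : heq x x' -> heq (HMul x y) (HMul x' y)
| heq_mulr x y y' : heq y y' -> heq (HMul x y) (HMul x y')
| heq_addA x y z : heq (HAdd x (HAdd y z)) (HAdd (HAdd x y) z)
| heq_addC x y : heq (HAdd x y) (HAdd y x)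
| heq_add0 x : heq (HAdd (HScal 0) x) x
| heq_mulA x y z : heq (HMul x (HMul y z)) (HMul (HMul x y) z)
| heq_mul1 x : heq (HMul (HScal 1) x) x
| heq_mul0 x : heq (HMul (HScal 0) x) (HScal 0)
| heq_mulDl x y z : heq (HMul (HAdd x y) z) (HAdd (HMul x z) (HMul y z))
| heq_mulDr x y z : heq (HMul x (HAdd y z)) (HAdd (HMul x y) (HMul x z))
| heq_scalD a b : heq (HScal (a + b)) (HAdd (HScal a) (HScal b))
| heq_scalM a b : heq (HScal (a * b)) (HMul (HScal a) (HScal b))
| heq_scalC a x : heq (HMul (HScal a) x) (HMul x (HScal a))
| heq_quad i :
    heq (HMul (HAdd (HGen i) (HScal (- q))) (HAdd (HGen i) (HScal q^-1)))
        (HScal 0)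
| heq_comm (i j : 'I_n.-1) : (i.+1 < j)%N || (j.+1 < i)%N ->
    heq (HMul (HGen i) (HGen j)) (HMul (HGen j) (HGen i))
| heq_braid (i j : 'I_n.-1) : j = i.+1 :> nat ->
    heq (HMul (HMul (HGen i) (HGen j)) (HGen i))
        (HMul (HMul (HGen j) (HGen i)) (HGen j)).

HB.instance Definition _ := gen_eqMixin hterm.
HB.instance Definition _ := gen_choiceMixin hterm.

Definition heqb : rel hterm := fun x y => `[< heq x y >].

Lemma heqb_refl : reflexive heqb.
Proof. by move=> x; apply/asboolP/heq_refl. Qed.

Lemma heqb_sym : symmetric heqb.
Proof. by move=> x y; apply/asboolP/asboolP; apply: heq_sym. Qed.

Lemma heqb_trans : transitive heqb.
Proof.
move=> y x z /asboolP xy /asboolP yz; apply/asboolP; exact: heq_trans xy yz.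
Qed.

Canonical heqb_equiv := EquivRel heqb heqb_refl heqb_sym heqb_trans.

Definition hecke := {eq_quot heqb}%qT.
HB.instance Definition _ := Choice.on hecke.

Definition hclass (x : hterm) : hecke := (\pi_hecke x)%qT.
Definition hrepr (X : hecke) : hterm := repr X.

Lemma hreprK X : hclass (hrepr X) = X.
Proof. exact: reprK. Qed.

Lemma hclassP x y : hclass x = hclass y <-> heq x y.
Proof.
split=> [/eqmodP /asboolP // | xy]; apply/eqmodP; exact/asboolP.
Qed.

Lemma hreprP x : heq (hrepr (hclass x)) x.
Proof. by apply/hclassP; rewrite hreprK. Qed.

Lemma heq_addr x y y' : heq y y' -> heq (HAdd x y) (HAdd x y').
Proof.
move=> yy'; apply: heq_trans (heq_addC _ _) _.
by apply: heq_trans (heq_addC _ _); apply: heq_addl.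
Qed.

Definition hadd (X Y : hecke) := hclass (HAdd (hrepr X) (hrepr Y)).
Definition hmul (X Y : hecke) := hclass (HMul (hrepr X) (hrepr Y)).
Definition hscale (a : F) (X : hecke) := hmul (hclass (HScal a)) X.
Definition hopp (X : hecke) := hscale (-1) X.
Definition hzero := hclass (HScal 0).
Definition hone := hclass (HScal 1).

Lemma haddE x y : hadd (hclass x) (hclass y) = hclass (HAdd x y).
Proof.
apply/hclassP; apply: heq_trans (heq_addl _ (hreprP x)) _.
exact/heq_addr/hreprP.
Qed.

Lemma hmulE x y : hmul (hclass x) (hclass y) = hclass (HMul x y).
Proof.
apply/hclassP; apply: heq_trans (heq_mull _ (hreprP x)) _.
exact/heq_mulr/hreprP.
Qed.

Local Ltac hecke_ax :=
  rewrite /hopp /hscale /hzero /hone ?(haddE, hmulE); apply/hclassP.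

Lemma haddA : associative hadd.
Proof.
move=> X Y Z; rewrite -(hreprK X) -(hreprK Y) -(hreprK Z); hecke_ax.
exact: heq_addA.
Qed.

Lemma haddC : commutative hadd.
Proof.
by move=> X Y; rewrite -(hreprK X) -(hreprK Y); hecke_ax; apply: heq_addC.
Qed.

Lemma hadd0 : left_id hzero hadd.
Proof. by move=> X; rewrite -(hreprK X); hecke_ax; apply: heq_add0. Qed.

Lemma haddN : left_inverse hzero hopp hadd.
Proof.
move=> X; rewrite -(hreprK X); hecke_ax; set x := hrepr X.
apply: heq_trans (heq_addr _ (heq_sym (heq_mul1 x))) _.
apply: heq_trans (heq_sym (heq_mulDl _ _ _)) _.
apply: heq_trans (heq_mull _ (heq_sym (heq_scalD _ _))) _.
by rewrite addNr; apply: heq_mul0.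
Qed.

HB.instance Definition _ :=
  GRing.isZmodule.Build hecke haddA haddC hadd0 haddN.

Lemma hmulA : associative hmul.
Proof.
move=> X Y Z; rewrite -(hreprK X) -(hreprK Y) -(hreprK Z); hecke_ax.
exact: heq_mulA.
Qed.

Lemma hmul1 : left_id hone hmul.
Proof. by move=> X; rewrite -(hreprK X); hecke_ax; apply: heq_mul1. Qed.

Lemma hmulr1 : right_id hone hmul.
Proof.
move=> X; rewrite -(hreprK X); hecke_ax.
exact: heq_trans (heq_sym (heq_scalC _ _)) (heq_mul1 _).
Qed.

Lemma hmulDl : left_distributive hmul +%R.
Proof.
move=> X Y Z; rewrite -(hreprK X) -(hreprK Y) -(hreprK Z) /GRing.add /=.
by hecke_ax; apply: heq_mulDl.
Qed.

Lemma hmulDr : right_distributive hmul +%R.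
Proof.
move=> X Y Z; rewrite -(hreprK X) -(hreprK Y) -(hreprK Z) /GRing.add /=.
by hecke_ax; apply: heq_mulDr.
Qed.

Section Evaluation.
Variables (N : nat) (M : 'I_n.-1 -> 'M[F]_N).

Fixpoint hterm_mx (x : hterm) : 'M[F]_N :=
  match x with
  | HGen i => M i
  | HScal a => a%:M
  | HAdd y z => hterm_mx y + hterm_mx z
  | HMul y z => hterm_mx y *m hterm_mx z
  end.

Record hecke_rels : Prop := HeckeRels {
  hr_quad i : (M i - q%:M) *m (M i + q^-1%:M) = 0;
  hr_comm (i j : 'I_n.-1) : (i.+1 < j)%N -> M i *m M j = M j *m M i;
  hr_braid (i j : 'I_n.-1) : j = i.+1 :> nat ->
    M i *m M j *m M i = M j *m M i *m M j
}.

Hypothesis M_rels : hecke_rels.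

Lemma hterm_mx_heq x y : heq x y -> hterm_mx x = hterm_mx y.
Proof.
case: M_rels => quad comm braid.
elim=> {x y} //=.
- by move=> x y z _ -> _ ->.
- by move=> x x' y _ ->.
- by move=> x x' y _ ->.
- by move=> x y y' _ ->.
- by move=> x y z; rewrite addrA.
- by move=> x y; rewrite addrC.
- by move=> x; rewrite raddf0 add0r.
- by move=> x y z; rewrite mulmxA.
- by move=> x; rewrite mul1mx.
- by move=> x; rewrite raddf0 mul0mx.
- by move=> x y z; rewrite mulmxDl.
- by move=> x y z; rewrite mulmxDr.
- by move=> a b; rewrite raddfD.
- by move=> a b; rewrite scalar_mxM.
- by move=> a x; rewrite scalar_mxC.
- by move=> i; rewrite raddfN quad raddf0.
- by move=> i j /orP[] /comm.
Qed.

End Evaluation.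

Lemma hone_neq0 : hone != hzero.
Proof.
apply/eqP => /hclassP /(@hterm_mx_heq 1 (fun=> q%:M)) /=.
have rels : hecke_rels (fun=> q%:M : 'M_1).
  split=> // i; by rewrite subrr mul0mx.
move=> /(_ rels) /matrixP /(_ 0 0) /eqP.
by rewrite !mxE /= !mulr1n oner_eq0.
Qed.

HB.instance Definition _ := GRing.Zmodule_isNzRing.Build hecke
  hmulA hmul1 hmulr1 hmulDl hmulDr hone_neq0.

Lemma hscaleA a b X : hscale a (hscale b X) = hscale (a * b) X.
Proof.
rewrite -(hreprK X); hecke_ax; apply: heq_trans (heq_mulA _ _ _) _.
exact/heq_mull/heq_sym/heq_scalM.
Qed.

Lemma hscale1 : left_id 1 hscale.
Proof. exact: hmul1. Qed.

Lemma hscaleDr : right_distributive hscale +%R.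
Proof. by move=> a; apply: hmulDr. Qed.

Lemma hscaleDl X : {morph hscale^~ X : a b / a + b}.
Proof.
move=> a b; rewrite -(hreprK X) [in RHS]/GRing.add /=; hecke_ax.
apply: heq_trans (heq_mulDl _ _ _); exact/heq_mull/heq_scalD.
Qed.

HB.instance Definition _ := GRing.Zmodule_isLmodule.Build F hecke
  hscaleA hscale1 hscaleDr hscaleDl.

Lemma hscaleAl a (X Y : hecke) : a *: (X * Y) = a *: X * Y.
Proof. exact: hmulA. Qed.

HB.instance Definition _ := GRing.Lmodule_isLalgebra.Build F hecke hscaleAl.

Lemma hscaleAr a (X Y : hecke) : a *: (X * Y) = X * (a *: Y).
Proof.
rewrite -(hreprK X) -(hreprK Y) /GRing.scale /GRing.mul /=; hecke_ax.
apply: heq_trans (heq_mulA _ _ _) _; apply: heq_trans (heq_sym (heq_mulA _ _ _)).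
exact/heq_mull/heq_scalC.
Qed.

HB.instance Definition _ := GRing.Lalgebra_isAlgebra.Build F hecke hscaleAr.

Definition hgen (i : 'I_n.-1) : hecke := hclass (HGen i).

(* By Matsumoto's theorem the product does not depend on the reduced word. *)
Definition hecke_T (w : 'S_n) : hecke := \prod_(i <- reduced_word w) hgen i.

Section Lift.
Variables (N : nat) (M : 'I_n.-1 -> 'M[F]_N).

Definition hecke_mx (M_rels : hecke_rels M) (X : hecke) : 'M[F]_N :=
  hterm_mx M (hrepr X).

Variable M_rels : hecke_rels M.
Local Notation f := (hecke_mx M_rels).

Lemma hecke_mx_class x : f (hclass x) = hterm_mx M x.
Proof. exact/(hterm_mx_heq M_rels)/hreprP. Qed.

Lemma hecke_mx_gen i : f (hgen i) = M i.
Proof. exact: hecke_mx_class. Qed.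

Lemma hecke_mx_zmod : zmod_morphism f.
Proof.
have fD X Y : f (X + Y) = f X + f Y.
  by rewrite -(hreprK X) -(hreprK Y) [X in f X]haddE !hecke_mx_class.
by move=> X Y; apply/eqP; rewrite eq_sym subr_eq -fD subrK.
Qed.

Lemma hecke_mx_monoid : monoid_morphism f.
Proof.
split=> [|X Y]; first exact: hecke_mx_class.
by rewrite -(hreprK X) -(hreprK Y) [X in f X]hmulE !hecke_mx_class.
Qed.

Lemma hecke_mx_scale : scalable f.
Proof.
move=> a X; rewrite -(hreprK X) [X in f X]hmulE !hecke_mx_class /=.
by rewrite mul_scalar_mx.
Qed.

HB.instance Definition _ := GRing.isZmodMorphism.Build _ _ f hecke_mx_zmod.
HB.instance Definition _ :=
  GRing.isMonoidMorphism.Build _ _ f hecke_mx_monoid.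
HB.instance Definition _ := GRing.isScalable.Build _ _ _ _ f hecke_mx_scale.

End Lift.
End Hecke.

Section QuantumIdentities.
Local Open Scope ring_scope.
Variables (F : fieldType) (q : F).
Hypothesis q_neq0 : q != 0.
Local Notation qn := (qnat q).
Local Notation qi := (qint q).
Local Notation p := (q - q^-1).
Local Notation E k := ((q ^+ 2) ^ k).

Lemma qnat0 : qn 0 = 0. Proof. by rewrite /qnat big_ord0. Qed.

Lemma qnatS k : qn k.+1 = qn k + q * q ^+ 2 ^+ k.
Proof. by rewrite /qnat big_ord_recr /= exprS -mul2n exprM. Qed.

Lemma qnatS' k : qn k.+1 = q + q ^+ 2 * qn k.
Proof.
elim: k => [|k IHk]; first by rewrite qnatS qnat0 expr0; ring.
by rewrite qnatS [in LHS]IHk qnatS (exprS (q ^+ 2)); ring.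
Qed.

Lemma qint_opp_nat (k : nat) : qi (- k%:Z) = - (E (- k%:Z)) * qn k.
Proof.
case: k => [|k]; first by rewrite oppr0 /= qnat0 mulr0.
by rewrite -NegzE /= /exprz -mul2n exprM.
Qed.

Lemma expfz2_neq0 k : E k != 0.
Proof. by rewrite expfz_neq0 ?expf_neq0. Qed.

Lemma expz2S k : E (k + 1) = E k * q ^+ 2.
Proof. by rewrite expfzDr ?expf_neq0. Qed.

Lemma qintS k : qi (k + 1) = qi k + q * E k.
Proof.
case: k => [k|k]; first by rewrite -PoszD addn1 /= qnatS.
have eNk : Negz k + 1 = - k%:Z by rewrite NegzE intS opprD addrAC addNr add0r.
rewrite eNk.
have := expz2S (Negz k); rewrite eNk.
rewrite [Negz k]NegzE !qint_opp_nat qnatS' => ->; ring.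
Qed.

Lemma int_pm1_ind (P : int -> Prop) :
  P 0 -> (forall k, P k <-> P (k + 1)) -> forall k, P k.
Proof.
move=> P0 PS; elim/int_ind => // k Pk; first by rewrite -addn1 PoszD; apply: (proj1 (PS _)).
by apply: (proj2 (PS (- k.+1%:Z))); rewrite -addn1 PoszD opprD addrNK.
Qed.

Lemma qint_expz k : E k = 1 + p * qi k.
Proof.
elim/int_pm1_ind: k => [|k]; first by rewrite expr0z /= qnat0; ring.
have q2_neq0 := expf_neq0 2 q_neq0.
have eq1 : (1 + p * qi (k + 1) - E (k + 1)) = 1 + p * qi k - E k.
  by rewrite qintS expz2S; field.
by split=> /eqP; rewrite eq_sym -subr_eq0 ?eq1 -?eq1 => /eqP eq2;
   apply/eqP; rewrite eq_sym -subr_eq0 ?eq1 -?eq1 eq2.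
Qed.

Lemma qintD a b : qi (a + b) = qi a + qi b + p * qi a * qi b.
Proof.
elim/int_pm1_ind: b => [|b]; first by rewrite addr0 /= qnat0; ring.
have eq1 : qi (a + (b + 1)) - (qi a + qi (b + 1) + p * qi a * qi (b + 1)) =
           qi (a + b) - (qi a + qi b + p * qi a * qi b).
  rewrite addrA !qintS expfzDr ?expf_neq0 // [E a]qint_expz; ring.
by split=> /eqP; rewrite -subr_eq0 ?eq1 -?eq1 => /eqP eq2;
   apply/eqP; rewrite -subr_eq0 ?eq1 -?eq1 eq2.
Qed.

Lemma qintN k : qi k + qi (- k) + p * qi k * qi (- k) = 0.
Proof. by rewrite -qintD subrr /= qnat0. Qed.

Lemma qintN_neq0 k : qi k != 0 -> qi (- k) != 0.
Proof.
move=> nz; apply/eqP => eq0; case/eqP: nz.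
by have := qintN k; rewrite eq0 mulr0 !addr0.
Qed.

Definition sn_diag k : F := -1 / qi k.

Lemma sn_diagN k : qi k != 0 -> sn_diag (- k) = p - sn_diag k.
Proof.
move=> nz; have nzN := qintN_neq0 nz; rewrite /sn_diag.
apply/eqP; rewrite -subr_eq0; apply/eqP.
have -> : -1 / qi (- k) - (p - -1 / qi k) =
   - (qi k + qi (- k) + p * qi k * qi (- k)) / (qi k * qi (- k)).
  by field; rewrite nz nzN q_neq0.
by rewrite qintN oppr0 mul0r.
Qed.

Lemma sn_diagD a b : qi a != 0 -> qi b != 0 -> qi (a + b) != 0 ->
  sn_diag a * sn_diag b + sn_diag (a + b) * p =
  sn_diag (a + b) * (sn_diag a + sn_diag b).
Proof.
move=> nza nzb nzab; rewrite /sn_diag; apply/eqP; rewrite -subr_eq0; apply/eqP.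
have -> : -1 / qi a * (-1 / qi b) + -1 / qi (a + b) * p -
    -1 / qi (a + b) * (-1 / qi a + -1 / qi b) =
    (qi (a + b) - (qi a + qi b + p * qi a * qi b)) /
      (qi a * qi b * qi (a + b)).
  by field; rewrite nza nzb nzab q_neq0.
by rewrite qintD subrr mul0r.
Qed.

Variables (n : nat) (im : F) (sq : nat -> F).
Hypothesis fd : field_data q n im sq.

Definition small k := (k != 0) && (`|k| < n)%N.

Lemma smallN k : small k -> small (- k).
Proof. by rewrite /small oppr_eq0 abszN. Qed.

Lemma qint_neq0 k : small k -> qi k != 0.
Proof.
wlog: k / 0 <= k => [IH sk|].
  case: (lerP 0 k) => [/IH|/ltW]; first exact.
  rewrite -oppr_ge0 => /IH/(_ (smallN sk))/qintN_neq0; by rewrite opprK.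
case: k => // k _ /andP[nz lt]; apply: (fd_qnat fd).
by rewrite lt0n -eqz_nat nz ltnW.
Qed.

Lemma alphaN k : alpha q im sq (- k) = - alpha q im sq k.
Proof.
case: k => [[|k]|k].
- by rewrite oppr0 /= /alpha_nat (fd_sq0 fd) mulr0 mul0r oppr0.
- by rewrite -NegzE.
- by rewrite NegzE opprK /= opprK.
Qed.

Lemma alpha_sqr k : small k ->
  alpha q im sq k * alpha q im sq (- k) = 1 + sn_diag k * (p - sn_diag k).
Proof.
wlog: k / 0 <= k => [IH sk|].
  case: (lerP 0 k) => [/IH|/ltW]; first exact.
  rewrite -oppr_ge0 => /IH/(_ (smallN sk)); rewrite opprK mulrC => ->.
  by rewrite sn_diagN ?qint_neq0 //; ring.
case: k => // -[//|k] _ /[dup] sk /andP[_]; rewrite absz_nat => lt_kn.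
have nz : qn k.+1 != 0 := qint_neq0 sk.
rewrite alphaN /= /alpha_nat /=.
have sq2 : sq k.+2 ^+ 2 = qn k.+2 by apply: (fd_sq fd).
have sq0 : sq k ^+ 2 = qn k.
  case: k {sk nz sq2} lt_kn => [|k] lt_kn; last first.
    by apply: (fd_sq fd) => /=; apply: ltnW; apply: ltnW.
  by rewrite (fd_sq0 fd) expr0n qnat0.
have -> : im * sq k.+2 * sq k / qn k.+1 * - (im * sq k.+2 * sq k / qn k.+1) =
  - im ^+ 2 * sq k.+2 ^+ 2 * sq k ^+ 2 / (qn k.+1) ^+ 2 by field.
rewrite sq2 sq0 (fd_im fd) opprK mul1r /sn_diag /=.
have /= e1 := qint_expz k.+1.
have e2 : qn k.+2 = qn k.+1 + q * (1 + p * qn k.+1).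
  by rewrite -e1 qnatS -exprnP.
have e3 : qn k = qn k.+1 - q^-1 * (1 + p * qn k.+1).
  by rewrite -e1 qnatS -exprnP (exprS (q ^+ 2)); field.
by rewrite e2 e3; field; rewrite ?q_neq0 ?nz.
Qed.

Lemma alpha_pm1 k : (`|k| = 1)%N -> alpha q im sq k = 0.
Proof.
have a1 : alpha q im sq 1 = 0.
  by rewrite /= /alpha_nat /= (fd_sq0 fd) mulr0 mul0r.
case: k => [[|[|k]]|[|k]] // _.
by rewrite -[Negz 0]/(- (1 : int)) alphaN a1 oppr0.
Qed.

End QuantumIdentities.

Section TableauGeometry.
Variables (n : nat) (lam : seq nat).
Hypothesis lam_part : is_partition n lam.
Implicit Types t u : tableau n.

Lemma lam_sum : sumn lam = n.
Proof. by case/andP: lam_part => /andP[_ /eqP]. Qed.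

Lemma lam_pos : 0 \notin lam.
Proof. by case/andP: lam_part => /andP[]. Qed.

Lemma lam_mono r r' : r <= r' -> nth 0 lam r' <= nth 0 lam r.
Proof.
have [_ lam_srt] := andP lam_part => le_r.
have [lt_r'|/(nth_default 0) -> //] := ltnP r' (size lam).
have geq_tr : transitive geq by move=> a b c /= ab /leq_trans; apply.
by apply: (sorted_leq_nth geq_tr leqnn 0 lam_srt); rewrite ?inE // (leq_ltn_trans le_r).
Qed.

Lemma nth_lam_size r c : c < nth 0 lam r -> r < size lam.
Proof. by apply: contraLR; rewrite -leqNgt => /(nth_default 0) ->. Qed.

Lemma box_bound r c r' c' :
  c < nth 0 lam r -> c' < nth 0 lam r' -> c + r' < n.
Proof.
move=> lt_c /nth_lam_size; have := leq_trans lt_c (lam_mono (leq0n r)).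
rewrite -lam_sum; move: lam_pos; case: lam => //= x l.
rewrite inE negb_or => /andP[_ l_pos] lt_cx lt_r'.
have le_l : size l <= sumn l.
  elim: l l_pos {lt_r'} => //= y l IH; rewrite inE negb_or eq_sym -lt0n.
  by case/andP=> y_gt0 /IH; lia.
by lia.
Qed.

Lemma std_box t i : standard lam t -> (t i).2 < nth 0 lam (t i).1.
Proof. by case/and4P=> _ /forallP. Qed.

Lemma std_inj t : standard lam t -> injective t.
Proof. by case/and4P=> /injectiveP. Qed.

Lemma std_row t i j : standard lam t ->
  (t i).1 = (t j).1 -> (t i).2 < (t j).2 -> i < j.
Proof.
case/and4P=> _ _ /forallP/(_ i)/forallP/(_ j)/implyP st _ e lt.
by apply: st; rewrite e eqxx.
Qed.

Lemma std_col t i j : standard lam t ->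
  (t i).2 = (t j).2 -> (t i).1 < (t j).1 -> i < j.
Proof.
case/and4P=> _ _ _ /forallP/(_ i)/forallP/(_ j)/implyP st e lt.
by apply: st; rewrite e eqxx.
Qed.

Lemma std_surj t r c : standard lam t -> c < nth 0 lam r ->
  exists j, (t j).1 = r :> nat /\ (t j).2 = c :> nat.
Proof.
move=> st lt_c.
pose B := [set b : 'I_n * 'I_n | b.2 < nth 0 lam b.1].
have card_B : #|B| <= n.
  rewrite -sum1_card.
  rewrite (eq_bigl (fun b : 'I_n * 'I_n => true && (b.2 < nth 0 lam b.1)));
    last by move=> b; rewrite inE.
  rewrite -(pair_big_dep xpredT (fun (a b : 'I_n) => b < nth 0 lam a)
              (fun _ _ => 1)) /=.
  apply: (@leq_trans (\sum_(a < n) nth 0 lam a)).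
    apply: leq_sum => a _; rewrite sum1_card.
    rewrite cardE -(size_map val) -[X in _ <= X](size_iota 0).
    apply: uniq_leq_size => [|b /mapP[c']].
      by rewrite map_inj_uniq ?enum_uniq //; apply: val_inj.
    by rewrite mem_enum unfold_in /= mem_iota /= => ? ->.
  rewrite -[X in _ <= X]lam_sum sumnE (big_nth 0) big_mkord.
  have [le_n|lt_n] := leqP n (size lam).
    rewrite (big_ord_widen _ (nth 0 lam) le_n) [X in _ <= X](bigID (fun i : 'I_(size lam) => i < n)) /=.
    exact: leq_addr.
  rewrite (big_ord_widen n (nth 0 lam) (ltnW lt_n)).
  rewrite (bigID (fun i : 'I_n => i < size lam)) /= addnC big1 // => i.
  by rewrite -leqNgt => /(nth_default 0).
have im_B : [set t j | j : 'I_n] = B.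
  apply/eqP; rewrite eqEcard; apply/andP; split.
    by apply/subsetP=> _ /imsetP[j _ ->]; rewrite inE std_box.
  by rewrite card_imset ?card_ord //; apply: std_inj st.
have lt_cn : c < n by have := box_bound lt_c lt_c; lia.
have lt_rn : r < n by have := box_bound lt_c lt_c; lia.
have : (Ordinal lt_rn, Ordinal lt_cn) \in B by rewrite inE.
by rewrite -im_B => /imsetP[j _ def_j]; exists j; rewrite -def_j.
Qed.

Lemma box_inj t i j : standard lam t ->
  (t i).1 = (t j).1 :> nat -> (t i).2 = (t j).2 :> nat -> i = j.
Proof.
move=> st e1 e2; apply: (std_inj st).
by rewrite [t i]surjective_pairing [t j]surjective_pairing; congr pair;
   apply: val_inj.
Qed.

Lemma std_nw t i j : standard lam t -> i != j ->
  (t i).1 <= (t j).1 -> (t i).2 <= (t j).2 -> i < j.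
Proof.
move=> st ne_ij le1 le2.
have le_row a b : (t a).1 = (t b).1 :> nat -> (t a).2 <= (t b).2 -> a <= b.
  rewrite leq_eqVlt => e /orP[/eqP/(box_inj st e) -> //|lt].
  by apply/ltnW/(std_row st) => //; apply: val_inj.
have le_col a b : (t a).2 = (t b).2 :> nat -> (t a).1 <= (t b).1 -> a <= b.
  rewrite leq_eqVlt => e /orP[/eqP e'|lt].
    by rewrite (box_inj st e' e).
  by apply/ltnW/(std_col st) => //; apply: val_inj.
have [m [m1 m2]] := std_surj st (leq_trans (std_box j st) (lam_mono le1)).
have le_im : i <= m by apply: le_row; rewrite ?m1 ?m2.
have le_mj : m <= j by apply: le_col; rewrite ?m1 ?m2.
by rewrite ltn_neqAle ne_ij (leq_trans le_im).
Qed.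

Lemma diag_far t i j : standard lam t -> content t i = content t j ->
  i < j -> i.+2 < j.
Proof.
move=> st; rewrite /content => e lt_ij.
have ne_ij : i != j by apply: contraTneq lt_ij => ->; rewrite ltnn.
have lt1 : (t i).1 < (t j).1.
  rewrite ltnNge; apply/negP => le1.
  have le2 : (t j).2 <= (t i).2 by lia.
  by have := std_nw st _ le1 le2; rewrite eq_sym => /(_ ne_ij); lia.
have lt2 : (t i).2 < (t j).2 by lia.
have [m [m1 m2]] := std_surj st (leq_trans (std_box j st) (lam_mono (ltnW lt1))).
have [k [k1 k2]] := std_surj st (ltn_trans lt2 (std_box j st)).
have nw a b : (t a).1 <= (t b).1 -> (t a).2 <= (t b).2 ->
   ((t a).1 < (t b).1) || ((t a).2 < (t b).2) -> a < b.
  move=> le_1 le_2 lt; apply: (std_nw st) => //.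
  by apply: contraTneq lt => ->; rewrite !ltnn.
have : i < m by apply: nw; rewrite ?m1 ?m2 ?lt2 ?orbT //; lia.
have : m < j by apply: nw; rewrite ?m1 ?m2 ?lt1 //; lia.
have : i < k by apply: nw; rewrite ?k1 ?k2 ?lt1 //; lia.
have : k < j by apply: nw; rewrite ?k1 ?k2 ?lt2 ?orbT //; lia.
have : m != k :> nat by apply: contraTneq lt1 => /ord_inj e'; rewrite -m1 e' k1 ltnn.
lia.
Qed.

Lemma content_small t (i j : 'I_n) : standard lam t -> i < j -> j <= i.+2 ->
  small n (content t i - content t j)%R.
Proof.
move=> st lt_ij le_j; rewrite /small subr_eq0; apply/andP; split.
  by apply: contraTneq le_j => /(diag_far st)/(_ lt_ij); rewrite -ltnNge.
have := box_bound (std_box i st) (std_box j st).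
have := box_bound (std_box j st) (std_box i st).
by rewrite /content; lia.
Qed.

Lemma axial_small t i : standard lam t -> small n (axial t i).
Proof. by move=> st; apply: (content_small st). Qed.

Lemma simpleK (i : 'I_n.-1) : involutive (simple_refl i).
Proof. exact: tpermK. Qed.

Lemma swap_tabK (i : 'I_n.-1) : involutive (@swap_tab n ^~ i).
Proof. by move=> t; apply/ffunP=> j; rewrite !ffunE simpleK. Qed.

Lemma simple_lt (i : 'I_n.-1) (j k : 'I_n) : simple_refl i j < simple_refl i k ->
  (j < k) \/ (simple_refl i j = i :> nat /\ simple_refl i k = i.+1 :> nat).
Proof.
rewrite /simple_refl; case: tpermP => [->|->|/eqP + /eqP]; rewrite -?val_eqE /=;
case: tpermP => [->|->|/eqP + /eqP]; rewrite -?val_eqE /=; lia.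
Qed.

Lemma swap_std t (i : 'I_n.-1) : standard lam t -> absz (axial t i) != 1 ->
  standard lam (swap_tab t i).
Proof.
move=> st ax; have axE : axial t i != 1%R /\ axial t i != (-1)%R.
  by move: ax; move: (axial t i); lia.
apply/and4P; split.
- apply/injectiveP=> j k; rewrite !ffunE => /(std_inj st).
  exact: (can_inj (@simpleK i)).
- by apply/forallP=> j; rewrite ffunE std_box.
- apply/forallP=> j; apply/forallP=> k; apply/implyP.
  rewrite !ffunE; set j' := simple_refl i j; set k' := simple_refl i k.
  case/andP=> /eqP e lt; case: (simple_lt (std_row st e lt)) => // -[ej ek].
  have jE : j' = Ordinal (ord_pred_ltn i) by apply: val_inj.
  have kE : k' = Ordinal (ord_pred_ltnS i) by apply: val_inj.
  have lt' : (t j').2.+1 < (t k').2.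
    move: axE; rewrite /axial /content -jE -kE e; lia.
  have [m [m1 m2]] := std_surj st (ltn_trans lt' (std_box k' st)).
  have : m < k' by apply: (std_row st); [apply: val_inj|]; rewrite /= ?m2.
  have : j' < m.
    by apply: (std_row st); [apply: val_inj|]; rewrite /= ?m1 ?m2 ?e.
  by rewrite ej ek; lia.
- apply/forallP=> j; apply/forallP=> k; apply/implyP.
  rewrite !ffunE; set j' := simple_refl i j; set k' := simple_refl i k.
  case/andP=> /eqP e lt; case: (simple_lt (std_col st e lt)) => // -[ej ek].
  have jE : j' = Ordinal (ord_pred_ltn i) by apply: val_inj.
  have kE : k' = Ordinal (ord_pred_ltnS i) by apply: val_inj.
  have lt' : (t j').1.+1 < (t k').1.
    move: axE; rewrite /axial /content -jE -kE e; lia.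
  have [m [m1 m2]] := std_surj st (leq_trans (std_box k' st) (lam_mono (ltnW lt'))).
  have : m < k' by apply: (std_col st); [apply: val_inj|]; rewrite /= ?m1.
  have : j' < m.
    by apply: (std_col st); [apply: val_inj|]; rewrite /= ?m1 ?m2 ?e.
  by rewrite ej ek; lia.
Qed.

End TableauGeometry.

Section Specht.
Local Open Scope ring_scope.
Variables (F : fieldType) (q : F) (n : nat) (im : F) (sq : nat -> F).
Variable lam : seq nat.
Implicit Types t u : tableau n.

Local Notation N := #|Std n lam|.

(* The vector v_t of the standard basis of ['rV_N]; it is 0 when [t] is not
   standard. *)
Definition tab_vec t : 'rV[F]_N := \row_b (enum_val b == t)%:R.

Definition alpha_tab t (i : 'I_n.-1) : F :=
  if standard lam (swap_tab t i) then alpha q im sq (axial t i) else 0.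

(* S(lambda) is the space of row vectors on which right multiplication by T_i
   acts as [v |-> v *m seminormal_mx i]; row [a] is the image of v_t. *)
Definition seminormal_mx (i : 'I_n.-1) : 'M[F]_N :=
  \matrix_a let t := enum_val a in
    (-1 / qint q (axial t i)) *: tab_vec t
      + alpha_tab t i *: tab_vec (swap_tab t i).

Lemma tab_vec_row (A : 'M[F]_N) a : tab_vec (enum_val a) *m A = row a A.
Proof.
rewrite rowE; congr (_ *m _); apply/rowP=> b; rewrite !mxE eqxx /=.
by rewrite (inj_eq enum_val_inj).
Qed.

Lemma tab_vec0 t : ~~ standard lam t -> tab_vec t = 0.
Proof.
move=> nst; apply/rowP=> b; rewrite !mxE; case: eqP => // e.
by have := enum_valP b; rewrite e inE (negPf nst).
Qed.

Hypotheses (lam_part : is_partition n lam) (fd : field_data q n im sq).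
Let q_neq0 := fd_q fd.

Local Notation x k := (sn_diag q k).
Local Notation al k := (alpha q im sq k).
Local Notation p := (q - q^-1).

Lemma axial_swap t i : axial (swap_tab t i) i = - axial t i.
Proof.
by rewrite /axial /content !ffunE /simple_refl tpermL tpermR [RHS]opprB.
Qed.

Lemma tab_vec_seminormal t i : tab_vec t *m seminormal_mx i =
  x (axial t i) *: tab_vec t + al (axial t i) *: tab_vec (swap_tab t i).
Proof.
have [st|nst] := boolP (standard lam t).
  have tS : t \in Std n lam by rewrite inE.
  rewrite -(enum_rankK_in tS tS) tab_vec_row rowK /= /alpha_tab.
  by case: ifP => // /negbT/tab_vec0 ->; rewrite !scaler0.
rewrite (tab_vec0 nst) mul0mx scaler0 add0r.
have [st'|/tab_vec0->] := boolP (standard lam (swap_tab t i)); last first.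
  by rewrite scaler0.
rewrite (alpha_pm1 fd) ?scale0r //; apply/eqP; apply: contraR nst => ax.
have := swap_std lam_part st' (i := i); rewrite swap_tabK; apply.
by rewrite axial_swap abszN.
Qed.

Lemma seminormal_eq (A B : 'M[F]_N) :
  (forall t, standard lam t -> tab_vec t *m A = tab_vec t *m B) -> A = B.
Proof.
move=> eqAB; apply/row_matrixP=> a; rewrite -!tab_vec_row; apply: eqAB.
by have := enum_valP a; rewrite inE.
Qed.

Let mulE := (mulmxDl, mulmxDr, mulmxA, mul_mx_scalar, tab_vec_seminormal).

Lemma seminormal_quad i :
  (seminormal_mx i - q%:M) *m (seminormal_mx i + q^-1%:M) = 0.
Proof.
apply: seminormal_eq => t st; rewrite mulmx0 mulmxA mulmxBr mul_mx_scalar.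
rewrite !mulmxDr !mul_mx_scalar !mulmxBl -!scalemxAl tab_vec_seminormal.
rewrite mulmxDl -!scalemxAl !tab_vec_seminormal swap_tabK axial_swap.
have sm := axial_small lam_part i st.
have nz := qint_neq0 q_neq0 fd sm.
have := alpha_sqr q_neq0 fd sm.
rewrite (sn_diagN q_neq0 nz); set y := x _; set c := al _; set c' := al _.
move=> cc'; apply/rowP=> b; rewrite !mxE.
set e1 := (_ == _)%:R; set e2 := (_ == _)%:R.
transitivity (e1 * (c * c' - (1 + y * (p - y)))); first by field.
by rewrite cc' subrr mulr0.
Qed.

Lemma swap_tab_far t (i j k : 'I_n.-1) : (i.+1 < k)%N || (k.+1 < i)%N ->
  axial (swap_tab t i) k = axial t k.
Proof.
move=> far; rewrite /axial /content !ffunE /simple_refl !tpermD //;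
  rewrite -val_eqE /=; lia.
Qed.

Lemma simpleC (i j : 'I_n.-1) k : (i.+1 < j)%N ->
  simple_refl i (simple_refl j k) = simple_refl j (simple_refl i k).
Proof.
move=> lt_ij; have ij : commute (simple_refl i) (simple_refl j).
  apply/commgP/conjg_fixP; rewrite tpermJ !tpermD // -val_eqE /= /bump; lia.
by rewrite -!permM ij.
Qed.

Lemma seminormal_comm (i j : 'I_n.-1) : (i.+1 < j)%N ->
  seminormal_mx i *m seminormal_mx j = seminormal_mx j *m seminormal_mx i.
Proof.
move=> lt_ij; apply: seminormal_eq => t _; rewrite !mulmxA !tab_vec_seminormal.
rewrite !mulmxDl -!scalemxAl !tab_vec_seminormal !(@swap_tab_far t) ?lt_ij ?orbT //.
have -> : swap_tab (swap_tab t i) j = swap_tab (swap_tab t j) i.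
  by apply/ffunP=> k; rewrite !ffunE simpleC.
by apply/rowP=> b; rewrite !mxE; ring.
Qed.

Lemma seminormal_braid (i j : 'I_n.-1) : j = i.+1 :> nat ->
  seminormal_mx i *m seminormal_mx j *m seminormal_mx i =
  seminormal_mx j *m seminormal_mx i *m seminormal_mx j.
Proof.
move=> def_j; apply: seminormal_eq => t st.
pose k1 := Ordinal (ord_pred_ltn i); pose k2 := Ordinal (ord_pred_ltn j).
pose k3 := Ordinal (ord_pred_ltnS j).
have s1 : simple_refl i = tperm k1 k2 by congr tperm; apply: val_inj.
have s2 : simple_refl j = tperm k2 k3 by [].
have n12 : k1 != k2 by rewrite -val_eqE /=; lia.
have n13 : k1 != k3 by rewrite -val_eqE /=; lia.
have n23 : k2 != k3 by rewrite -val_eqE /=; lia.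
have n21 := n12; rewrite eq_sym in n21.
have n31 := n13; rewrite eq_sym in n31.
have n32 := n23; rewrite eq_sym in n32.
have axi u : axial u i = content u k1 - content u k2.
  by rewrite /axial; congr (_ - content _ _); apply: val_inj.
have axj u : axial u j = content u k2 - content u k3 by [].
have ci u k : content (swap_tab u i) k = content u (tperm k1 k2 k).
  by rewrite /content ffunE s1.
have cj u k : content (swap_tab u j) k = content u (tperm k2 k3 k).
  by rewrite /content ffunE s2.
have sml (k l : 'I_n) : (k < l)%N -> (l <= k.+2)%N ->
    small n (content t k - content t l) by apply: (content_small lam_part st).
have a_sm : small n (axial t i) by rewrite axi; apply: sml => /=; lia.
have b_sm : small n (axial t j) by rewrite axj; apply: sml => /=; lia.
have ab_sm : small n (axial t i + axial t j).
  by rewrite axi axj addrA subrK; apply: sml => /=; lia.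
set a := axial t i in a_sm ab_sm; set b := axial t j in b_sm ab_sm.
have e_i : axial (swap_tab t i) j = a + b.
  by rewrite /a /b !axi !axj !ci tpermR tpermD // addrA subrK.
have e_j : axial (swap_tab t j) i = a + b.
  by rewrite /a /b !axi !axj !cj tpermL tpermD // addrA subrK.
have e_ij : axial (swap_tab (swap_tab t i) j) i = b.
  by rewrite axi !cj tpermL tpermD // !ci tpermL tpermD // /b axj.
have e_ji : axial (swap_tab (swap_tab t j) i) j = a.
  by rewrite axj !ci tpermR tpermD // !cj tpermR tpermD // /a axi.
have bb : swap_tab (swap_tab (swap_tab t i) j) i =
          swap_tab (swap_tab (swap_tab t j) i) j.
  have br : (simple_refl i * simple_refl j * simple_refl i =
             simple_refl j * simple_refl i * simple_refl j)%g.
    have := tpermJ k2 k3 (simple_refl i); rewrite -s2 conjgE {1}s1 tpermV -s1 mulgA => ->.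
    have := tpermJ k1 k2 (simple_refl j); rewrite -s1 conjgE {1}s2 tpermV -s2 mulgA => ->.
    by rewrite s1 s2 tpermR tpermD // tpermL tpermD.
  by apply/ffunP=> k; rewrite !ffunE -!permM !mulgA br.
rewrite !mulmxA !tab_vec_seminormal.
rewrite !mulmxDl -!scalemxAl !tab_vec_seminormal.
rewrite !mulmxDl -!scalemxAl !tab_vec_seminormal.
rewrite !swap_tabK !axial_swap -/a -/b e_i e_j e_ij e_ji bb.
have nza := qint_neq0 q_neq0 fd a_sm.
have nzb := qint_neq0 q_neq0 fd b_sm.
have nzab := qint_neq0 q_neq0 fd ab_sm.
have := sn_diagD q_neq0 nza nzb nzab.
have := alpha_sqr q_neq0 fd a_sm; have := alpha_sqr q_neq0 fd b_sm.
rewrite !(sn_diagN q_neq0) //.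
move: (x a) (x b) (x (a + b)) => xa xb xab.
move: (al a) (al (- a)) (al b) (al (- b)) (al (a + b)) => ca ca' cb cb' cab.
move=> hb ha hab; apply/rowP=> z; rewrite !mxE.
set et := (_ == t)%:R; set ei := (_ == swap_tab t i)%:R.
set ej := (_ == swap_tab t j)%:R.
apply/eqP; rewrite -subr_eq0; apply/eqP.
transitivity (et * (xab * (ca * ca' - (1 + xa * (p - xa)))
                    - xab * (cb * cb' - (1 + xb * (p - xb))))
   + (et * (xa - xb) + ei * ca - ej * cb)
       * (xa * xb + xab * p - xab * (xa + xb))); first by ring.
by rewrite ha hb hab !(subrr, mulr0, addr0).
Qed.

Lemma seminormal_rels : hecke_rels q seminormal_mx.
Proof.
split; [exact: seminormal_quad | exact: seminormal_comm |].
exact: seminormal_braid.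
Qed.

Definition specht_mx : hecke q n -> 'M[F]_N := hecke_mx seminormal_rels.

Definition tau_mx : 'M[F]_N := \matrix_a tab_vec (conj_tab (enum_val a)).

(* Row vectors: the product below is [v |-> tau (v h)]. *)
Definition chi_tau (h : hecke q n) : F := \tr (specht_mx h *m tau_mx).

End Specht.

(* Main.v *)
(* The map tau implements the automorphism T_i |-> - T_i^{-1}, so h |-> tr(h tau)
   is a twisted trace: tr(h T_i tau) = (q - q^{-1}) tr(h tau) - tr(T_i h tau) and
   tr(T_i h T_i tau) = - tr(h tau).  Every w is carried to some w_kappa by steps
   x -> s x s with l(x s) < l(x), and along these steps the two identities give
   P_x = - P_{sxs} if the length drops, and P_x = X P_{xs} - P_{sxs} otherwise.
   There remains w = w_kappa.

   In the seminormal form, only those tableaux contribute to tr(T_{w_kappa} tau)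
   in which every entry is on the diagonal or forms a mirror pair with a
   neighbouring entry linked to it by a generator.  These are signed fillings of
   the shifted diagram above the diagonal.  Summing over the signs, which uses
   [c-b][c+b] = q^{2c}(Z_c - Z_b) with Z_c = [c]^2 / q^{2c}, kills all blocks of
   kappa except those with exactly one diagonal entry, and turns the weight of a
   block into a product of factors 1/(Z_a - Z_b) over consecutive contents.  Seen
   as a sum over non-colliding particles (the rows), it extends to an alternating
   function of the positions, and by partial fractions it equals the sum in which
   a single particle makes all the moves.  Hence a block of size 2k - 1 must
   create a new row of length k, and the trace vanishes unless the parts of kappa
   are the diagonal hooks of lambda. *)
Require Import Defs.
From HB Require Import structures.
From mathcomp Require Import all_boot all_order all_algebra all_fingroup.
From mathcomp Require Import ring zify.
From Stdlib Require Import Relation_Operators Operators_Properties.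

Set Implicit Arguments.
Unset Strict Implicit.
Unset Printing Implicit Defensive.

Import Order.TTheory GRing.Theory Num.Theory.

(** The obstacle is that standardness lets a row grow only while the rows stay strictly decreasing,
    whereas partial fractions need every row to be free to move. The alternating extension removes
    it: a forbidden step makes two rows equal, where an alternating function is zero, so forbidden
    steps can be added to the sum. The one row that makes all the moves of a block may overtake
    others and leave the rows out of order; the final value is therefore a determinant, the sign of
    the rearrangement that sorts them into the shifted rows of [lam]. Hence the coefficient at
    [w_comp n kappa] is an integer, namely 0 or a sign. The count of diagonal entries in a block is
    a matter of parity. When an odd number of entries is left after one of content [y], the
    remaining sum carries a factor [[y]], which is zero after a diagonal entry; in a block of even
    size the two signs of the first pair cancel. The square roots come from telescoping: lengthening
    a row from [c] to [c + 1] contributes a constant times [sq (2c + 1) / sq (2c - 1)], so that a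
    row of length [k] keeps, besides powers of [im] and [sq 1], only the root attached to its hook
    [2k - 1]. *)

Local Notation s := simple_refl.
Local Notation lo i := (Ordinal (ord_pred_ltn i)).
Local Notation hi i := (Ordinal (ord_pred_ltnS i)).

Arguments alpha : simpl never.
Arguments qint : simpl never.

(** * Length and reduced words in the symmetric group *)

Section Length.
Variable n : nat.
Implicit Types (w x y z : 'S_n) (u : seq 'I_n.-1) (i j : 'I_n.-1).

Lemma simple_lo i : s i (lo i) = hi i. Proof. exact: tpermL. Qed.
Lemma simple_hi i : s i (hi i) = lo i. Proof. exact: tpermR. Qed.

Lemma simple_out i (k : 'I_n) : k != i :> nat -> k != i.+1 :> nat -> s i k = k.
Proof. by move=> *; rewrite /simple_refl tpermD // -val_eqE /= eq_sym. Qed.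

Lemma simple_sqr i : (s i * s i = 1)%g. Proof. exact: tperm2. Qed.
Lemma simple_inv i : ((s i)^-1 = s i)%g. Proof. exact: tpermV. Qed.

Lemma simple_mulK i w : (s i * (s i * w) = w)%g.
Proof. by rewrite mulgA simple_sqr mul1g. Qed.

Lemma mul_simpleK i w : (w * s i * s i = w)%g.
Proof. by rewrite -mulgA simple_sqr mulg1. Qed.

Lemma word_perm_cons i u : word_perm (i :: u) = (s i * word_perm u)%g.
Proof. by rewrite /word_perm big_cons. Qed.

Lemma simple_commute i j : i.+1 < j -> (s i * s j = s j * s i)%g.
Proof.
move=> lt_ij; apply/commgP/conjg_fixP.
by rewrite tpermJ !simple_out //= /bump; lia.
Qed.

Definition inversions w :=
  \sum_(p : 'I_n * 'I_n) ((p.1 < p.2) && (w p.2 < w p.1)).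

Lemma inversionsV w : inversions (w^-1)%g = inversions w.
Proof.
rewrite /inversions (reindex_inj (h := fun p : 'I_n * 'I_n => (w p.2, w p.1))) /=.
  by apply: eq_bigr => p _; rewrite !permK andbC.
by move=> [a b] [c d] /= [/perm_inj -> /perm_inj ->].
Qed.

Lemma simple_ltn i (k l : 'I_n) : k != l -> (k, l) != (lo i, hi i) ->
  (k, l) != (hi i, lo i) -> ((s i) k < (s i) l) = (k < l).
Proof.
rewrite /simple_refl !xpair_eqE -!val_eqE /=.
by case: (tpermP _ _ k) => [->|->|/eqP + /eqP]; rewrite -?val_eqE /=;
   case: (tpermP _ _ l) => [->|->|/eqP + /eqP]; rewrite -?val_eqE /=; lia.
Qed.

(** Reindexing the pairs by [s i] preserves every comparison except the one between [i] and [i.+1].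
    The additive form covers ascents and descents at once, without truncated subtraction. *)
Lemma inversions_mul i w :
  inversions (s i * w) + (w (hi i) < w (lo i)) =
  inversions w + (w (lo i) < w (hi i)).
Proof.
have inj_s : injective (fun p : 'I_n * 'I_n => ((s i) p.1, (s i) p.2)).
  by move=> [a b] [c d] /= [/perm_inj -> /perm_inj ->].
rewrite [X in X + _]/inversions (reindex_inj inj_s) /=.
have ne : (hi i, lo i) != (lo i, hi i) by rewrite xpair_eqE -!val_eqE /=; lia.
rewrite /inversions.
rewrite (bigD1 (lo i, hi i)) // (bigD1 (hi i, lo i)) //=.
rewrite [in RHS](bigD1 (lo i, hi i)) // [in RHS](bigD1 (hi i, lo i)) //=.
rewrite !permM !simple_lo !simple_hi !simple_lo /= ltnSn [i.+1 < i]ltnNge leqnSn /=.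
under eq_bigr => p /andP[p1 p2].
  rewrite !permM !(simpleK i).
  have -> : (((s i) p.1 < (s i) p.2) && (w p.2 < w p.1)) =
            ((p.1 < p.2) && (w p.2 < w p.1)).
    have [->|ne12] := eqVneq p.1 p.2; first by rewrite !ltnn !andbF.
    by rewrite simple_ltn // -surjective_pairing.
  over.
by rewrite /= !add0n addnC addnA addnAC.
Qed.

Lemma inversions1 : inversions 1%g = 0.
Proof. by rewrite /inversions big1 // => p _; rewrite !perm1; lia. Qed.

(** Values grow by at least one at each step, so counting from the first entry gives [a <= w a] and
    counting to the last one gives [w a <= a]. *)
Lemma no_descent w : (forall i, w (lo i) < w (hi i)) -> w = 1%g.
Proof.
move=> up.
have mono k (a b : 'I_n) : b = a + k :> nat -> w a + k <= w b.
  elim: k b => [|k IHk] b; first by rewrite !addn0 => /ord_inj ->.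
  case: b => [[|c] lt_c] /=; rewrite addnS // => -[def_c].
  have lt_c' : c < n by apply: ltn_trans lt_c.
  have lt_i : c < n.-1 by rewrite ltn_predRL.
  have := up (Ordinal lt_i).
  have -> : lo (Ordinal lt_i) = Ordinal lt_c' by apply: val_inj.
  have -> : hi (Ordinal lt_i) = Ordinal lt_c by apply: val_inj.
  by have := IHk (Ordinal lt_c') def_c; rewrite addnS; lia.
apply/permP=> a; rewrite perm1; apply/val_inj/eqP => /=.
have n_gt0 : 0 < n by apply: leq_ltn_trans (ltn_ord a).
have lt_n : n.-1 < n by rewrite prednK.
have := mono a (Ordinal n_gt0) a (esym (add0n _)).
have /mono : Ordinal lt_n = a + (n.-1 - a) :> nat.
  by rewrite /= subnKC // -ltnS prednK.
by have := ltn_ord (w (Ordinal lt_n)); have := ltn_ord a; lia.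
Qed.

Lemma inversions_word w : exists u, word_perm u = w /\ size u = inversions w.
Proof.
have [k] := ubnP (inversions w); elim: k w => // k IHk w lt_k.
have [/forallP up|] := boolP [forall i, w (lo i) < w (hi i)].
  by exists [::]; rewrite (no_descent up) inversions1 /word_perm big_nil.
case/forallPn=> i; rewrite -leqNgt => le_w.
have lt_w : w (hi i) < w (lo i).
  rewrite ltn_neqAle le_w andbT val_eqE (inj_eq perm_inj) -val_eqE /=; lia.
have := inversions_mul i w; rewrite lt_w ltnNge (ltnW lt_w) /= addn0 addn1 => e.
have [|u [def_u sz_u]] := IHk (s i * w)%g; first by rewrite -ltnS e.
by exists (i :: u); rewrite /= sz_u e word_perm_cons def_u simple_mulK.
Qed.

Lemma inversions_le u : inversions (word_perm u) <= size u.
Proof.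
elim: u => [|i u IHu]; first by rewrite /word_perm big_nil inversions1.
have := inversions_mul i (word_perm u); rewrite word_perm_cons /=.
by case: (ltngtP (word_perm u (lo i)) _); lia.
Qed.

Lemma cox_lenE w : cox_len w = inversions w.
Proof.
rewrite /cox_len; case: ex_minnP => k /existsP[u /eqP def_u] min_k.
have [v [def_v sz_v]] := inversions_word w.
have le_k := inversions_le u; rewrite def_u size_tuple in le_k.
apply/eqP; rewrite eqn_leq le_k min_k //; apply/existsP.
by have /eqP sz := sz_v; exists (Tuple sz); rewrite /= def_v.
Qed.

Lemma reduced_wordP w :
  word_perm (reduced_word w) = w /\ size (reduced_word w) = cox_len w.
Proof.
rewrite /reduced_word; split; last exact: size_tuple.
exact/eqP/(xchooseP (reduced_word_ex w)).
Qed.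

Lemma cox_len_word u : cox_len (word_perm u) <= size u.
Proof. by rewrite cox_lenE inversions_le. Qed.

Lemma cox_len1 : cox_len (1 : 'S_n) = 0.
Proof. by rewrite cox_lenE inversions1. Qed.

Lemma cox_lenV w : cox_len (w^-1)%g = cox_len w.
Proof. by rewrite !cox_lenE inversionsV. Qed.

Definition ldesc w i := w (hi i) < w (lo i).
Definition rdesc w i := ldesc (w^-1)%g i.

Lemma ldescN w i : ~~ ldesc w i = (w (lo i) < w (hi i)).
Proof.
rewrite /ldesc -leqNgt leq_eqVlt val_eqE (inj_eq perm_inj) -val_eqE /=; lia.
Qed.

Lemma len_ldesc w i : ldesc w i -> cox_len w = (cox_len (s i * w)%g).+1.
Proof.
move=> d; have := inversions_mul i w.
by rewrite -/(ldesc w i) d -ldescN d !cox_lenE; lia.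
Qed.

Lemma len_lasc w i : ~~ ldesc w i -> cox_len (s i * w)%g = (cox_len w).+1.
Proof.
move=> d; have := inversions_mul i w.
by rewrite -/(ldesc w i) (negPf d) -ldescN d !cox_lenE; lia.
Qed.

Lemma len_rdesc w i : rdesc w i -> cox_len w = (cox_len (w * s i)%g).+1.
Proof.
by move/len_ldesc; rewrite cox_lenV => ->; rewrite -cox_lenV invMg invgK simple_inv.
Qed.

Lemma len_rasc w i : ~~ rdesc w i -> cox_len (w * s i)%g = (cox_len w).+1.
Proof.
by move/len_lasc; rewrite cox_lenV => <-; rewrite -cox_lenV invMg simple_inv.
Qed.

Lemma ldesc_lt w i : ldesc w i = (cox_len (s i * w)%g < cox_len w).
Proof.
have [/len_ldesc|/len_lasc] := boolP (ldesc w i); lia.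
Qed.

Lemma rdesc_lt w i : rdesc w i = (cox_len (w * s i)%g < cox_len w).
Proof.
have [/len_rdesc|/len_rasc] := boolP (rdesc w i); lia.
Qed.

Definition reduced u := cox_len (word_perm u) == size u.

Lemma reduced_cons i u : reduced (i :: u) -> reduced u /\ ldesc (word_perm (i :: u)) i.
Proof.
rewrite /reduced => /eqP red_iu; rewrite ldesc_lt red_iu /= word_perm_cons simple_mulK.
have := cox_len_word u; rewrite ltnS => le_u; split=> //.
rewrite eqn_leq le_u /= -ltnS -[X in X <= _]red_iu word_perm_cons.
by have [/len_ldesc|/len_lasc] := boolP (ldesc (word_perm u) i); lia.
Qed.

Lemma reduced_word_ldesc w i : ldesc w i ->
  exists u, word_perm (i :: u) = w /\ reduced (i :: u).
Proof.
move=> d; have [def_u sz_u] := reduced_wordP (s i * w)%g.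
exists (reduced_word (s i * w)%g); rewrite /reduced word_perm_cons def_u simple_mulK /=.
by rewrite sz_u -len_ldesc.
Qed.

(** * Independence of products over reduced words *)

Section Matsumoto.
Local Open Scope ring_scope.
Variables (R : pzRingType) (f : 'I_n.-1 -> R).
Hypothesis f_comm : forall i j, (i.+1 < j)%N -> f i * f j = f j * f i.
Hypothesis f_braid : forall i j, j = i.+1 :> nat ->
  f i * f j * f i = f j * f i * f j.

(** Induction on the length. If the first letters [i] and [j] differ, both are left descents of [w],
    so [w] has reduced words that begin with either spelling of the longest element generated by
    [s i] and [s j]. Each given word is compared with the spelling that shares its first letter, and
    the two spellings agree by [f_comm] or [f_braid]. *)
Lemma matsumoto u v : word_perm u = word_perm v -> reduced u -> reduced v ->
  \prod_(i <- u) f i = \prod_(i <- v) f i.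
Proof.
have [k] := ubnP (size u); elim: k u v => // k IHk u v lt_k eq_uv red_u red_v.
have sz_uv : size u = size v by rewrite -(eqP red_u) -(eqP red_v) eq_uv.
case: u v sz_uv eq_uv red_u red_v lt_k => [|i u] [|j v] //= [sz] eq_uv red_u red_v.
rewrite ltnS => lt_k.
have step i' u' v' : (size u' < k)%N -> word_perm (i' :: u') = word_perm (i' :: v') ->
    reduced (i' :: u') -> reduced (i' :: v') ->
    \prod_(i <- u') f i = \prod_(i <- v') f i.
  move=> lt_u' eq' /reduced_cons[r1 _] /reduced_cons[r2 _]; apply: IHk => //.
  by apply: (mulgI (s i')); rewrite -!word_perm_cons.
have [eq_ij|ne_ij] := eqVneq i j.
  by rewrite -eq_ij !big_cons in eq_uv red_v *; rewrite (@step i u v).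
wlog lt_ij : i j u v ne_ij sz eq_uv red_u red_v lt_k / (i < j)%N.
  move=> IH; have [lt_ij|lt_ji|/ord_inj e] := ltngtP i j; first exact: IH.
    by apply/esym/IH; rewrite -?sz // eq_sym.
  by rewrite e eqxx in ne_ij.
have [_ di] := reduced_cons red_u.
have [_] := reduced_cons red_v; rewrite -eq_uv => dj.
set w := word_perm (i :: u) in eq_uv di dj.
have w_u : reduced (i :: u) by [].
have [far|near] := ltnP i.+1 j.
  have out_lo : s i (lo j) = lo j by apply: simple_out => /=; lia.
  have out_hi : s i (hi j) = hi j by apply: simple_out => /=; lia.
  have dj' : ldesc (s i * w)%g j by rewrite /ldesc !permM out_lo out_hi.
  have [x [def_x red_x]] := reduced_word_ldesc dj'.
  have len_w := len_ldesc di; rewrite -def_x (eqP red_x) in len_w.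
  have def_w : w = word_perm [:: i, j & x].
    by rewrite word_perm_cons def_x simple_mulK.
  have def_w' : w = word_perm [:: j, i & x].
    by rewrite def_w !word_perm_cons !mulgA simple_commute.
  have red_ijx : reduced [:: i, j & x] by rewrite /reduced -def_w len_w.
  have red_jix : reduced [:: j, i & x] by rewrite /reduced -def_w' len_w.
  rewrite !big_cons (@step i u (j :: x)) // (@step j v (i :: x)) -?sz //.
    by rewrite !big_cons !mulrA f_comm.
  by rewrite -eq_uv.
have def_j : j = i.+1 :> nat by lia.
have lo_j : lo j = hi i by apply: val_inj.
have out1 : s i (hi j) = hi j by apply: simple_out => /=; lia.
have out2 : s j (lo i) = lo i by apply: simple_out => /=; lia.
have sj_hi : s j (hi i) = hi j by rewrite -lo_j simple_lo.
(* Descents at [i] and [i.+1] make [w] decrease on three consecutive points, so the letters [i],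
   [j], [i] can be removed one after the other. *)
have dj' : ldesc (s i * w)%g j.
  rewrite /ldesc !permM lo_j simple_hi out1; move: dj di.
  by rewrite /ldesc lo_j; lia.
have di' : ldesc (s j * (s i * w))%g i.
  by rewrite /ldesc !permM sj_hi out2 simple_lo out1 -lo_j.
have [x [def_x red_x]] := reduced_word_ldesc di'.
have len_w := len_ldesc di; rewrite (len_ldesc dj') -def_x (eqP red_x) in len_w.
have def_w : w = word_perm [:: i, j, i & x].
  by rewrite 2!word_perm_cons def_x !simple_mulK.
have braid : (s i * s j * s i = s j * s i * s j)%g.
  have := tpermJ (lo j) (hi j) (s i); rewrite conjgE simple_inv mulgA => ->.
  have := tpermJ (lo i) (hi i) (s j); rewrite conjgE simple_inv mulgA => ->.
  by rewrite lo_j simple_hi out1 out2 sj_hi.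
have def_w' : w = word_perm [:: j, i, j & x].
  by rewrite def_w !word_perm_cons !mulgA braid.
have red_iji : reduced [:: i, j, i & x] by rewrite /reduced -def_w len_w.
have red_jij : reduced [:: j, i, j & x] by rewrite /reduced -def_w' len_w.
rewrite !big_cons (@step i u [:: j, i & x]) // (@step j v [:: i, j & x]) -?sz //.
  by rewrite !big_cons !mulrA f_braid.
by rewrite -eq_uv.
Qed.

Lemma prod_reduced_word u : reduced u ->
  \prod_(i <- reduced_word (word_perm u)) f i = \prod_(i <- u) f i.
Proof.
move=> red_u; have [def_u' sz_u'] := reduced_wordP (word_perm u).
by apply: matsumoto => //; rewrite /reduced def_u' sz_u'.
Qed.

Lemma prod_reduced_word_lmul i w : ~~ ldesc w i ->
  \prod_(k <- reduced_word (s i * w)%g) f k =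
  f i * \prod_(k <- reduced_word w) f k.
Proof.
move=> asc; have [def_u sz_u] := reduced_wordP w.
rewrite -[in LHS]def_u -word_perm_cons prod_reduced_word ?big_cons //.
by rewrite /reduced word_perm_cons def_u len_lasc //= sz_u.
Qed.

Lemma prod_reduced_word_rmul i w : ~~ rdesc w i ->
  \prod_(k <- reduced_word (w * s i)%g) f k =
  \prod_(k <- reduced_word w) f k * f i.
Proof.
move=> asc; have [def_u sz_u] := reduced_wordP w.
have def_ui : word_perm (reduced_word w ++ [:: i]) = (w * s i)%g.
  by rewrite word_perm_cat def_u /word_perm big_seq1.
rewrite -def_ui prod_reduced_word ?big_cat ?big_seq1 //.
by rewrite /reduced def_ui len_rasc // size_cat sz_u addn1.
Qed.

End Matsumoto.

End Length.

(** * Reduction to the elements w_kappa *)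

(** Flag [i] tells whether the entries [i] and [i.+1] lie in the same block. Every block ends with
    [false], the last one included, so there is one flag per entry rather than one per generator. *)
Definition links (kappa : seq nat) : seq bool :=
  flatten [seq nseq m.-1 true ++ [:: false] | m <- kappa].

Lemma size_links kappa : 0 \notin kappa -> size (links kappa) = sumn kappa.
Proof.
elim: kappa => //= m kappa IH; rewrite inE negb_or => /andP[m_gt0 /IH sz].
by rewrite /links /= size_cat sz size_cat size_nseq /=; lia.
Qed.

Lemma count_links kappa : 0 \notin kappa ->
  count id (links kappa) + size kappa = sumn kappa.
Proof.
elim: kappa => //= m kappa IH; rewrite inE negb_or => /andP[m_gt0 /IH <-].
by rewrite /links /= !count_cat count_nseq /=; lia.
Qed.

Lemma proper_partial_sums_cons m k kappa :
  proper_partial_sums [:: m, k & kappa] =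
  m :: [seq m + x | x <- proper_partial_sums (k :: kappa)].
Proof.
rewrite /proper_partial_sums /= addn0; congr cons.
rewrite (iotaDl 1 1) -!map_comp; apply/eq_in_map => j.
by rewrite mem_iota => /andP[j_gt0 _] /=; case: j j_gt0.
Qed.

Lemma nth_links kappa i : 0 \notin kappa -> i.+1 < sumn kappa ->
  nth false (links kappa) i = (i.+1 \notin proper_partial_sums kappa).
Proof.
elim: kappa i => // m kappa IH i; rewrite inE negb_or => /andP[m_gt0 pos].
rewrite /links /= -/(links kappa) nth_cat size_cat size_nseq addn1.
rewrite prednK ?lt0n 1?eq_sym //.
case: kappa IH pos => [|k kappa] IH pos lt_i.
  by rewrite /= addn0 in lt_i; rewrite ltnW // nth_cat size_nseq nth_nseq ltn_predRL lt_i.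
rewrite proper_partial_sums_cons inE negb_or.
have [lt_im|le_mi] := ltnP i m.
  rewrite nth_cat size_nseq nth_nseq.
  have [lt'|ge'] := ltnP i m.-1; last first.
    have -> : i - m.-1 = 0 by lia.
    have -> : i.+1 = m by lia.
    by rewrite /= eqxx.
  have -> /= : i.+1 != m by lia.
  by apply/esym/mapP=> -[x _]; move: lt'; lia.
rewrite IH //; last by rewrite /= in lt_i *; lia.
have -> /= : i.+1 != m by lia.
by rewrite -[in RHS](subnKC le_mi) -addnS mem_map //; apply: addnI.
Qed.

Lemma links_surj (g : seq bool) : ~~ last false g ->
  exists2 kappa, 0 \notin kappa & links kappa = g.
Proof.
elim: g => [|b g IH] /=; first by exists [::].
case: g IH => [|b' g] IH last_g; first by exists [:: 1]; case: b last_g.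
have [kappa pos def_g] := IH last_g.
case: b {IH last_g}; last by exists (1 :: kappa); rewrite // -def_g.
case: kappa pos def_g => [|m kappa] //; rewrite inE negb_or => /andP[m_gt0 pos] <-.
exists (m.+1 :: kappa) => //; case: m m_gt0 => //.
Qed.

Section Parabolic.
Variable n : nat.
Implicit Types (w x y z : 'S_n) (u : seq 'I_n.-1) (i j : 'I_n.-1).
Implicit Type P : pred 'I_n.-1.

Definition incr_word P := [seq i <- enum 'I_n.-1 | P i].

Lemma mem_incr_word P i : (i \in incr_word P) = P i.
Proof. by rewrite mem_filter mem_enum andbT. Qed.

Lemma incr_wordE P : word_perm (incr_word P) = (\prod_(i | P i) s i)%g.
Proof. by rewrite /word_perm /incr_word big_filter enumT. Qed.

Lemma word_perm_fix u (k : 'I_n) : all (fun i => (k < i) || (i.+1 < k)) u ->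
  word_perm u k = k.
Proof.
elim: u => [|i u IHu] /=; first by rewrite /word_perm big_nil perm1.
by case/andP=> ki /IHu fix_k; rewrite word_perm_cons permM simple_out ?fix_k //; lia.
Qed.

Lemma reduced_sorted u : sorted ltn (map val u) -> reduced u.
Proof.
elim: u => [|i u IHu] /= srt; first by rewrite /reduced /word_perm big_nil cox_len1.
have gt_i : all (fun j : 'I_n.-1 => i < j) u.
  by have := order_path_min ltn_trans srt; rewrite all_map.
have /eqP red_u := IHu (path_sorted srt).
rewrite /reduced word_perm_cons len_lasc ?red_u //= ldescN.
have fix_le (k : 'I_n) : k <= i -> word_perm u k = k.
  move=> le_k; apply: word_perm_fix; apply/allP=> j /(allP gt_i); lia.
rewrite fix_le //= ltnNge; apply/negP => le_i.
by have /perm_inj e := fix_le _ le_i; rewrite e /= ltnn in le_i.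
Qed.

Lemma commute_word u i : all (fun j : 'I_n.-1 => i.+1 < j) u ->
  (s i * word_perm u = word_perm u * s i)%g.
Proof.
elim: u => [|j u IHu] /=; first by rewrite /word_perm big_nil mulg1 mul1g.
case/andP=> lt_ij /IHu e.
by rewrite !word_perm_cons mulgA simple_commute // -!mulgA e.
Qed.

Lemma incr_word_sorted P : sorted ltn (map val (incr_word P)).
Proof.
apply: (subseq_sorted ltn_trans) (iota_ltn_sorted 0 n.-1).
by rewrite -val_enum_ord; apply/map_subseq/filter_subseq.
Qed.

Lemma incr_word_reduced P : reduced (incr_word P).
Proof. exact/reduced_sorted/incr_word_sorted. Qed.

Definition cyc_step x y := exists2 i, rdesc x i & y = (s i * x * s i)%g.

(** An invariant for the reduction of any element to an increasing word: [z] permutes the first [m]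
    points, and the letters already in order start at [m.-1]. The last point [M] that [z] may move
    is treated first: conjugations raise [z M] until [z M] is [M] itself or the point just below it;
    in the latter case one letter moves from [z] into the increasing word. *)
Lemma incr_chain m z P : (forall k : 'I_n, m <= k -> z k = k) ->
    (forall i, P i -> m <= i.+1) ->
  exists P', clos_refl_trans _ cyc_step (z * word_perm (incr_word P))%g
                (word_perm (incr_word P')).
Proof.
elim: m z P => [|m IHm] z P fix_z leP.
  exists P; have -> : z = 1%g by apply/permP=> k; rewrite perm1 fix_z.
  by rewrite mul1g; apply: rt_refl.
have [le_nm|lt_mn] := leqP n m.
  by apply: IHm => [k|i /leP /ltnW //]; have := ltn_ord k; lia.
pose M := Ordinal lt_mn.
have fix_m z' : (forall k : 'I_n, m < k -> z' k = k) -> z' M = M ->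
    forall k : 'I_n, m <= k -> z' k = k.
  move=> fix' fixM k; rewrite leq_eqVlt => /orP[/eqP def_k|/fix' //].
  by have -> : k = M by apply: val_inj.
have stable z' : (forall k : 'I_n, m < k -> z' k = k) ->
    forall k : 'I_n, k <= m -> z' k <= m.
  move=> fix' k le_k; rewrite leqNgt; apply/negP => lt_k.
  by have /perm_inj e := fix' _ lt_k; rewrite e in lt_k; lia.
have fixP (k : 'I_n) : k < m -> word_perm (incr_word P) k = k.
  move=> lt_k; apply: word_perm_fix; apply/allP=> i.
  by rewrite mem_incr_word => /leP; lia.
have [d] := ubnP (m - z M); elim: d z fix_z => // d IHd z fix_z lt_d.
have zM := stable z fix_z M (leqnn _).
have [eq_zM|ne_zM] := eqVneq (z M) M.
  by apply: IHm => [|i /leP /ltnW //]; apply: fix_m.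
have lt_zM : z M < m by move: ne_zM zM; rewrite -val_eqE /=; lia.
have lt_i : z M < n.-1 by have := ltn_ord M; rewrite /=; lia.
have [i def_i] : exists i : 'I_n.-1, i = z M :> nat by exists (Ordinal lt_i).
have lo_i : lo i = z M by apply: val_inj.
(* If [z M] is just below [M], then [z * s i] fixes [M] and [s i] joins the increasing word.
   Otherwise [s i] commutes with that word, and conjugation by it replaces the value [i] of [z M] by
   [i.+1]. *)
have [eq_i|ne_i] := eqVneq i.+1 m.
  pose P' := [pred j | (j == i) || P j].
  have hi_i : hi i = M by apply: val_inj; rewrite /= eq_i.
  have def_P' : word_perm (incr_word P') = (s i * word_perm (incr_word P))%g.
    rewrite -word_perm_cons; congr word_perm.
    have lt_tr : transitive (fun j k : 'I_n.-1 => j < k) by move=> ? ? ?; apply: ltn_trans.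
    apply: (irr_sorted_eq lt_tr) => [j|||j]; first exact: ltnn.
    - by have := incr_word_sorted P'; rewrite sorted_map.
    - rewrite /= path_sortedE //; apply/andP; split.
        by apply/allP=> j; rewrite mem_incr_word => /leP; rewrite /=; lia.
      by have := incr_word_sorted P; rewrite sorted_map.
    - by rewrite in_cons !mem_incr_word.
  have := IHm (z * s i)%g P'; rewrite def_P' -mulgA simple_mulK; apply.
    apply: fix_m => [k lt_k|]; last by rewrite permM -lo_i simple_lo.
    by rewrite permM fix_z // simple_out //= -?eq_i; lia.
  by move=> j /orP[/eqP->|/leP /ltnW //]; rewrite eq_i.
have far_i : i.+1 < m by lia.
have sM : s i M = M by apply: simple_out => /=; lia.
have comm_iP : (s i * word_perm (incr_word P) = word_perm (incr_word P) * s i)%g.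
  rewrite commute_word //; apply/allP=> j.
  by rewrite mem_incr_word => /leP; rewrite /=; lia.
have [||P' chain] := IHd (s i * z * s i)%g.
- by move=> k lt_k; rewrite !permM !simple_out ?fix_z //= 1?simple_out //=; lia.
- by rewrite !permM sM -lo_i simple_lo /=; lia.
exists P'; apply: rt_trans chain; apply: rt_step; exists i.
  (* The preimage of [i] is [M], the largest point that [z] may move, so it exceeds the preimage of
     [i.+1]: this is a right descent. *)
  rewrite /rdesc /ldesc invMg !permM.
  have fixV (k : 'I_n) : k < m -> (word_perm (incr_word P))^-1%g k = k.
    by move=> lt_k; rewrite -{1}(fixP k lt_k) permK.
  have [lo_lt hi_lt] : lo i < m /\ hi i < m by rewrite /=; lia.
  rewrite (fixV _ lo_lt) (fixV _ hi_lt) lo_i permK ltn_neqAle.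
  have fix_zV (k : 'I_n) : m < k -> (z^-1)%g k = k.
    by move=> lt_k; rewrite -{1}(fix_z k lt_k) permK.
  rewrite (stable _ fix_zV) 1?ltnW // andbT val_eqE.
  rewrite -(inj_eq (@perm_inj _ z)) permKV -lo_i -val_eqE /=; lia.
by rewrite !mulgA -(mulgA _ (s i)) comm_iP !mulgA.
Qed.

Lemma w_compE kappa :
  w_comp n kappa =
  word_perm (incr_word (fun i : 'I_n.-1 => i.+1 \notin proper_partial_sums kappa)).
Proof. by rewrite incr_wordE. Qed.

Lemma incr_word_ext P P' : P =1 P' -> incr_word P = incr_word P'.
Proof. by move=> eqP; apply: eq_filter. Qed.

Lemma incr_word_comp P : exists2 kappa,
  is_composition n kappa & word_perm (incr_word P) = w_comp n kappa.
Proof.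
pose g := mkseq (fun k => oapp P false (insub k : option 'I_n.-1)) n.
have sz_g : size g = n by apply: size_mkseq.
have last_g : ~~ last false g.
  case n_gt0 : n => [|m]; first by rewrite (size0nil (etrans sz_g n_gt0)).
  rewrite -nth_last sz_g n_gt0 nth_mkseq ?n_gt0 //= insubF //=; lia.
have [kappa pos def_g] := links_surj last_g.
have sum_n : sumn kappa = n by rewrite -size_links // def_g.
exists kappa; first by rewrite /is_composition pos sum_n eqxx.
rewrite w_compE; congr word_perm; apply: incr_word_ext => i.
rewrite -nth_links ?sum_n; [|by []|by have := ltn_ord i; lia].
rewrite def_g nth_mkseq; last by have := ltn_ord i; lia.
by rewrite insubT //= => lt_i; congr P; apply: val_inj.
Qed.

Lemma cyc_chain w : exists2 kappa,
  is_composition n kappa & clos_refl_trans _ cyc_step w (w_comp n kappa).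
Proof.
have [k|i|P chain] := @incr_chain n w pred0; [|by []|].
  by rewrite leqNgt ltn_ord.
have [kappa comp def_w] := incr_word_comp P; exists kappa => //.
rewrite -def_w; move: chain; rewrite [incr_word pred0](eq_filter (a2 := pred0)) //.
by rewrite filter_pred0 /word_perm big_nil mulg1.
Qed.

Lemma cox_len_w_comp kappa : is_composition n kappa ->
  cox_len (w_comp n kappa) + size kappa = n.
Proof.
case/andP=> pos /eqP sum_n; rewrite w_compE (eqP (incr_word_reduced _)).
rewrite -[RHS]sum_n -count_links //; congr (_ + _); rewrite size_filter.
have sz_g := size_links pos; rewrite sum_n in sz_g.
rewrite (eq_count (a2 := preim val (nth false (links kappa)))); last first.
  by move=> i; rewrite /= nth_links ?sum_n //; have := ltn_ord i; lia.
rewrite -count_map val_enum_ord.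
rewrite -[in RHS](mkseq_nth false (links kappa)) sz_g count_map.
case n_gt0 : n => [|m] //; rewrite -[m.+1]addn1 iotaD count_cat.
have nth_m : nth false (links kappa) m = false.
  move: sz_g; rewrite n_gt0; case/lastP: (kappa) => // ks m'.
  rewrite /links map_rcons flatten_rcons catA size_cat nth_cat addn1 => -[->].
  by rewrite ltnn subnn.
by rewrite addn1 /= nth_m !addn0; apply: eq_count.
Qed.

End Parabolic.

(** * The twisted trace *)

Section SelfConjugate.
Variables (n : nat) (lam : seq nat).
Hypotheses (lam_part : is_partition n lam) (lam_conj : conj_part lam = lam).
Implicit Type t : tableau n.

Lemma nth_conj_part c : nth 0 (conj_part lam) c = count (fun r => c < r) lam.
Proof.
have [lt_c|le_c] := ltnP c (head 0 lam); first by rewrite nth_mkseq.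
rewrite nth_default ?size_mkseq //; apply/esym/eqP; rewrite -leqn0 leqNgt -has_count.
apply/hasPn=> _ /(nthP 0)[r _ <-]; rewrite -leqNgt (leq_trans _ le_c) //.
by rewrite -nth0; apply: (lam_mono lam_part).
Qed.

Lemma lam_sym r c : (c < nth 0 lam r) = (r < nth 0 lam c).
Proof.
suff cnt k : k < count (fun x => c < x) lam -> c < nth 0 lam k.
  suff cnt' k : c < nth 0 lam k -> k < count (fun x => c < x) lam.
    by rewrite -[in RHS]lam_conj nth_conj_part; apply/idP/idP => [/cnt'|/cnt].
  move=> lt_c; have lt_k := nth_lam_size lt_c.
  rewrite -(cat_take_drop k.+1 lam) count_cat ltn_addr //.
  suff: all (fun x => c < x) (take k.+1 lam) by rewrite all_count => /eqP->; rewrite size_takel.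
  apply/(all_nthP 0) => i; rewrite size_takel // ltnS => le_i.
  by rewrite nth_take ?ltnS // (leq_trans lt_c) // (lam_mono lam_part).
apply: contraTT; rewrite -!leqNgt => le_c.
rewrite -(cat_take_drop k lam) count_cat.
rewrite [X in _ + X](_ : _ = 0) ?addn0.
  by rewrite (leq_trans (count_size _ _)) // size_take_min geq_minl.
apply/eqP; rewrite -leqn0 leqNgt -has_count; apply/hasPn=> _ /(nthP 0)[i _ <-].
by rewrite nth_drop -leqNgt (leq_trans _ le_c) // (lam_mono lam_part) // leq_addr.
Qed.

Lemma conj_tabK : involutive (@conj_tab n).
Proof. by move=> t; apply/ffunP=> i; rewrite !ffunE; case: (t i). Qed.

Lemma conj_std t : standard lam (conj_tab t) = standard lam t.
Proof.
suff imp (u : tableau n) : standard lam u -> standard lam (conj_tab u).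
  by apply/idP/idP=> [/imp|/imp //]; rewrite conj_tabK.
move=> st; apply/and4P; split.
- apply/injectiveP=> i j; rewrite !ffunE => -[e2 e1]; apply: (std_inj st).
  by rewrite (surjective_pairing (u i)) e1 e2 -surjective_pairing.
- by apply/forallP=> i; rewrite ffunE /= lam_sym std_box.
- apply/forallP=> i; apply/forallP=> j; apply/implyP; rewrite !ffunE /=.
  by case/andP=> /eqP; apply: (std_col st).
apply/forallP=> i; apply/forallP=> j; apply/implyP; rewrite !ffunE /=.
by case/andP=> /eqP; apply: (std_row st).
Qed.

Lemma conj_swap t i : conj_tab (swap_tab t i) = swap_tab (conj_tab t) i.
Proof. by apply/ffunP=> j; rewrite !ffunE. Qed.

Lemma content_conj t j : content (conj_tab t) j = (- content t j)%R.
Proof. by rewrite /content ffunE opprB. Qed.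

Lemma axial_conj t i : axial (conj_tab t) i = (- axial t i)%R.
Proof. by rewrite /axial !content_conj -opprD. Qed.

End SelfConjugate.

Section TwistedTrace.
Local Open Scope ring_scope.
Variables (F : fieldType) (q : F) (n : nat) (im : F) (sq : nat -> F).
Variable lam : seq nat.
Hypotheses (lam_part : is_partition n lam) (fd : field_data q n im sq).
Hypothesis lam_conj : conj_part lam = lam.
Implicit Type t : tableau n.
Local Notation N := #|Std n lam|.
Local Notation M := (@seminormal_mx F q n im sq lam).
Local Notation tau := (@tau_mx F n lam).
Local Notation tv := (@tab_vec F n lam).
Local Notation p := (q - q^-1).

Lemma tab_vec_tau t : tv t *m tau = tv (conj_tab t).
Proof.
have [st|nst] := boolP (standard lam t); last first.
  by rewrite !tab_vec0 ?mul0mx // (conj_std lam_part).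
have tS : t \in Std n lam by rewrite inE.
by rewrite -(enum_rankK_in tS tS) tab_vec_row rowK.
Qed.

(** Conjugation negates axial distances, [alpha] is odd, and [sn_diag q (- k)] is
    [p - sn_diag q k]. *)
Lemma seminormal_tau i : M i *m tau = tau *m (p%:M - M i).
Proof.
apply: seminormal_eq => t st; rewrite !mulmxA tab_vec_tau mulmxBr mul_mx_scalar.
rewrite !(tab_vec_seminormal lam_part fd) mulmxDl -!scalemxAl !tab_vec_tau.
rewrite axial_conj conj_swap.
rewrite (sn_diagN (fd_q fd)); last by apply: (qint_neq0 (fd_q fd) fd); apply: (axial_small lam_part).
by rewrite (alphaN fd); apply/rowP=> b; rewrite !mxE; ring.
Qed.

Lemma seminormal_sqr i : M i *m M i = p *: M i + 1%:M.
Proof.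
have := seminormal_quad lam_part fd i.
rewrite mulmxDr !mulmxBl mul_mx_scalar !mul_scalar_mx scale_scalar_mx.
rewrite mulfV ?(fd_q fd) //; set A := M i *m M i; clearbody A; move: (M i) => B /matrixP e.
apply/matrixP=> a b; apply/eqP; rewrite -subr_eq0; apply/eqP.
by have := e a b; rewrite !mxE => <-; ring.
Qed.

Lemma twisted_cyc (h : 'M_N) i :
  \tr (h *m M i *m tau) = p * \tr (h *m tau) - \tr (M i *m h *m tau).
Proof.
rewrite -mulmxA seminormal_tau mulmxA mxtrace_mulC mulmxBl mul_scalar_mx.
by rewrite raddfB /= mxtraceZ mulmxA.
Qed.

Lemma twisted_conj (h : 'M_N) i : \tr (M i *m h *m M i *m tau) = - \tr (h *m tau).
Proof.
rewrite twisted_cyc mulmxA seminormal_sqr !mulmxDl mul1mx -!scalemxAl.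
by rewrite raddfD /= mxtraceZ opprD addrA subrr add0r.
Qed.

Lemma chi_tauE w : chi_tau lam_part fd (hecke_T q w) =
  \tr ((\prod_(i <- reduced_word w) M i) *m tau).
Proof.
rewrite /chi_tau /specht_mx /hecke_T rmorph_prod /=.
by under eq_bigr do rewrite hecke_mx_gen.
Qed.

End TwistedTrace.

(** * Non-colliding particles and partial fractions *)

Section PartialFractions.
Local Open Scope ring_scope.
Variables (F : fieldType) (T : finType) (z : T -> F).
Implicit Type J : {set T}.

(** Induction on [J]: after removal of a point [o] the identity is used twice, at [x] and at [z o].
    The summands combine one by one, since [1/((x - a)(a - o)) + 1/((x - o)(o - a)) = 1/((x - o)(x -
    a))]. *)
Lemma partial_fractions J x : {in J &, injective z} ->
    (forall j, j \in J -> x != z j) -> J != set0 ->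
  \sum_(i in J) (x - z i)^-1 * \prod_(j in J :\ i) (z i - z j)^-1 =
  \prod_(j in J) (x - z j)^-1.
Proof.
have [k] := ubnP #|J|; elim: k J x => // k IHk J x lt_k inj_z x_nz /set0Pn[o oJ].
rewrite (big_setD1 o) //= [in RHS](big_setD1 o) //=; set J' := J :\ o.
have [J'0|nzJ'] := eqVneq J' set0; first by rewrite J'0 !big_set0 addr0.
have subJ j : j \in J' -> j \in J by rewrite inE => /andP[].
have inj_z' : {in J' &, injective z} by move=> i j /subJ iJ /subJ jJ; apply: inj_z.
have lt_k' : (#|J'| < k)%N by move: lt_k; rewrite (cardsD1 o) oJ.
have zo j : j \in J' -> z o != z j.
  rewrite inE => /andP[ne_j jJ]; apply: contraNneq ne_j => /inj_z e.
  by rewrite inE -e.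
have IH1 := IHk J' x lt_k' inj_z' (fun j jJ => x_nz j (subJ j jJ)) nzJ'.
have IH2 := IHk J' (z o) lt_k' inj_z' zo nzJ'.
rewrite -IH1 -IH2 !mulr_sumr -big_split /=; apply: eq_bigr => i iJ'.
have -> : J :\ i = o |: (J' :\ i).
  apply/setP=> j; rewrite !inE; have [->|//] := eqVneq j o.
  by rewrite oJ andbT; move: iJ'; rewrite !inE eq_sym => /andP[].
rewrite big_setU1 /=; last by rewrite !inE eqxx !andbF.
have nz1 : x - z o != 0 by rewrite subr_eq0 x_nz.
have nz2 : x - z i != 0 by rewrite subr_eq0 x_nz ?subJ.
have nz3 : z o - z i != 0 by rewrite subr_eq0 zo.
have nz4 : z i - z o != 0 by rewrite subr_eq0 eq_sym zo.
set P := \prod_(_ in _) _; move: P => P.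
by field; rewrite nz1 nz2 nz3 nz4.
Qed.

(** The coefficient of [1/x] at infinity in the previous identity. It is obtained without limits:
    the summand of a point [o] is expanded by that identity at [x = z o] and cancels the other
    summands. *)
Lemma partial_fractions_oo J : {in J &, injective z} -> (1 < #|J|)%N ->
  \sum_(i in J) \prod_(j in J :\ i) (z i - z j)^-1 = 0.
Proof.
move=> inj_z lt1; have /card_gt0P[o oJ] : (0 < #|J|)%N by apply: ltnW.
rewrite (big_setD1 o) //=; set J' := J :\ o.
have nzJ' : J' != set0 by rewrite -card_gt0; move: lt1; rewrite (cardsD1 o) oJ.
have subJ j : j \in J' -> j \in J by rewrite inE => /andP[].
have inj_z' : {in J' &, injective z} by move=> i j /subJ iJ /subJ jJ; apply: inj_z.
have zo j : j \in J' -> z o != z j.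
  rewrite inE => /andP[ne_j jJ]; apply: contraNneq ne_j => /inj_z e.
  by rewrite inE -e.
rewrite -(partial_fractions inj_z' zo nzJ') -big_split /= big1 // => i iJ'.
have -> : J :\ i = o |: (J' :\ i).
  apply/setP=> j; rewrite !inE; have [->|//] := eqVneq j o.
  by rewrite oJ andbT; move: iJ'; rewrite !inE eq_sym => /andP[].
rewrite big_setU1 /=; last by rewrite !inE eqxx !andbF.
by rewrite -[z i - z o]opprB invrN mulNr subrr.
Qed.

End PartialFractions.

Section Hopping.
Local Open Scope ring_scope.
Variables (F : fieldType) (D : nat) (Z beta : nat -> F) (L : nat).
Hypothesis Z_inj : forall b c, (b < L)%N -> (c < L)%N -> Z b = Z c -> b = c.
Local Notation config := {ffun 'I_D -> nat}.
Implicit Types (B : config) (i j : 'I_D) (x : F).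

Definition add_at B i d : config := [ffun j => (B j + (j == i) * d)%N].
Definition swap_at B i j : config := [ffun l => B (tperm i j l)].

Lemma add_atE B i d : add_at B i d i = (B i + d)%N.
Proof. by rewrite ffunE eqxx mul1n. Qed.

Lemma add_at_neq B i j d : j != i -> add_at B i d j = B j.
Proof. by move=> ne; rewrite ffunE (negPf ne) addn0. Qed.

Variables (a : nat) (H : config -> F).

(** Vanishing at collisions is a separate clause, because the sign rule does not imply it in
    characteristic two. *)
Record alternating_upto (G : config -> F) : Prop := AlternatingUpto {
  alt_swap : forall B i j, (i < a)%N -> (j < a)%N -> i != j ->
    G (swap_at B i j) = - G B;
  alt_coll : forall B i j, (i < a)%N -> (j < a)%N -> i != j -> B i = B j ->
    G B = 0
}.

Hypothesis H_alt : alternating_upto H.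
Hypothesis H_supp : forall B, H B != 0 -> forall i, (B i <= L)%N.

(** The level [x] is that of the preceding hop, so the weights couple consecutive hops of different
    rows. A row may even hop onto another one; [H] being alternating, such terms vanish. *)
Fixpoint hop k B x : F :=
  if k is k'.+1 then
    \sum_(i : 'I_D | (i < a)%N)
       beta (B i) / (x - Z (B i)) * hop k' (add_at B i 1) (Z (B i))
  else H B.

Lemma swap_add B i j l d :
  swap_at (add_at B l d) i j = add_at (swap_at B i j) (tperm i j l) d.
Proof.
apply/ffunP=> m; rewrite !ffunE; congr (_ + _ * _)%N.
by rewrite -(inj_eq (@perm_inj _ (tperm i j)) _ l) tpermK.
Qed.

Lemma tperm_lt i j l : (i < a)%N -> (j < a)%N -> (tperm i j l < a)%N = (l < a)%N.
Proof. by move=> ia ja; case: tpermP => [->|->|]; rewrite ?ia ?ja. Qed.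

(** A swap only relabels the summands. When rows [i] and [j] coincide, the summands in which [i] or
    [j] hops are exchanged by the swap, hence opposite, and in all others the collision persists. *)
Lemma hop_alt k x : alternating_upto (hop k ^~ x).
Proof.
elim: k x => [|k IHk] x //=; split=> B i j ia ja ne_ij.
  rewrite -sumrN (reindex_inj (@perm_inj _ (tperm i j))) /=.
  apply: eq_big => [l|l la]; first exact: tperm_lt.
  rewrite tperm_lt // in la.
  rewrite -mulrN -(alt_swap (IHk _) _ ia ja ne_ij) swap_add.
  by rewrite [swap_at B i j _]ffunE tpermK.
move=> eq_B; rewrite (bigD1 i) // (bigD1 j) /=; last by rewrite ja eq_sym.
rewrite addrA [X in _ + X]big1 ?addr0 => [|l /andP[/andP[la ne_li] ne_lj]].
  have eq_swap : swap_at B i j = B.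
    apply/ffunP=> l; rewrite ffunE.
    by case: tpermP => [->|->|//]; rewrite eq_B.
  have := alt_swap (IHk (Z (B i))) (add_at B i 1) ia ja ne_ij.
  by rewrite swap_add tpermL eq_swap -eq_B => ->; rewrite mulrN addrN.
by rewrite (alt_coll (IHk _) ia ja ne_ij) ?mulr0 // !add_at_neq // eq_sym.
Qed.

Lemma hop_supp k B x : hop k B x != 0 -> forall i, (B i <= L)%N.
Proof.
elim: k B x => [|k IHk] B x /=; first exact: H_supp.
move=> nz i; rewrite leqNgt; apply/negP => lt_Bi; case/eqP: nz.
rewrite big1 // => j ja; apply/eqP; rewrite mulf_eq0; apply/orP; right.
apply: contraLR lt_Bi => /IHk/(_ i); rewrite -leqNgt; apply: leq_trans.
by rewrite ffunE leq_addr.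
Qed.

Fixpoint walk b d x : F :=
  if d is d'.+1 then beta b / (x - Z b) * walk b.+1 d' (Z b) else 1.

Definition walk_start b d : F := beta b * walk b.+1 d.-1 (Z b).

(** The entering level occurs in a single simple fraction; this is what makes partial fractions in
    [x] applicable. *)
Lemma walkS b d x : walk b d.+1 x = walk_start b d.+1 / (x - Z b).
Proof. by rewrite /walk_start /= mulrAC. Qed.

Definition walk_to b e x : F := if (b <= e)%N then walk b (e - b) x else 0.

(** Configurations form an infinite type. As [H] vanishes as soon as a row exceeds [L], sums over
    end points can run over this finite one. *)
Local Notation ends := {ffun 'I_D -> 'I_L.+1}.
Implicit Type E : ends.
Definition nat_ends E : config := [ffun i => val (E i)].

Lemma nat_ends_inj : injective nat_ends.
Proof.
move=> E E' /ffunP e; apply/ffunP=> i; apply: val_inj.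
by have := e i; rewrite !ffunE.
Qed.

Lemma nat_ends_le E i : (nat_ends E i <= L)%N.
Proof. by rewrite ffunE -ltnS ltn_ord. Qed.

Lemma sum_ends B : \sum_(E | nat_ends E == B) H (nat_ends E) = H B.
Proof.
have [/eqP HB0 | /H_supp le_B] := boolP (H B == 0).
  by rewrite big1 // => E /eqP ->.
pose E : ends := [ffun i => inord (B i)].
have def_E : nat_ends E = B by apply/ffunP=> i; rewrite !ffunE /= inordK ?ltnS.
rewrite -[in RHS]def_E (big_pred1 E) // => E' /=.
by rewrite -[in LHS]def_E (inj_eq nat_ends_inj).
Qed.

(** Only the total and the idle rows are constrained, so that the condition does not depend on which
    row hopped first. End points that lie below [B] somewhere are discarded by [walk_to]. *)
Definition reach k B E : bool :=
  (\sum_(i : 'I_D) nat_ends E i == \sum_(i : 'I_D) B i + k)%N &&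
  [forall i : 'I_D, (a <= i)%N ==> (nat_ends E i == B i)].

(** Here every row walks on its own, entering from the same level [x], and the order of hops of
    different rows is forgotten. *)
Definition free_hop k B x : F :=
  \sum_(E | reach k B E)
    (\prod_(i : 'I_D | (i < a)%N) walk_to (B i) (nat_ends E i) x) * H (nat_ends E).

Lemma reach_out k B E i : reach k B E -> ~~ (i < a)%N -> nat_ends E i = B i.
Proof. by case/andP=> _ /forallP/(_ i)/implyP out; rewrite -leqNgt => /out/eqP. Qed.

Lemma reach_add k B E i : (i < a)%N -> reach k (add_at B i 1) E = reach k.+1 B E.
Proof.
move=> ia; rewrite /reach; congr (_ && _).
  congr (_ == _); under eq_bigr do rewrite ffunE muln1.
  rewrite big_split /= -addnA; congr (_ + _)%N.
  by rewrite (bigD1 i) //= eqxx big1 ?addn0 // => j /negPf ->.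
apply: eq_forallb => j; have [ja|//] := leqP a j.
by rewrite add_at_neq //; apply: contraTneq ja => ->; rewrite -ltnNge.
Qed.

Definition below B E : bool := [forall i : 'I_D, (i < a)%N ==> (B i <= nat_ends E i)%N].
Definition moved B E : {set 'I_D} := [set i : 'I_D | (i < a)%N && (B i < nat_ends E i)%N].

Lemma reach_moved k B E : reach k B E -> below B E ->
  (\sum_(i : 'I_D | i \in moved B E) (nat_ends E i - B i) = k)%N.
Proof.
move=> rE /forallP le_BE; have [/eqP e _] := andP rE.
have le_all i : (B i <= nat_ends E i)%N.
  have := le_BE i; case: ltnP => // /=; rewrite leqNgt => ia _.
  by rewrite (reach_out rE).
apply: (@addnI (\sum_(i : 'I_D) B i)); rewrite -e [X in (_ + X)%N]big_mkcond -big_split /=.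
apply: eq_bigr => i _; rewrite inE; have := le_all i.
case: ltnP => /= [|ia] le_i; first by case: ltnP => //= *; lia.
by rewrite (reach_out rE) ?addn0 // -leqNgt.
Qed.

Lemma walk_to_below B E x : ~~ below B E ->
  \prod_(i : 'I_D | (i < a)%N) walk_to (B i) (nat_ends E i) x = 0.
Proof.
case/forallPn=> i; rewrite negb_imply => /andP[ia nle].
by rewrite (bigD1 i) //= /walk_to (negPf nle) mul0r.
Qed.

Lemma walk_to_moved B E (Q : pred 'I_D) x : below B E ->
  \prod_(i : 'I_D | (i < a)%N && Q i) walk_to (B i) (nat_ends E i) x =
  \prod_(i : 'I_D | (i \in moved B E) && Q i)
     (walk_start (B i) (nat_ends E i - B i) * (x - Z (B i))^-1).
Proof.
move=> /forallP le_BE; rewrite big_mkcond [in RHS]big_mkcond /=.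
apply: eq_bigr => i _; rewrite inE; have := le_BE i.
case: (ltnP i a) => //= _; rewrite /walk_to => le_i; case: (Q i); last by rewrite andbF.
rewrite le_i andbT; case: ltngtP le_i => [lt_i _|//|->]; last by rewrite subnn.
by rewrite -[(nat_ends E i - B i)%N]prednK ?subn_gt0 // walkS.
Qed.

(* The contribution of the end point [E] when row [i] hops first. *)
Definition first_hop B E i : F :=
  beta (B i) * \prod_(j : 'I_D | (j < a)%N)
    walk_to (add_at B i 1 j) (nat_ends E j) (Z (B i)).

Lemma first_hop_unmoved B E i : (i < a)%N -> i \notin moved B E ->
  first_hop B E i = 0.
Proof.
move=> ia; rewrite inE ia -leqNgt => le_i.
by rewrite /first_hop (bigD1 i) //= add_atE addn1 /walk_to ltnNge le_i /= mul0r mulr0.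
Qed.

Lemma first_hop_below B E i : (i < a)%N -> ~~ below B E -> first_hop B E i = 0.
Proof.
move=> ia /forallPn[j]; rewrite negb_imply -ltnNge => /andP[ja lt_j].
rewrite /first_hop (bigD1 j) //= /walk_to leqNgt [add_at B i 1 j]ffunE.
by rewrite (leq_trans lt_j) ?leq_addr //= mul0r mulr0.
Qed.

(** Up to a factor that does not depend on [i], this is the summand of the partial fraction
    identities at the points [Z (B j)] of the moved rows. *)
Lemma first_hop_moved B E i : below B E -> i \in moved B E ->
  first_hop B E i =
  \prod_(j : 'I_D | j \in moved B E) walk_start (B j) (nat_ends E j - B j) *
  \prod_(j : 'I_D | j \in moved B E :\ i) (Z (B i) - Z (B j))^-1.
Proof.
move=> le_BE iJ; have := iJ; rewrite inE => /andP[ia lt_i].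
rewrite /first_hop (bigD1 i) //= add_atE addn1 mulrA.
rewrite (eq_bigr (fun j => walk_to (B j) (nat_ends E j) (Z (B i)))); last first.
  by move=> j /andP[_ ne_j]; rewrite add_at_neq.
rewrite (walk_to_moved (fun j => j != i)) // big_split /= mulrA.
rewrite [in RHS](bigD1 i) //= /walk_to lt_i subnS /walk_start; congr (_ * _).
by apply: eq_bigl => j; rewrite !inE andbC.
Qed.

Definition distinct B : Prop :=
  forall i j, (i < a)%N -> (j < a)%N -> B i = B j -> i = j.

Lemma moved_inj B E : distinct B -> {in moved B E &, injective (fun i => Z (B i))}.
Proof.
move=> dB i j; rewrite !inE => /andP[ia lt_i] /andP[ja lt_j] /Z_inj e.
by apply: dB => //; apply: e; [apply: leq_trans lt_i _ | apply: leq_trans lt_j _];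
  apply: nat_ends_le.
Qed.

(** By [walkS] the right side is a product of simple fractions in [x], one for each moved row, and
    the left side is its expansion. At least one hop is required, so that some row has moved. *)
Lemma sum_first_hop B E k x : distinct B -> reach k.+1 B E ->
    (forall i, (i < a)%N -> (B i < L)%N -> x != Z (B i)) ->
  \sum_(i : 'I_D | (i < a)%N) (x - Z (B i))^-1 * first_hop B E i =
  \prod_(i : 'I_D | (i < a)%N) walk_to (B i) (nat_ends E i) x.
Proof.
move=> dB rE xB; have [le_BE|nle] := boolP (below B E); last first.
  by rewrite walk_to_below // big1 // => i ia; rewrite first_hop_below ?mulr0.
have := walk_to_moved predT x le_BE.
under eq_bigl do rewrite andbT; move=> ->.
under [in RHS]eq_bigl do rewrite andbT; rewrite big_split /=.
rewrite -(partial_fractions (moved_inj dB)).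
- rewrite mulr_sumr [RHS]big_mkcond [LHS]big_mkcond; apply: eq_bigr => i _.
  case: ifP => [ia|nia]; last by rewrite inE nia.
  case: ifP => [iJ|/negbT niJ]; last by rewrite first_hop_unmoved ?mulr0.
  by rewrite first_hop_moved // mulrCA.
- move=> i; rewrite inE => /andP[ia lt_i]; apply: xB => //.
  by apply: leq_trans lt_i _; apply: nat_ends_le.
by apply/eqP=> J0; have := reach_moved rE le_BE; rewrite J0 big_set0.
Qed.

Lemma reach_add_at k B E i : (i < a)%N -> nat_ends E = add_at B i k.+1 ->
  below B E /\ moved B E = [set i].
Proof.
move=> ia def_E; split.
  by apply/forallP=> j; apply/implyP=> _; rewrite def_E ffunE leq_addr.
apply/setP=> j; rewrite !inE def_E ffunE; have [->|ne_j] := eqVneq j i.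
  by rewrite ia; lia.
by rewrite addn0 ltnn andbF.
Qed.

(** Without the factors in [x] the identity at infinity applies and kills the end points where
    several rows moved. A row that moved alone made all the hops. *)
Lemma sum_first_hop_start B E k : distinct B -> reach k.+1 B E ->
  \sum_(i : 'I_D | (i < a)%N) first_hop B E i =
  \sum_(i : 'I_D | (i < a)%N && (nat_ends E == add_at B i k.+1))
     walk_start (B i) k.+1.
Proof.
move=> dB rE; have [le_BE|nle] := boolP (below B E); last first.
  rewrite [RHS]big1 => [|i /andP[ia /eqP/(reach_add_at ia)[]]]; last by rewrite (negPf nle).
  by rewrite big1 // => i ia; rewrite first_hop_below.
rewrite [LHS](bigID (mem (moved B E))) /= [X in _ + X]big1 ?addr0; last first.
  by move=> i /andP[ia]; apply: first_hop_unmoved.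
rewrite (eq_bigl (mem (moved B E))); last first.
  by move=> i /=; rewrite !inE andbA andbb.
have sumJ := reach_moved rE le_BE.
have [le1|lt1] := leqP #|moved B E| 1; last first.
  rewrite (eq_bigr _ (fun i => first_hop_moved le_BE)) -mulr_sumr.
  rewrite (partial_fractions_oo (moved_inj dB)) // mulr0 big1 // => i.
  by case/andP=> ia /eqP/(reach_add_at ia)[_ e]; rewrite e cards1 in lt1.
have [J0|[i iJ]] := set_0Vmem (moved B E); first by rewrite J0 big_set0 in sumJ.
have JE : moved B E = [set i].
  by apply/eqP; rewrite eq_sym eqEcard sub1set iJ cards1.
have := iJ; rewrite inE => /andP[ia lt_i]; rewrite JE big_set1 in sumJ *.
have def_E : nat_ends E = add_at B i k.+1.
  apply/ffunP=> j; rewrite [RHS]ffunE; have [->|ne_j] := eqVneq j i; first by rewrite mul1n -sumJ subnKC // ltnW.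
  have := iJ; have : j \notin moved B E by rewrite JE inE.
  rewrite inE addn0; case: (ltnP j a) => /= [ja|ja _ _]; last first.
    by rewrite (reach_out rE) // -leqNgt.
  rewrite -leqNgt => le_j _; apply/eqP; rewrite eqn_leq le_j.
  by have /forallP/(_ j)/implyP/(_ ja) := le_BE.
rewrite (big_pred1 i) => [|j /=]; last exact: in_set1.
rewrite [RHS](big_pred1 i) => [|j /=]; last first.
  apply/andP/eqP => [[ja /eqP/(reach_add_at ja)[_]]|->]; last by rewrite ia def_E.
  by rewrite JE => /set1_inj.
by rewrite first_hop_moved // JE setDv big_set0 mulr1 big_set1 sumJ.
Qed.

Lemma free_hop0 B x : free_hop 0 B x = H B.
Proof.
rewrite -sum_ends /free_hop [LHS]big_mkcond [RHS]big_mkcond; apply: eq_bigr => E _.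
have [def_B|ne_B] := eqVneq (nat_ends E) B.
  have -> : reach 0 B E by rewrite /reach def_B addn0 eqxx; apply/forallP=> i; rewrite eqxx implybT.
  by rewrite -{1}def_B big1 ?mul1r // => i _; rewrite /walk_to leqnn subnn.
case: ifP => // rE; have [le_BE|nle] := boolP (below B E); last by rewrite walk_to_below ?mul0r.
case/eqP: ne_B; apply/ffunP=> i; have := reach_moved rE le_BE.
move/eqP; rewrite sum_nat_eq0 => /forallP/(_ i); rewrite inE.
case: (ltnP i a) => /= [ia|ia _]; last by rewrite (reach_out rE) // -leqNgt.
have /forallP/(_ i)/implyP/(_ ia) := le_BE; lia.
Qed.

(** Exchanging the end points of [i] and [j] preserves the product of walks, which start together,
    and changes the sign of [H]. End points are paired according to their order, which works in
    characteristic two as well. *)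
Lemma free_hop_coll k B x i j : (i < a)%N -> (j < a)%N -> i != j -> B i = B j ->
  free_hop k B x = 0.
Proof.
move=> ia ja ne_ij eq_B; pose sw E : ends := [ffun l => E (tperm i j l)].
have nat_sw E : nat_ends (sw E) = swap_at (nat_ends E) i j.
  by apply/ffunP=> l; rewrite !ffunE.
have swK : involutive sw by move=> E; apply/ffunP=> l; rewrite !ffunE tpermK.
have B_sw l : B (tperm i j l) = B l by case: tpermP => [->|->|].
have reach_sw E : reach k B (sw E) = reach k B E.
  rewrite /reach nat_sw; congr (_ && _).
    rewrite [in RHS](reindex_inj (@perm_inj _ (tperm i j))) /=.
    by congr (_ == _); apply: eq_bigr => l _; rewrite [swap_at _ _ _ _]ffunE.
  apply: eq_forallb => l; have [la|//] := leqP a l; rewrite ffunE tpermD //.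
    by apply: contraTneq la => <-; rewrite -ltnNge.
  by apply: contraTneq la => <-; rewrite -ltnNge.
rewrite /free_hop (bigID (fun E => (nat_ends E i < nat_ends E j)%N)) /=.
rewrite [X in _ + X](bigID (fun E => (nat_ends E j < nat_ends E i)%N)) /=.
rewrite [X in _ + (_ + X)]big1 ?addr0; last first.
  move=> E /andP[/andP[_ n1] n2]; rewrite (alt_coll H_alt ia ja ne_ij) ?mulr0 //; lia.
rewrite [X in _ + X](reindex_inj (inv_inj swK)) /=.
rewrite -[RHS](addrN (\sum_(E | reach k B E && (nat_ends E i < nat_ends E j)%N)
  (\prod_(i : 'I_D | (i < a)%N) walk_to (B i) (nat_ends E i) x) * H (nat_ends E))).
congr (_ + _); rewrite -sumrN; apply: eq_big => [E|E _].
  by rewrite reach_sw nat_sw !ffunE tpermL tpermR; case: ltngtP; rewrite ?andbT ?andbF.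
rewrite nat_sw (alt_swap H_alt _ ia ja ne_ij) mulrN; congr (- (_ * _)).
rewrite [RHS](reindex_inj (@perm_inj _ (tperm i j))) /=.
apply: eq_big => [l|l _]; first by rewrite tperm_lt.
by rewrite B_sw ffunE.
Qed.

(** If the hop passes [L] or lands on another row, both sides vanish. Otherwise the rows stay
    distinct and [Z_inj] keeps the new level [Z (B i)] away from the poles. *)
Lemma hop_add_free k B i :
  (forall C x, distinct C -> (forall j, (j < a)%N -> (C j < L)%N -> x != Z (C j)) ->
     hop k C x = free_hop k C x) ->
  distinct B -> (i < a)%N ->
  hop k (add_at B i 1) (Z (B i)) = free_hop k (add_at B i 1) (Z (B i)).
Proof.
move=> IHk dB ia; have [le_L|lt_L] := leqP L (B i).
  have [-> |/hop_supp/(_ i)] := eqVneq (hop k (add_at B i 1) (Z (B i))) 0; last first.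
    by rewrite add_atE addn1 ltnNge le_L.
  rewrite /free_hop big1 // => E _; rewrite (bigD1 i) //= /walk_to add_atE.
  by rewrite addn1 leqNgt ltnS (leq_trans (nat_ends_le E i)) // !mul0r.
have [/existsP[j /and3P[ja ne_ji /eqP eq_j]]|ncoll] :=
  boolP [exists j : 'I_D, [&& (j < a)%N, j != i & B j == (B i).+1]].
  have e : add_at B i 1 j = add_at B i 1 i by rewrite add_atE add_at_neq // eq_j addn1.
  by rewrite (alt_coll (hop_alt _ _) ja ia ne_ji) // (free_hop_coll _ _ ja ia ne_ji).
have ncollE j : (j < a)%N -> j != i -> B j <> (B i).+1.
  by move=> ja ne_ji e; case/existsP: ncoll; exists j; rewrite ja ne_ji e eqxx.
apply: IHk => [j l ja la|j ja].
  have [->|ne_j] := eqVneq j i; have [-> //|ne_l] := eqVneq l i.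
  - by rewrite add_atE add_at_neq // addn1 => /esym/(ncollE l la ne_l).
  - by rewrite add_atE add_at_neq // addn1 => /(ncollE j ja ne_j).
  by rewrite !add_at_neq // => /dB ->.
have [->|ne_j] := eqVneq j i.
  by rewrite add_atE addn1 => lt_Bi; apply/eqP=> /Z_inj e; have := e lt_L lt_Bi; lia.
rewrite add_at_neq // => lt_Bj; apply/eqP=> /Z_inj e.
by have /dB e' := e lt_L lt_Bj; rewrite e' ?eqxx // in ne_j.
Qed.

(** After the first hop the rest is free by induction; for a fixed end point the sum over the row
    that hops first is then [sum_first_hop]. *)
Lemma hop_free k B x : distinct B ->
    (forall i, (i < a)%N -> (B i < L)%N -> x != Z (B i)) ->
  hop k B x = free_hop k B x.
Proof.
elim: k B x => [|k IHk] B x dB xB; first by rewrite free_hop0.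
rewrite /=; under eq_bigr => i ia.
  rewrite (hop_add_free IHk) // /free_hop mulr_sumr.
  under eq_bigl => E do rewrite reach_add //.
  over.
rewrite (exchange_big_dep (reach k.+1 B)) //=; apply: eq_bigr => E rE.
rewrite -(sum_first_hop dB rE xB) mulr_suml; apply: eq_big => [i|i ia].
  by rewrite rE andbT.
by rewrite /first_hop; ring.
Qed.

(** The first hop of a block has no denominator in front of it, so the identity at infinity replaces
    the one at [x] and leaves a single moving row. *)
Lemma sum_hop_start k B : distinct B ->
  \sum_(i : 'I_D | (i < a)%N) beta (B i) * hop k (add_at B i 1) (Z (B i)) =
  \sum_(i : 'I_D | (i < a)%N) walk_start (B i) k.+1 * H (add_at B i k.+1).
Proof.
move=> dB; under eq_bigr => i ia.
  rewrite (hop_add_free (@hop_free k)) // /free_hop mulr_sumr.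
  under eq_bigl => E do rewrite reach_add //.
  over.
rewrite (exchange_big_dep (reach k.+1 B)) //=.
under [in RHS]eq_bigr => i ia do rewrite -sum_ends mulr_sumr.
rewrite [in RHS](exchange_big_dep (reach k.+1 B)) /=; last first.
  move=> i E ia /eqP def_E; apply/andP; split.
    rewrite def_E; apply/eqP; under eq_bigr do rewrite ffunE.
    rewrite big_split /=; congr (_ + _)%N.
    by rewrite (bigD1 i) //= eqxx mul1n big1 ?addn0 // => j /negPf ->.
  apply/forallP=> j; apply/implyP=> ja; rewrite def_E add_at_neq //.
  by apply: contraTneq ja => ->; rewrite -ltnNge.
apply: eq_bigr => E rE; rewrite -[in RHS]mulr_suml -(sum_first_hop_start dB rE).
rewrite mulr_suml; apply: eq_big => [i|i ia]; first by rewrite rE andbT.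
by rewrite /first_hop mulrA.
Qed.

End Hopping.

(** * Quantum integers of contents *)

Section QuantumContents.
Local Open Scope ring_scope.
Variables (F : fieldType) (q : F).
Hypothesis q_neq0 : q != 0.
Local Notation qi := (qint q).
Local Notation p := (q - q^-1).
Local Notation E k := ((q ^+ 2) ^ k).

Definition sqr_content (k : int) : F := qi k ^+ 2 / E k.
Local Notation Z := sqr_content.

Lemma qint0 : qi 0 = 0. Proof. exact: qnat0. Qed.

Lemma expz_opp k : E (- k) = (E k)^-1.
Proof. by rewrite invr_expz. Qed.

Lemma qint_opp k : qi (- k) = - qi k / E k.
Proof.
have nz := expfz2_neq0 q_neq0 k; apply: (mulIf nz); rewrite mulfVK //.
have e := qintN q_neq0 k; rewrite (qint_expz q_neq0).
by apply/eqP; rewrite -subr_eq0; apply/eqP; rewrite -[RHS]e; ring.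
Qed.

Lemma sqr_contentN k : Z (- k) = Z k.
Proof.
rewrite /Z qint_opp expz_opp; move: (E k) (expfz2_neq0 q_neq0 k) => e nz.
by field; rewrite nz oner_neq0.
Qed.

Lemma qint_double k : qi (k + k) = qi k * (1 + E k).
Proof. by rewrite (qintD q_neq0) (qint_expz q_neq0); ring. Qed.

Lemma qint_sub_add c b : qi (c - b) * qi (c + b) = E c * (Z c - Z b).
Proof.
rewrite !(qintD q_neq0) qint_opp /Z.
have := expfz2_neq0 q_neq0 c; have := expfz2_neq0 q_neq0 b.
rewrite !(qint_expz q_neq0); move: (q - q^-1) => r nzb nzc.
by field; rewrite nzb nzc.
Qed.

Lemma sqr_content_neq c b : qi (c - b) != 0 -> qi (c + b) != 0 -> Z c - Z b != 0.
Proof.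
move=> n1 n2; have := mulf_neq0 n1 n2; rewrite qint_sub_add.
by apply: contraNneq => ->; rewrite mulr0.
Qed.

(** The sum over the contents [c] and [- c] of a pair, when what follows depends on [c] through
    [Z c] only; the minus sign is the oddness of [alpha]. *)
Lemma sn_diag_even y c : qi (y - c) != 0 -> qi (y + c) != 0 ->
  sn_diag q (y - c) - sn_diag q (y + c) = - (qi (c + c) / E c) / (Z y - Z c).
Proof.
move=> n1 n2; have n3 := sqr_content_neq n1 n2.
have e := qint_sub_add y c.
have nzy := expfz2_neq0 q_neq0 y; have nzc := expfz2_neq0 q_neq0 c.
have -> : (Z y - Z c)^-1 = E y / (qi (y - c) * qi (y + c)).
  by rewrite e; field; rewrite nzy n3.
rewrite /sn_diag qint_double.
have -> : -1 / qi (y - c) - -1 / qi (y + c) =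
   (qi (y - c) - qi (y + c)) / (qi (y - c) * qi (y + c)).
  by field; rewrite n1 n2.
rewrite mulrA; congr (_ / _).
rewrite !(qintD q_neq0) qint_opp; move: nzc; rewrite !(qint_expz q_neq0).
by move: (q - q^-1) => r nzc; field.
Qed.

(** The same sum when what follows carries the factor [[c] / E c], whose value at [- c] is [- [c]].
    The factor reappears on the right with [y] in place of [c], so it propagates through a block. *)
Lemma sn_diag_odd y c : qi (y - c) != 0 -> qi (y + c) != 0 ->
  sn_diag q (y - c) * (qi c / E c) + sn_diag q (y + c) * qi c =
  - (qi (c + c) / E c) / (Z y - Z c) * (qi y / E y).
Proof.
move=> n1 n2; have n3 := sqr_content_neq n1 n2.
have e := qint_sub_add y c.
have nzy := expfz2_neq0 q_neq0 y; have nzc := expfz2_neq0 q_neq0 c.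
have -> : (Z y - Z c)^-1 = E y / (qi (y - c) * qi (y + c)).
  by rewrite e; field; rewrite nzy n3.
rewrite /sn_diag qint_double.
have -> : -1 / qi (y - c) * (qi c / E c) + -1 / qi (y + c) * qi c =
   - qi c / E c * (qi (y + c) + qi (y - c) * E c) / (qi (y - c) * qi (y + c)).
  by field; rewrite n1 n2 nzc.
have -> : qi (y + c) + qi (y - c) * E c = qi y * (1 + E c).
  rewrite !(qintD q_neq0) qint_opp; move: nzc; rewrite !(qint_expz q_neq0).
  by move: (q - q^-1) => r nzc; field.
by field; rewrite n1 n2 nzc nzy.
Qed.

End QuantumContents.

(** * The sign of a rearrangement *)

Section AlternatingIndicator.
Local Open Scope ring_scope.
Variables (F : fieldType) (D : nat) (mu : {ffun 'I_D -> nat}).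
Local Notation config := {ffun 'I_D -> nat}.

Definition match_mx (e : config) : 'M[F]_D := \matrix_(i, j) (e i == mu j)%:R.
(** When [mu] is strictly decreasing, this is the sign of the permutation that takes [e] to [mu], or
    0 if [e] is not a rearrangement of [mu]. *)
Definition alt_indicator (e : config) : F := \det (match_mx e).

Lemma alt_indicator_swap e i j : i != j ->
  alt_indicator (swap_at e i j) = - alt_indicator e.
Proof.
move=> ne_ij; rewrite /alt_indicator.
have -> : match_mx (swap_at e i j) = row_perm (tperm i j) (match_mx e).
  by apply/matrixP=> k l; rewrite !mxE ffunE.
by rewrite row_permE det_mulmx det_perm odd_tperm ne_ij mulN1r.
Qed.

Lemma alt_indicator_coll (e : config) i j : i != j -> e i = e j -> alt_indicator e = 0.
Proof.
by move=> ne_ij eq_e; apply: (determinant_alternate ne_ij) => k; rewrite !mxE eq_e.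
Qed.

Lemma alt_indicator_hit (e : config) i : alt_indicator e != 0 -> exists j, e i = mu j.
Proof.
move=> nz; have [/existsP[j /eqP e_j]|nex] := boolP [exists j, e i == mu j].
  by exists j.
case/eqP: nz; rewrite /alt_indicator (expand_det_row _ i) big1 // => j _.
rewrite mxE; case: eqP => [e_j|]; last by rewrite mul0r.
by case/existsP: nex; exists j; rewrite e_j.
Qed.

Hypothesis mu_decr : forall i j : 'I_D, (i < j)%N -> (mu j < mu i)%N.

(** Only the identity contributes to the determinant: a permutation that matches two strictly
    decreasing sequences is increasing. *)
Lemma alt_indicator_decr (e : config) : (forall i j : 'I_D, (i < j)%N -> (e j < e i)%N) ->
  alt_indicator e = (e == mu)%:R.
Proof.
move=> e_decr; rewrite /alt_indicator /determinant (bigD1 1%g) //= [X in _ + X]big1 ?addr0.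
  rewrite odd_perm1 expr0 mul1r; case: eqP => [->|ne].
    by rewrite big1 // => i _; rewrite mxE perm1 eqxx.
  have [i ne_i] : exists i, e i != mu i.
    apply/existsP; rewrite -negb_forall; apply/forallP=> eq_e.
    by case: ne; apply/ffunP=> i; apply/eqP.
  by rewrite (bigD1 i) //= mxE perm1 (negPf ne_i) mul0r.
move=> s ne_s; have [/forallP eq_e|] := boolP [forall i, e i == mu (s i)].
  case/eqP: ne_s; apply: no_descent => i.
  have := e_decr (Ordinal (ord_pred_ltn i)) (Ordinal (ord_pred_ltnS i)) (ltnSn i).
  rewrite (eqP (eq_e _)) (eqP (eq_e (Ordinal (ord_pred_ltn i)))).
  move=> lt_mu; case: ltngtP => // [/mu_decr lt'|/ord_inj e'].
    by have := ltn_trans lt_mu lt'; rewrite ltnn.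
  by rewrite e' ltnn in lt_mu.
case/forallPn=> i ne_i; rewrite (bigD1 i) //= mxE (negPf ne_i) mul0r mulr0 //.
Qed.

Lemma alt_indicator_perm (e : config) : alt_indicator e != 0 ->
  (alt_indicator e = 1 \/ alt_indicator e = -1) /\ perm_eq (codom e) (codom mu).
Proof.
move=> nz; have inj_e : injective e.
  move=> i j eq_e; apply/eqP; apply: contraNT nz => ne_ij.
  by apply/eqP; apply: alt_indicator_coll ne_ij eq_e.
have inj_mu : injective mu.
  by move=> i j eq_mu; case: (ltngtP i j) => [/mu_decr|/mu_decr|/ord_inj//];
     rewrite eq_mu ltnn.
have ex_s i : exists j, e i == mu j.
  by have [j ->] := alt_indicator_hit i nz; exists j.
pose s0 i := xchoose (ex_s i).
have s0P i : e i = mu (s0 i) by apply/eqP/(xchooseP (ex_s i)).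
have inj_s : injective s0 by move=> i j eq_s; apply: inj_e; rewrite !s0P eq_s.
pose s := perm inj_s.
have def_mx : match_mx e = perm_mx s.
  apply/matrixP=> i j; rewrite !mxE s0P (inj_eq inj_mu) permE.
  by rewrite eq_sym.
split; first by rewrite /alt_indicator def_mx det_perm; case: (odd_perm s); [right|left].
have -> : codom e = [seq mu i | i <- map s (enum 'I_D)].
  by rewrite -map_comp; apply: eq_map => i; rewrite /= permE s0P.
apply: perm_map; apply: uniq_perm; rewrite ?enum_uniq //.
  by rewrite map_inj_uniq ?enum_uniq //; apply: perm_inj.
move=> i; rewrite mem_enum; apply/mapP; exists ((s^-1)%g i); rewrite ?mem_enum //.
by rewrite permKV.
Qed.

End AlternatingIndicator.

(** * Signed fillings of shifted shapes *)

Section LegalMoves.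
Local Open Scope ring_scope.
Variable D : nat.
Local Notation config := {ffun 'I_D -> nat}.
Implicit Types (B : config) (i j r : 'I_D) (a : nat).

Definition legal B r : bool :=
  [forall r' : 'I_D, (r'.+1 == r :> nat) ==> (B r + 1 < B r')%N].

(** Row lengths of a shifted diagram with exactly [a] nonempty rows. *)
Record good a B : Prop := Good {
  good_le : (a <= D)%N;
  good_decr : forall i j, (i < j)%N -> (j < a)%N -> (B j < B i)%N;
  good_gt0 : forall i, (i < a)%N -> (0 < B i)%N;
  good_out : forall i, (a <= i)%N -> B i = 0%N
}.

Lemma legal_lt a B r i : good a B -> legal B r -> (r <= a)%N -> (i < r)%N ->
  (B r + 1 < B i)%N.
Proof.
move=> gB /forallP leg ra ir.
have lt_D : (r.-1 < D)%N by have := ltn_ord r; lia.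
have := leg (Ordinal lt_D); rewrite /= prednK ?eqxx /=; last by lia.
have [->//|ne] := eqVneq i (Ordinal lt_D).
have := good_decr gB (i := i) (j := Ordinal lt_D).
by rewrite -val_eqE /= in ne *; lia.
Qed.

(** The row above is longer than [B r] and, the step being illegal, not longer than [B r + 1]. The
    step thus creates a collision, which is why sums over legal rows extend to all rows for
    alternating functions. *)
Lemma illegal_coll a B r : good a B -> ~~ legal B r -> (r <= a)%N ->
  exists i, [/\ (i < r)%N, i != r & B i = (B r + 1)%N].
Proof.
move=> gB /forallPn[i]; rewrite negb_imply -leqNgt => /andP[/eqP ir le_i] ra.
exists i; split; first by rewrite -ir.
  by rewrite -val_eqE /=; lia.
have [lt_ra|ge_ra] := ltnP r a.
  by have := good_decr gB (i := i) (j := r); lia.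
rewrite (good_out gB ge_ra) in le_i *.
by have := good_gt0 gB (i := i); lia.
Qed.

Lemma add_at_lt B i r d : (i < r)%N -> add_at B r d i = B i.
Proof. by move=> ir; rewrite add_at_neq // -val_eqE /=; lia. Qed.

Lemma add_at_gt B i r d : (r < i)%N -> add_at B r d i = B i.
Proof. by move=> ir; rewrite add_at_neq // -val_eqE /=; lia. Qed.

Lemma good_add_gen a a' B r : good a B -> legal B r -> (r <= a)%N ->
  (r < a')%N -> (a <= a')%N -> (a' <= maxn a r.+1)%N -> good a' (add_at B r 1).
Proof.
move=> gB leg ra ra' aa' le_a'; split=> [|i j ij ja|i ia|i ia].
- by rewrite (leq_trans le_a') // geq_max (good_le gB) ltn_ord.
- have [jr|rj|/ord_inj ejr] := ltngtP j r.
  + by rewrite !add_at_lt ?(ltn_trans ij) // (good_decr gB) // (leq_trans jr).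
  + rewrite add_at_gt //; apply: leq_trans (_ : B i <= _)%N; last by rewrite ffunE leq_addr.
    by rewrite (good_decr gB) //; move: le_a'; lia.
  rewrite ejr add_atE in ij *; rewrite add_at_lt //.
  exact: legal_lt gB leg ra ij.
- have [->|ne] := eqVneq i r; first by rewrite add_atE addn1.
  rewrite add_at_neq // (good_gt0 gB) //; rewrite -val_eqE /= in ne; lia.
rewrite add_at_gt ?(good_out gB) //; lia.
Qed.

Lemma good_add a B r : good a B -> legal B r -> (r < a)%N -> good a (add_at B r 1).
Proof. by move=> gB leg ra; apply: good_add_gen gB leg _ _ _ _; lia. Qed.

Lemma good_inject a B r : good a B -> legal B r -> r = a :> nat ->
  good a.+1 (add_at B r 1).
Proof. by move=> gB leg ra; apply: good_add_gen gB leg _ _ _ _; lia. Qed.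

Lemma good_zero a B r : good a B -> (B r == 0)%N = (a <= r)%N.
Proof.
move=> gB; have [ar|ra] := leqP a r; first by rewrite (good_out gB ar).
by have := good_gt0 gB ra; lia.
Qed.

Lemma legal_inject a B r : good a B -> legal B r && (B r == 0)%N =
  (r == a :> nat) && legal B r.
Proof.
move=> gB; rewrite (good_zero _ gB) andbC; have [leg|] := boolP (legal B r); last by rewrite !andbF.
rewrite !andbT; apply/idP/eqP => [ar|->//].
apply/eqP; rewrite eqn_leq ar andbT leqNgt; apply/negP => lt_ar.
have lt_D : (a < D)%N by apply: ltn_trans lt_ar _.
have lt_D' : (r.-1 < D)%N by have := ltn_ord r; lia.
have /forallP/(_ (Ordinal lt_D')) := leg; rewrite /= prednK ?eqxx /=; last by lia.
by rewrite (good_out gB (i := Ordinal lt_D')) //=; lia.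
Qed.

Lemma sum_rows (F : zmodType) a B (f : 'I_D -> F) : good a B ->
    (forall r, (r <= a)%N -> ~~ legal B r -> f r = 0) ->
  \sum_(r : 'I_D | (r < a.+1)%N) f r =
  \sum_(r : 'I_D | legal B r && (B r == 0)%N) f r +
  \sum_(r : 'I_D | legal B r && (B r != 0)%N) f r.
Proof.
move=> gB f0; rewrite -bigID /=.
rewrite [LHS]big_mkcond [RHS]big_mkcond; apply: eq_bigr => r _.
rewrite ltnS; case: (leqP r a) => ra.
  by case: ifP => // /negbT; apply: f0.
case: ifP => // leg; have := legal_inject r gB; rewrite leg /=.
by rewrite (good_zero _ gB) ltnW //; case: eqP => // e; rewrite e ltnn in ra.
Qed.

Lemma sum_rows_lt (F : zmodType) a B (f : 'I_D -> F) : good a B ->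
    (forall r, (r < a)%N -> ~~ legal B r -> f r = 0) ->
  \sum_(r : 'I_D | (r < a)%N) f r =
  \sum_(r : 'I_D | legal B r && (B r != 0)%N) f r.
Proof.
move=> gB f0.
rewrite [LHS]big_mkcond [RHS]big_mkcond; apply: eq_bigr => r _.
rewrite (good_zero _ gB) -ltnNge; case: ltnP => ra; last by rewrite andbF.
by rewrite andbT; case: ifP => // /negbT; apply: f0.
Qed.

End LegalMoves.

(** * Summation of the fillings block by block *)

Section Blocks.
Local Open Scope ring_scope.
Variables (F : fieldType) (q im : F) (sq : nat -> F) (n : nat).
Hypothesis fd : field_data q n im sq.
Variables (D : nat) (mu : {ffun 'I_D -> nat}) (L : nat).
Hypothesis mu_decr : forall i j : 'I_D, (i < j)%N -> (mu j < mu i)%N.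
Hypothesis mu_gt0 : forall i, (0 < mu i)%N.
Hypothesis mu_le : forall i, (mu i <= L)%N.
Hypothesis L_le : (L.*2 <= n.+1)%N.
Local Notation config := {ffun 'I_D -> nat}.
Implicit Types (B : config) (i j r : 'I_D) (a k m : nat) (ks : seq nat) (y : int).

Let q_neq0 := fd_q fd.
Local Notation qi := (qint q).
Local Notation E k := ((q ^+ 2) ^ k).
Local Notation Zi := (sqr_content q).
Local Notation al := (alpha q im sq).

Definition content_level (c : nat) : F := Zi c%:Z.
Local Notation Z := content_level.
(** The numerator left by lengthening a row from [c] to [c.+1] after summation over both signs. The
    value at 0 is the numerator of [-1 / [y]], the weight of a diagonal entry linked to an entry of
    content [y]. *)
Definition hop_weight (c : nat) : F :=
  if c == 0 then -1 else - (al (c%:Z + c%:Z) * (qi (c%:Z + c%:Z) / E c%:Z)).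
Local Notation beta := hop_weight.

Lemma content_level_inj (b c : nat) : (b < L)%N -> (c < L)%N -> Z b = Z c -> b = c.
Proof.
move=> ltb ltc eqZ; apply/eqP; apply: contraT => ne.
have n1 : qi (b%:Z - c%:Z) != 0.
  by apply: (qint_neq0 q_neq0 fd); rewrite /small; lia.
have n2 : qi (b%:Z + c%:Z) != 0.
  by apply: (qint_neq0 q_neq0 fd); rewrite /small; lia.
by have := sqr_content_neq q_neq0 n1 n2; rewrite -/(Z b) -/(Z c) eqZ subrr eqxx.
Qed.

Definition link_weight (lk : bool) (y c : int) : F :=
  if lk then sn_diag q (y - c) else 1.
Local Notation lw := link_weight.

(* Signed sum over all ways of completing the shifted shape [B] to [mu]: every
   step adds a box of content [c] to a row, standing for one entry on the
   diagonal when [c = 0], and for two entries with contents [c, -c] or [-c, c]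
   otherwise.  The flags tell which consecutive entries are linked by a
   generator, and [y] is the content of the entry that precedes. *)
Fixpoint fill (lk : bool) (gs : seq bool) (y : int) (B : config) : F :=
  if gs is g :: gs' then
    \sum_(r | legal B r && (B r == 0)) lw lk y 0 * fill g gs' 0 (add_at B r 1) +
    (if gs' is g' :: gs'' then
       if g then
         \sum_(r | legal B r && (B r != 0))
           (lw lk y (B r)%:Z * al ((B r)%:Z + (B r)%:Z) *
              fill g' gs'' (B r)%:Z (add_at B r 1) +
            lw lk y (- (B r)%:Z) * al (- ((B r)%:Z + (B r)%:Z)) *
              fill g' gs'' (- (B r)%:Z) (add_at B r 1))
       else 0
     else 0)
  else (B == mu)%:R.

Lemma fill_supp lk gs y B : fill lk gs y B != 0 -> forall i, (B i <= mu i)%N.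
Proof.
have [k] := ubnP (size gs); elim: k lk gs y B => // k IHk lk gs y B lt_k.
case: gs lt_k => [|g gs'] /= lt_k.
  by have [->|] := eqVneq B mu; rewrite ?eqxx.
move=> nz i; rewrite leqNgt; apply/negP => lt_i; case/eqP: nz.
have IH lk' gs0 y' r : (size gs0 < k)%N -> fill lk' gs0 y' (add_at B r 1) = 0.
  move=> lt_gs; apply/eqP; apply: contraLR lt_i => /(IHk _ _ _ _ lt_gs)/(_ i).
  by rewrite -leqNgt; apply: leq_trans; rewrite ffunE leq_addr.
rewrite big1 ?add0r => [|r _]; last by rewrite IH ?mulr0.
case: gs' lt_k IH => // g' gs'' /= lt_k IH; case: g => //.
by rewrite big1 // => r _; rewrite !IH ?mulr0 ?addr0 // ltnW.
Qed.

(** For odd [m], the number of boxes that one diagonal entry and [m./2] pairs add, hence the length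
    of the shifted row with hook [m]. *)
Definition half_up (m : nat) : nat := m.+1./2.
(** The minus sign is due to the first box of a block, which is linked to nothing before it and has
    weight [- beta]. *)
Definition block_weight (m : nat) : F := - walk_start Z beta 0 (half_up m).
(** The final shape if each remaining block opens one row and completes it at once; its rows need
    not be in decreasing order. *)
Definition mix a ks B : config :=
  [ffun i : 'I_D => if (i < a)%N then B i else half_up (nth 0%N ks (i - a))].

(* The value of [fill] at the beginning of a block. *)
Definition closed_fill ks a B : F :=
  if [&& (a + size ks == D)%N, all odd ks &
         [forall i : 'I_D, (0 < B i)%N == (i < a)%N]] then
    (\prod_(m <- ks) block_weight m) * alt_indicator F mu (mix a ks B)
  else 0.

Lemma closed_fill_alt ks a : alternating_upto a (closed_fill ks a).
Proof.
have mix_swap B i j : (i < a)%N -> (j < a)%N ->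
    mix a ks (swap_at B i j) = swap_at (mix a ks B) i j.
  move=> ia ja; apply/ffunP=> l; rewrite !ffunE tperm_lt //.
  by case: ltnP => // al'; rewrite tpermD // -val_eqE /=; lia.
split=> B i j ia ja ne_ij; rewrite /closed_fill.
  have -> : [forall l : 'I_D, (0 < swap_at B i j l)%N == (l < a)%N] =
            [forall l : 'I_D, (0 < B l)%N == (l < a)%N].
    apply/forallP/forallP => pos l; have := pos (tperm i j l);
      by rewrite ?ffunE ?tpermK tperm_lt.
  by case: ifP => _; rewrite ?oppr0 // mix_swap // alt_indicator_swap // mulrN.
move=> eq_B; case: ifP => // _.
by rewrite (alt_indicator_coll _ _ ne_ij) ?mulr0 // !ffunE ia ja.
Qed.

Lemma closed_fill_supp ks a B : closed_fill ks a B != 0 -> forall i, (B i <= L)%N.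
Proof.
rewrite /closed_fill; case: ifP; rewrite ?eqxx // => /and3P[_ _ /forallP pos].
rewrite mulf_eq0 negb_or => /andP[_ nz] i; have [j] := alt_indicator_hit i nz.
rewrite ffunE; have := pos i; case: (ltnP i a) => _; first by move=> _ ->; apply: mu_le.
by move=> + _; case: (B i).
Qed.

Definition mid k ks : seq bool :=
  if k is k'.+1 then nseq k' true ++ false :: links ks else links ks.

Lemma midS k ks : mid k.+1 ks = (0 < k)%N :: mid k ks.
Proof. by case: k. Qed.

Lemma links_cons m ks : (0 < m)%N -> links (m :: ks) = mid m ks.
Proof. by case: m => // m _; rewrite /links /= -catA. Qed.

Lemma fill_midS lk k ks y B : fill lk (mid k.+1 ks) y B =
  \sum_(r | legal B r && (B r == 0)%N)
     lw lk y 0 * fill (0 < k)%N (mid k ks) 0 (add_at B r 1) +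
  (if k is k'.+1 then
     \sum_(r | legal B r && (B r != 0)%N)
       (lw lk y (B r)%:Z * al ((B r)%:Z + (B r)%:Z) *
          fill (0 < k')%N (mid k' ks) (B r)%:Z (add_at B r 1) +
        lw lk y (- (B r)%:Z) * al (- ((B r)%:Z + (B r)%:Z)) *
          fill (0 < k')%N (mid k' ks) (- (B r)%:Z) (add_at B r 1))
   else 0).
Proof.
rewrite midS; case: k => [|k]; last by rewrite midS.
by rewrite /=; congr (_ + _); case: (links ks).
Qed.

Local Notation hopc a ks := (hop Z beta a (closed_fill ks a)).

Lemma hopc_supp a ks k B x : hopc a ks k B x != 0 -> forall i, (B i <= L)%N.
Proof. exact: hop_supp (@closed_fill_supp ks a) _ _ _. Qed.

Lemma hopc_illegal a a' ks k B x r : good a B -> ~~ legal B r -> (r <= a)%N ->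
  (r < a')%N -> hopc a' ks k (add_at B r 1) x = 0.
Proof.
move=> gB nleg ra ra'; have [i [ir ne_i e]] := illegal_coll gB nleg ra.
have ia' : (i < a')%N by apply: ltn_trans ra'.
apply: (alt_coll (hop_alt Z beta (closed_fill_alt ks a') k x) ia' ra' ne_i).
by rewrite add_atE add_at_neq.
Qed.

(** A block that hops on [a.+1] rows cannot end without having opened row [a]. *)
Lemma closed_fill_good ks a B : good a B -> closed_fill ks a.+1 B = 0.
Proof.
move=> gB; rewrite /closed_fill; case: ifP => // /and3P[/eqP eD _ /forallP pos].
have aD : (a < D)%N by lia.
by have := pos (Ordinal aD); rewrite (good_out gB) //= ltnSn.
Qed.

(** The expected sum when [k] entries of the block remain after one of content [y]. An odd [k] asks
    for one more diagonal entry, hence [a.+1] rows; the factor [[y] / E y] comes from opening the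
    row, is reproduced by pairs, and vanishes at [y = 0], which excludes a second diagonal entry. *)
Definition mid_fill ks k a y B : F :=
  if odd k then qi y / E y * hopc a.+1 ks k.+1./2 B (Zi y)
  else hopc a ks k./2 B (Zi y).

(** The row of length [|y| + 1] is the one that has just received the preceding entry. Legality of
    [r] then excludes [B r = |y|], and the bound on [L] keeps [|y| + B r] below [n]. *)
Lemma content_neq0 a B r y : good a B -> (exists i, (i < a)%N /\ B i = `|y|.+1) ->
  (forall i, (B i <= L)%N) -> legal B r -> (B r != 0)%N -> (B r < L)%N ->
  qi (y - (B r)%:Z) != 0 /\ qi (y + (B r)%:Z) != 0.
Proof.
move=> gB [i [ia e_i]] le_L leg nz_r lt_r.
have ra : (r < a)%N by rewrite ltnNge -(good_zero _ gB).
have := le_L i; rewrite e_i => lt_y.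
have ne : `|y|%N != B r.
  apply/eqP=> e; have [lt_ir|lt_ri|/ord_inj e'] := ltngtP i r.
  - by have := legal_lt gB leg (ltnW ra) lt_ir; lia.
  - by have := good_decr gB lt_ri ia; lia.
  by move: e_i; rewrite e' e; lia.
by split; apply: (qint_neq0 q_neq0 fd); rewrite /small; lia.
Qed.

(** Here [h] stands for the rest of the filling. It vanishes when the lengthened row [r] exceeds
    [L], so the denominators matter only for [B r < L]. *)
Lemma pair_even a B r y h : good a B -> (exists i, (i < a)%N /\ B i = `|y|.+1) ->
  (forall i, (B i <= L)%N) -> legal B r -> (B r != 0)%N -> (h != 0 -> (B r < L)%N) ->
  sn_diag q (y - (B r)%:Z) * al ((B r)%:Z + (B r)%:Z) * h +
  sn_diag q (y - - (B r)%:Z) * al (- ((B r)%:Z + (B r)%:Z)) * h =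
  beta (B r) / (Zi y - Z (B r)) * h.
Proof.
move=> gB ex_i le_L leg nz; have [->|nzh /(_ isT) lt_r] := eqVneq h 0.
  by rewrite !mulr0 addr0.
have [n1 n2] := content_neq0 gB ex_i le_L leg nz lt_r.
rewrite (alphaN fd) opprK /hop_weight (negPf nz) /content_level.
have e := sn_diag_even q_neq0 n1 n2.
transitivity (al ((B r)%:Z + (B r)%:Z) * h *
  (sn_diag q (y - (B r)%:Z) - sn_diag q (y + (B r)%:Z))); first by ring.
by rewrite e; ring.
Qed.

Lemma pair_odd a B r y h : good a B -> (exists i, (i < a)%N /\ B i = `|y|.+1) ->
  (forall i, (B i <= L)%N) -> legal B r -> (B r != 0)%N -> (h != 0 -> (B r < L)%N) ->
  sn_diag q (y - (B r)%:Z) * al ((B r)%:Z + (B r)%:Z) *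
     (qi (B r)%:Z / E (B r)%:Z * h) +
  sn_diag q (y - - (B r)%:Z) * al (- ((B r)%:Z + (B r)%:Z)) *
     (qi (- (B r)%:Z) / E (- (B r)%:Z) * h) =
  qi y / E y * (beta (B r) / (Zi y - Z (B r)) * h).
Proof.
move=> gB ex_i le_L leg nz; have [->|nzh /(_ isT) lt_r] := eqVneq h 0.
  by rewrite !mulr0 addr0.
have [n1 n2] := content_neq0 gB ex_i le_L leg nz lt_r.
rewrite (alphaN fd) opprK /hop_weight (negPf nz) /content_level.
rewrite (qint_opp q_neq0) (expz_opp q) invrK.
have e := sn_diag_odd q_neq0 n1 n2.
have nzE := expfz2_neq0 q_neq0 (B r)%:Z.
rewrite mulfVK //.
transitivity (al ((B r)%:Z + (B r)%:Z) * h *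
  (sn_diag q (y - (B r)%:Z) * (qi (B r)%:Z / E (B r)%:Z) +
   sn_diag q (y + (B r)%:Z) * qi (B r)%:Z)); first by ring.
by rewrite e; ring.
Qed.

Lemma inject_weight y h :
  sn_diag q (y - 0) * h = qi y / E y * (beta 0%N / (Zi y - Z 0%N) * h).
Proof.
have Z0 : Z 0%N = 0 by rewrite /content_level /sqr_content qint0 expr0n mul0r.
rewrite subr0 Z0 subr0 /hop_weight eqxx.
rewrite /sqr_content /sn_diag; have nzE := expfz2_neq0 q_neq0 y.
(* If [[y] = 0], both sides are 0 because the inverse of 0 is 0. *)
have [->|nz] := eqVneq (qi y) 0; first by rewrite invr0 !mulr0 !mul0r.
by field; rewrite nz nzE.
Qed.

Section Block.
Variable ks : seq nat.
Hypothesis IHks : forall a B y, good a B ->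
  fill false (links ks) y B = closed_fill ks a B.

Lemma fill_mid k a B y : good a B -> (exists i, (i < a)%N /\ B i = `|y|.+1) ->
  fill (0 < k)%N (mid k ks) y B = mid_fill ks k a y B.
Proof.
have [m] := ubnP k; elim: m k a B y => // m IHm k a B y lt_k gB ex_i.
case: k lt_k => [|k] lt_k; first by rewrite /mid_fill /= (IHks _ gB).
have [/forallP le_L|] := boolP [forall i, (B i <= L)%N]; last first.
  case/forallPn=> i; rewrite -ltnNge => lt_i.
  have hop0 a' k' x : hopc a' ks k' B x = 0.
    by apply/eqP; apply: contraLR lt_i => /hopc_supp; rewrite -leqNgt.
  rewrite /mid_fill !hop0 mulr0 if_same; apply/eqP.
  apply: contraLR lt_i => /fill_supp/(_ i) le_i.
  by rewrite -leqNgt (leq_trans le_i).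
have inject r : legal B r && (B r == 0)%N -> fill (0 < k)%N (mid k ks) 0 (add_at B r 1) =
    mid_fill ks k a.+1 0 (add_at B r 1).
  move=> lB; have := lB; rewrite (legal_inject _ gB) => /andP[/eqP ra leg].
  apply: IHm => //; first exact: good_inject.
  exists r; rewrite ra ltnSn add_atE; split=> //.
  by have /andP[_ /eqP->] := lB.
have pair k' r (e : bool) : k = k'.+1 -> legal B r && (B r != 0)%N ->
    fill (0 < k')%N (mid k' ks) (if e then - (B r)%:Z else (B r)%:Z) (add_at B r 1) =
    mid_fill ks k' a (if e then - (B r)%:Z else (B r)%:Z) (add_at B r 1).
  move=> def_k /andP[leg nz]; have ra : (r < a)%N by rewrite ltnNge -(good_zero _ gB).
  apply: IHm; [by rewrite def_k in lt_k; lia | exact: good_add |].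
  by exists r; rewrite ra add_atE addn1; split=> //; case: e; rewrite ?abszN.
have nz_lt a' k' r x : hopc a' ks k' (add_at B r 1) x != 0 -> (B r < L)%N.
  by move/hopc_supp/(_ r); rewrite add_atE addn1.
rewrite fill_midS /=.
rewrite (eq_bigr _ (fun r lB => congr1 _ (inject r lB))).
have [odd_k|even_k] := boolP (odd k).
  have [k' def_k] : exists k', k = k'.+1 by case: (k) odd_k => // k' _; exists k'.
  (* Opening a row here would leave an odd number of entries after content 0, and [mid_fill] then
     has the factor [[0]]. *)
  rewrite big1 ?add0r => [|r _]; last by rewrite /mid_fill odd_k qint0 !mul0r mulr0.
  have even_k' : ~~ odd k' by move: odd_k; rewrite def_k.
  rewrite /mid_fill [odd k.+1]/= odd_k /=.
  have -> : uphalf k = k'./2.+1 by rewrite def_k.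

  subst k; rewrite [hop _ _ _ _ _ _ _]/= (sum_rows_lt gB) => [|r ra nleg]; last first.
    by rewrite (hopc_illegal _ _ _ gB nleg (ltnW ra)) ?mulr0.
  apply: eq_bigr => r lB; have /andP[leg nz] := lB.
  have := pair k' r false erefl lB; have := pair k' r true erefl lB.
  rewrite /mid_fill (negPf even_k') sqr_contentN // -/(Z _) => -> ->.
  by apply: pair_even gB ex_i le_L leg nz _; apply: nz_lt.
rewrite /mid_fill [odd k.+1]/= even_k /=.
rewrite (sum_rows gB) => [|r ra nleg]; last first.
  by rewrite (hopc_illegal _ _ _ gB nleg) // mulr0.
rewrite mulrDr !mulr_sumr; congr (_ + _).
  apply: eq_bigr => r /andP[_ /eqP Br]; rewrite Br (negPf even_k).
  exact: inject_weight.
case def_k : k => [|k'].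
  (* With a single entry left no pair fits, and the corresponding hops end without a new row. *)
  rewrite big1 // => r /andP[leg nz].
  have ra : (r < a)%N by rewrite ltnNge -(good_zero _ gB).
  by rewrite /= (closed_fill_good _ (good_add gB leg ra)) !mulr0.
have odd_k' : odd k' by move: even_k; rewrite def_k /= negbK.
apply: eq_bigr => r lB; have /andP[leg nz] := lB.
have := pair k' r false def_k lB; have := pair k' r true def_k lB.
rewrite /mid_fill odd_k' sqr_contentN // -/(Z _) => -> ->.
by apply: pair_odd gB ex_i le_L leg nz _; apply: nz_lt.
Qed.

(** The first entry has no link to its predecessor. In a block of odd size this gives the
    hypothesis-free first hop of [sum_hop_start]; in one of even size it lets the two signs
    cancel. *)
Lemma fill_block m a B y : (0 < m)%N -> good a B ->
  fill false (links (m :: ks)) y B = closed_fill (m :: ks) a B.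
Proof.
case: m => // k _ gB; rewrite links_cons // fill_midS /link_weight.
have inject r : legal B r && (B r == 0)%N -> fill (0 < k)%N (mid k ks) 0 (add_at B r 1) =
    mid_fill ks k a.+1 0 (add_at B r 1).
  move=> lB; have := lB; rewrite (legal_inject _ gB) => /andP[/eqP ra leg].
  apply: fill_mid => //; first exact: good_inject.
  exists r; rewrite ra ltnSn add_atE; split=> //.
  by have /andP[_ /eqP->] := lB.
have pair k' r (e : bool) : legal B r && (B r != 0)%N ->
    fill (0 < k')%N (mid k' ks) (if e then - (B r)%:Z else (B r)%:Z) (add_at B r 1) =
    mid_fill ks k' a (if e then - (B r)%:Z else (B r)%:Z) (add_at B r 1).
  move=> /andP[leg nz]; have ra : (r < a)%N by rewrite ltnNge -(good_zero _ gB).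
  apply: fill_mid; first exact: good_add.
  by exists r; rewrite ra add_atE addn1; split=> //; case: e; rewrite ?abszN.
rewrite (eq_bigr _ (fun r lB => congr1 _ (inject r lB))).
have [odd_k|even_k] := boolP (odd k).
  have [k' def_k] : exists k', k = k'.+1 by case: (k) odd_k => // k' _; exists k'.
  rewrite big1 ?add0r => [|r _]; last by rewrite /mid_fill odd_k qint0 !mul0r mulr0.
  have even_k' : ~~ odd k' by move: odd_k; rewrite def_k.
  (* Even size: a pair with contents [c] and [- c] has weights [alpha] of opposite sign, followed by
     equal sums, since these depend on [Z c] only. *)
  subst k; rewrite [RHS](_ : _ = 0); last first.
    by rewrite /closed_fill /= (negPf even_k') /= andbF.
  rewrite big1 // => r lB.
  have := pair k' r false lB; have := pair k' r true lB.
  rewrite /mid_fill (negPf even_k') sqr_contentN // => -> ->.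
  by rewrite !mul1r (alphaN fd) mulNr addrN.
have def_half : half_up k.+1 = k./2.+1 by [].
pose h r := hopc a.+1 ks k./2 (add_at B r 1) (Z (B r)).
(* For the first pair, [[c] / E c + [c] = [2c] / E c] turns the two signs into [- beta c]; for a
   diagonal entry the weight 1 is [- beta 0]. *)
transitivity (- \sum_(r : 'I_D | (r < a.+1)%N) beta (B r) * h r).
  rewrite (sum_rows gB) => [|r ra nleg]; last first.
    by rewrite /h (hopc_illegal _ _ _ gB nleg) // mulr0.
  rewrite opprD -!sumrN; congr (_ + _).
    apply: eq_bigr => r /andP[_ /eqP Br].
    by rewrite /mid_fill (negPf even_k) /h Br /hop_weight eqxx !mulN1r opprK mul1r.
  case def_k : k => [|k'].
    rewrite big1 // => r /andP[leg nz].
    have ra : (r < a)%N by rewrite ltnNge -(good_zero _ gB).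
    by rewrite /h def_k /= (closed_fill_good _ (good_add gB leg ra)) mulr0 oppr0.
  have odd_k' : odd k' by move: even_k; rewrite def_k /= negbK.
  apply: eq_bigr => r lB; have /andP[leg nz] := lB.
  have := pair k' r false lB; have := pair k' r true lB.
  have -> : h r = hopc a.+1 ks k'.+1./2 (add_at B r 1) (Z (B r)) by rewrite /h def_k.
  rewrite /mid_fill odd_k' sqr_contentN // -/(Z _) => -> ->.
  move: (hop _ _ _ _ _ _ _) => x.
  rewrite (qint_opp q_neq0) (expz_opp q) invrK /hop_weight (negPf nz).
  have nzE := expfz2_neq0 q_neq0 (B r)%:Z.
  by rewrite (qint_double q_neq0) (alphaN fd) mulfVK //; field.
have dB : distinct a.+1 B.
  have neq i j : (j < a.+1)%N -> (i < j)%N -> B i != B j.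
    rewrite ltnS leq_eqVlt => /orP[/eqP ja ij|ja ij]; last first.
      by have := good_decr gB ij ja; lia.
    rewrite (good_out gB (i := j)) ?ja // -lt0n (good_gt0 gB) //; lia.
  move=> i j ia ja e; case: (ltngtP i j) => [ij|ji|/ord_inj //].
    by have := neq i j ja ij; rewrite e eqxx.
  by have := neq j i ia ji; rewrite e eqxx.
rewrite (@sum_hop_start _ _ Z beta L content_level_inj _ _ (closed_fill_alt ks a.+1)
           (@closed_fill_supp ks a.+1)) // -def_half.
have [aD|Da] := ltnP a D; last first.
  rewrite [RHS](_ : _ = 0); last first.
    rewrite /closed_fill; case: eqP => //= e; lia.
  rewrite big1 ?oppr0 // => i _; rewrite /closed_fill; case: eqP; rewrite ?mulr0 //; lia.
(* The single moving row must be the new row [a]: otherwise it would still be empty at the end of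
   the block. *)
rewrite (bigD1 (Ordinal aD)) //= big1 ?addr0 => [|i /andP[ia ne]]; last first.
  rewrite /closed_fill; case: ifP; rewrite ?mulr0 // => /and3P[_ _ /forallP].
  move/(_ (Ordinal aD)); rewrite add_at_neq 1?eq_sym // (good_out gB) //= ltnSn //.
have Ba : B (Ordinal aD) = 0%N by apply: (good_out gB).
rewrite Ba -mulNr -/(block_weight k.+1) /closed_fill /= even_k /= addSnnS.
have -> : [forall i : 'I_D, (0 < B i)%N == (i < a)%N].
  by apply/forallP=> i; rewrite lt0n (good_zero _ gB) -ltnNge.
have -> : [forall i : 'I_D, (0 < add_at B (Ordinal aD) (half_up k.+1) i)%N == (i < a.+1)%N].
  apply/forallP=> i; rewrite ltnS.
  have [->|ne] := eqVneq i (Ordinal aD); first by rewrite add_atE def_half addnS leqnn.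
  rewrite add_at_neq // lt0n (good_zero _ gB) -ltnNge.
  by move: ne; rewrite -val_eqE /=; lia.
rewrite !andbT; case: ifP => _; rewrite ?mulr0 // big_cons mulrA; congr (_ * alt_indicator _ _ _).
apply/ffunP=> i; rewrite !ffunE ltnS -val_eqE /=.
case: (ltngtP i a) => [ia|ai|ia].
- by rewrite addn0.
- by rewrite subnS; case: (i - a)%N (subn_gt0 a i) => [|d]; rewrite ?ai.
by rewrite ia subnn mul1n /= (good_out gB) ?ia.
Qed.

End Block.

Lemma fill_links ks a B y : 0%N \notin ks -> good a B ->
  fill false (links ks) y B = closed_fill ks a B.
Proof.
elim: ks a B y => [|m ks IHks] a B y.
  move=> _ gB; rewrite /= /closed_fill addn0 big_nil mul1r.
  (* All [D] rows of [mu] are nonempty, so a shape with fewer rows is incomplete. *)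
  have [aD|ne] := eqVneq a D; last first.
    have aD : (a < D)%N by rewrite ltn_neqAle ne (good_le gB).
    case: eqP => // e; have := mu_gt0 (Ordinal aD).
    by rewrite -e (good_out gB).
  have -> : mix a [::] B = B by apply/ffunP=> i; rewrite ffunE aD ltn_ord.
  have -> : [forall i : 'I_D, (0 < B i)%N == (i < a)%N].
    by apply/forallP=> i; rewrite lt0n (good_zero _ gB) -ltnNge.
  rewrite /= alt_indicator_decr // => i j ij.
  by rewrite (good_decr gB) // aD.
rewrite inE negb_or eq_sym -lt0n => /andP[m_gt0 nz] gB.
by apply: fill_block => // a' B' y'; apply: IHks.
Qed.

End Blocks.

(** * The value of one block *)

Section BlockValue.
Local Open Scope ring_scope.
Variables (F : fieldType) (q im : F) (sq : nat -> F) (n : nat).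
Hypothesis fd : field_data q n im sq.
Variables (D : nat) (mu : {ffun 'I_D -> nat}) (L : nat).
Hypothesis mu_decr : forall i j : 'I_D, (i < j)%N -> (mu j < mu i)%N.
Hypothesis mu_le : forall i, (mu i <= L)%N.
Hypothesis L_le : (L.*2 <= n.+1)%N.
Let q_neq0 := fd_q fd.
Local Notation Z := (content_level q).
Local Notation beta := (hop_weight q im sq).

Lemma sq_neq0 k : (1 <= k <= n)%N -> sq k != 0.
Proof.
move=> le_k; have := fd_qnat fd le_k; rewrite -(fd_sq fd le_k).
by apply: contraNneq => ->; rewrite expr0n.
Qed.

(** [Z c - Z c.-1] is [[1] [2c - 1] / q^(2c)], and [alpha] at [2c] times [[2c]] is
    [im * sq (2c + 1) * sq (2c - 1)]. The powers of [q] cancel and the product over [c]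
    telescopes. *)
Lemma hop_ratio c : (0 < c)%N -> (c < L)%N ->
  beta c / (Z c.-1 - Z c) = im * sq c.*2.+1 / (sq 1 ^+ 2 * sq c.*2.-1).
Proof.
case: c => // c _ lt_c; rewrite /hop_weight /= /content_level.
have sm k : (1 <= k < n)%N -> qint q k != 0.
  by move=> lt_k; apply: (qint_neq0 q_neq0 fd); rewrite /small; lia.
have e1 : c.+1%:Z - c%:Z = 1 by lia.
have e2 : c.+1%:Z + c%:Z = c.*2.+1%:Z by lia.
have e3 : c.+1%:Z + c.+1%:Z = c.*2.+2%:Z by lia.
have := qint_sub_add q_neq0 c.+1 c; rewrite e1 e2 e3 /alpha /alpha_nat /=.
have -> : qint q 1 = sq 1 ^+ 2 by rewrite /= (fd_sq fd) //; lia.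
have -> : qint q c.*2.+1 = sq c.*2.+1 ^+ 2 by rewrite /= (fd_sq fd) //; lia.
have n1 : sq 1 != 0 by apply: sq_neq0; lia.
have n2 : sq c.*2.+1 != 0 by apply: sq_neq0; lia.
have n3 : qnat q c.*2.+2 != 0 by apply: (fd_qnat fd); lia.
have nzE := expfz2_neq0 q_neq0 c.+1.
move: (sqr_content q c.+1) (sqr_content q c) => z1 z0 ez.
have nz : z1 - z0 != 0.
  apply: contraTneq nzE => z10.
  have := mulf_neq0 (expf_neq0 2 n1) (expf_neq0 2 n2).
  by rewrite ez z10 mulr0 eqxx.
rewrite -opprB invrN.
have -> : (z1 - z0)^-1 = ((q ^+ 2) ^ c.+1 / (sq 1 ^+ 2 * sq c.*2.+1 ^+ 2)).
  by rewrite ez; field; rewrite nzE nz.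
rewrite -[qint q c.*2.+2]/(qnat q c.*2.+2) !doubleS /=.
by field; rewrite n1 n2 n3 nzE.
Qed.

Lemma walk_value b d : (b + d < L)%N -> walk Z beta b.+1 d (Z b) =
  im ^+ d * sq 1 ^- d.*2 * (sq (b + d).*2.+1 / sq b.*2.+1).
Proof.
have nz k : (k < L)%N -> sq k.*2.+1 != 0 by move=> lt_k; apply: sq_neq0; lia.
elim: d b => [|d IHd] b lt_L.
  by rewrite /= addn0 !expr0 invr1 !mul1r divff // nz //; lia.
have n1 : sq 1 != 0 by apply: sq_neq0; lia.
rewrite /= (hop_ratio (c := b.+1)) //; last by lia.
rewrite IHd ?addSnnS // doubleS /=.
have := nz b; have := nz b.+1; rewrite doubleS => n2 n3.
rewrite exprS doubleS !exprS; field.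
rewrite n1 n3 ?n2 ?andbT //; try lia.
by rewrite expf_neq0.
Qed.

Lemma block_weight_value m : odd m -> (half_up m <= L)%N ->
  block_weight q im sq m = im ^+ m./2 * sq 1 ^- m * sq m.
Proof.
move=> odd_m; have [h ->] : exists h, m = h.*2.+1.
  by exists m./2; rewrite -[LHS]odd_double_half odd_m.
have half_h : half_up h.*2.+1 = h.+1 by rewrite /half_up -doubleS doubleK.
rewrite /block_weight /walk_start half_h => lt_L.
rewrite /= uphalf_double /hop_weight eqxx mulN1r opprK (@walk_value 0) ?add0n //.
have n1 : sq 1 != 0 by apply: sq_neq0; lia.
by rewrite double0 [sq 1 ^+ h.*2.+1]exprS; field; rewrite n1 expf_neq0.
Qed.

Lemma closed_fill_value kappa : sumn kappa = n ->
  exists c : int,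
    closed_fill q im sq mu kappa 0 [ffun=> 0%N] =
      c%:~R * (- im) ^+ ((n - D)./2) * sq 1 ^- n * \prod_(m <- kappa) sq m
  /\ (c != 0 -> perm_eq kappa [seq (mu i).*2.-1 | i <- enum 'I_D]).
Proof.
move=> sum_n; rewrite /closed_fill add0n.
case: ifP => [/and3P[/eqP sz odd_k _]|_]; last by exists 0; rewrite !mul0r eqxx.
set e := mix _ _ _; have e_i (i : 'I_D) : e i = half_up (nth 0%N kappa i).
  by rewrite ffunE subn0.
have [->|nz] := eqVneq (alt_indicator F mu e) 0.
  by exists 0; rewrite mulr0 !mul0r eqxx.
have [sgn perm] := alt_indicator_perm mu_decr nz.
have codom_e : codom e = map half_up kappa.
  apply: (@eq_from_nth _ 0%N); first by rewrite size_map size_codom card_ord.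
  move=> i; rewrite size_codom card_ord => lt_i.
  rewrite (nth_map 0%N) ?sz // -[i]/(val (Ordinal lt_i)) codomE (nth_map (Ordinal lt_i)).
    by rewrite nth_ord_enum e_i.
  by rewrite size_enum_ord.
have half_le m : m \in kappa -> (half_up m <= L)%N.
  move=> /(map_f half_up); rewrite -codom_e (perm_mem perm) => /codomP[i ->].
  exact: mu_le.
have perm_k : perm_eq kappa [seq (mu i).*2.-1 | i <- enum 'I_D].
  have := perm_map (fun k => k.*2.-1) perm; rewrite codom_e -!map_comp.
  suff -> : [seq (half_up m).*2.-1 | m <- kappa] = kappa by [].
  rewrite -[RHS]map_id; apply/eq_in_map => m /(allP odd_k) /= odd_m.
  have [h ->] : exists h, m = h.*2.+1.
    by exists m./2; rewrite -[LHS]odd_double_half odd_m.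
  by rewrite /= /half_up /= doubleK.
have [c c_nz def_c] : exists2 c : int, c != 0 & alt_indicator F mu e = c%:~R.
  by case: sgn => ->; [exists 1 | exists (-1)].
have half_sum : (\sum_(m <- kappa) m./2 = (n - D)./2)%N.
  rewrite -sum_n -sz sumnE; elim: (kappa) odd_k => [|m ks IH] /=.
    by rewrite !big_nil.
  case/andP=> odd_m odd_ks; rewrite !big_cons IH //.
  have : (size ks <= \sum_(j <- ks) j)%N.
    elim: (ks) odd_ks => [|k l IHl] /=; first by rewrite big_nil.
    by case/andP=> odd_k /IHl; rewrite big_cons; case: k odd_k => // k _; lia.
  by have := odd_double_half m; rewrite odd_m; lia.
(* The blocks produce a power of [im]; this sign converts it into the same power of [- im]. *)
exists ((-1) ^+ ((n - D)./2) * c); split=> [|_ //].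
have -> : \prod_(m <- kappa) block_weight q im sq m =
          \prod_(m <- kappa) (im ^+ m./2 * sq 1 ^- m * sq m).
  by apply: eq_big_seq => m mk; rewrite block_weight_value ?half_le ?(allP odd_k).
rewrite def_c !big_split /= -expr_sum half_sum.
have -> : \prod_(m <- kappa) sq 1 ^- m = sq 1 ^- n.
  by rewrite prodfV -expr_sum -sum_n sumnE.
rewrite intrM rmorphXn /= rmorphN1 [(- im) ^+ _]exprNn -signr_odd.
rewrite signr_odd; have := sqrr_sign F ((n - D)./2); rewrite -signr_odd.
move: ((-1) ^+ _) (im ^+ _) (sq 1 ^- n) (\prod_(_ <- _) _) => u v s P u2.
by rewrite -[LHS]mul1r -u2; ring.
Qed.

End BlockValue.

(** * Expansion of the trace over standard tableaux *)

Section TraceExpansion.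
Local Open Scope ring_scope.
Variables (F : fieldType) (q : F) (n : nat) (im : F) (sq : nat -> F).
Variable lam : seq nat.
Hypotheses (lam_part : is_partition n lam) (fd : field_data q n im sq).
Hypothesis lam_conj : conj_part lam = lam.
Implicit Types (t u v : tableau n) (l : seq 'I_n.-1) (y : int).
Local Notation N := #|Std n lam|.
Local Notation M := (@seminormal_mx F q n im sq lam).
Local Notation tau := (@tau_mx F n lam).
Local Notation tv := (@tab_vec F n lam).
Local Notation x := (sn_diag q).
Local Notation al := (alpha q im sq).

(* The coefficient of v_v in v_u T_l. *)
Fixpoint word_coef l u v : F :=
  if l is i :: l' then
    x (axial u i) * word_coef l' u v + al (axial u i) * word_coef l' (swap_tab u i) v
  else (u == v)%:R.

Lemma word_coefE l u (b : 'I_N) :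
  (tv u *m \prod_(i <- l) M i) 0 b = word_coef l u (enum_val b).
Proof.
elim: l u => [|i l IHl] u; first by rewrite big_nil mulmx1 mxE eq_sym.
rewrite big_cons -mulmxE mulmxA (tab_vec_seminormal lam_part fd) mulmxDl.
by rewrite -!scalemxAl mxE [X in X + _]mxE [X in _ + X]mxE !IHl.
Qed.

Lemma trace_tau l : \tr (\prod_(i <- l) M i *m tau) =
  \sum_(t in Std n lam) word_coef l t (conj_tab t).
Proof.
rewrite mxtrace_mulC.
have conj_bij : {on [pred t in Std n lam], bijective (@conj_tab n)}.
  by exists (@conj_tab n) => t _; apply: conj_tabK.
rewrite [RHS](reindex _ conj_bij) /=.
rewrite [RHS](eq_bigl (mem (Std n lam))) => [|t]; last by rewrite !inE (conj_std lam_part).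
under [RHS]eq_bigr do rewrite conj_tabK.
rewrite [RHS]big_enum_val; apply: eq_bigr => a _.
by rewrite -word_coefE !mxE; apply: eq_bigr => b _; rewrite !mxE.
Qed.

End TraceExpansion.

(** * Local rules for the coefficients of the trace *)

Section TailCoefficients.
Local Open Scope ring_scope.
Variables (F : fieldType) (q : F) (n : nat) (im : F) (sq : nat -> F).
Variable lam : seq nat.
Implicit Types (t u v : tableau n) (l : seq 'I_n.-1) (y : int).
Local Notation word_coef := (@word_coef F q n im sq).
Local Notation x := (sn_diag q).
Local Notation al := (alpha q im sq).

Lemma word_coef_agree l u v (k : 'I_n) : word_coef l u v != 0 ->
  all (fun i : 'I_n.-1 => (k < i) || (i.+1 < k))%N l -> u k = v k.
Proof.
elim: l u => [|i l IHl] u /=; first by have [->|] := eqVneq u v; rewrite ?eqxx.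
move=> nz /andP[ki all_l]; have [z1|nz1] := eqVneq (word_coef l u v) 0; last exact: IHl.
rewrite z1 mulr0 add0r mulf_eq0 negb_or in nz; case/andP: nz => _ /IHl/(_ all_l) <-.
by rewrite ffunE simple_out //; lia.
Qed.

Variable P : nat -> bool.
Hypothesis P_lt : forall j, P j -> (j.+1 < n)%N.

Definition letters j : seq 'I_n.-1 := incr_word (fun i : 'I_n.-1 => (j <= i)%N && P i).

Lemma letters_skip j : ~~ P j -> letters j = letters j.+1.
Proof.
move=> nP; apply: incr_word_ext => i.
by case: ltngtP => // e; rewrite -e (negPf nP).
Qed.

Lemma letters_cons j (i : 'I_n.-1) : i = j :> nat -> P j -> letters j = i :: letters j.+1.
Proof.
move=> def_i Pj.
have lt_tr : transitive (fun j k : 'I_n.-1 => j < k)%N by move=> ? ? ?; apply: ltn_trans.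
apply: (irr_sorted_eq lt_tr) => [k|||k]; first exact: ltnn.
- by have := incr_word_sorted (fun i : 'I_n.-1 => (j <= i)%N && P i); rewrite sorted_map.
- rewrite /= path_sortedE //; apply/andP; split.
    by apply/allP=> k; rewrite mem_incr_word => /andP[]; rewrite /= def_i.
  by have := incr_word_sorted (fun i : 'I_n.-1 => (j < i)%N && P i); rewrite sorted_map.
rewrite in_cons !mem_incr_word -val_eqE /= def_i.
by have [lt_jk|lt_kj|<-] := ltngtP j k; rewrite ?Pj //=; lia.
Qed.

Lemma letters_out j : (n <= j.+1)%N -> letters j = [::].
Proof.
move=> le_nj; apply/eqP; rewrite -[_ == _]negbK -has_filter.
by apply/hasPn=> i _; have := ltn_ord i; lia.
Qed.

Lemma letters_ge j i : i \in letters j -> (j <= i)%N.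
Proof. by rewrite mem_incr_word => /andP[]. Qed.

(* The only tableau that can lead from [t] to its conjugate once the
   generators T_i with i < j have been applied. *)
Definition midway t j : tableau n :=
  [ffun k : 'I_n => if (k < j)%N then conj_tab t k else t k].

Definition tail_coef j t : F := word_coef (letters j) (midway t j) (conj_tab t).

Lemma tail_coef_end t : tail_coef n t = 1.
Proof.
rewrite /tail_coef letters_out //=.
have -> : midway t n = conj_tab t by apply/ffunP=> k; rewrite [LHS]ffunE ltn_ord.
by rewrite eqxx.
Qed.

Definition diag_box t (k : 'I_n) : bool := (t k).1 == (t k).2.

Lemma conj_diag t k : (conj_tab t k == t k) = diag_box t k.
Proof.
by rewrite ffunE /diag_box; case: (t k) => r c /=; rewrite xpair_eqE eq_sym andbb.
Qed.

Lemma content_diag t k : diag_box t k -> content t k = 0.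
Proof. by rewrite /diag_box /content => /eqP ->; rewrite subrr. Qed.

Lemma midway_diag t (k : 'I_n) : diag_box t k -> midway t k.+1 = midway t k.
Proof.
rewrite -conj_diag => /eqP e; apply/ffunP=> l.
by rewrite [LHS]ffunE [RHS]ffunE ltnS; case: (ltngtP l k) => // /ord_inj ->.
Qed.

(** The remaining generators do not touch entry [k], which therefore cannot reach its target box. *)
Lemma coef_stuck t l u (k : 'I_n) : u k != conj_tab t k ->
  (forall i, i \in l -> (k < i)%N) -> word_coef l u (conj_tab t) = 0.
Proof.
move=> ne lt_k; apply/eqP; apply: contraNT ne => /word_coef_agree agree.
by apply/eqP/agree/allP=> i /lt_k ->.
Qed.

Lemma content_eq t u (k m : 'I_n) : t k = u m -> content t k = content u m.
Proof. by rewrite /content => ->. Qed.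

Lemma content_mirror t (k l : 'I_n) : t l = conj_tab t k -> content t l = - content t k.
Proof. by move=> e; rewrite -content_conj; apply: content_eq. Qed.

(** The tail coefficient with the diagonal factor of the generator that links entry [j] to its
    predecessor, already settled at content [y]. Past the last entry the factor is 1. *)
Definition linked_coef (lk : bool) (j : nat) (y : int) (t : tableau n) : F :=
  oapp (fun k : 'I_n => link_weight q lk y (content t k)) 1 (insub j) * tail_coef j t.

Lemma linked_coefE lk (k : 'I_n) y t :
  linked_coef lk k y t = link_weight q lk y (content t k) * tail_coef k t.
Proof. by rewrite /linked_coef valK. Qed.

Lemma linked_coef_unlinked j y t : linked_coef false j y t = tail_coef j t.
Proof. by rewrite /linked_coef; case: insub => [k|] /=; rewrite mul1r. Qed.

Lemma linked_coef_end lk y t : linked_coef lk n y t = 1.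
Proof. by rewrite /linked_coef insubF ?ltnn //= mul1r tail_coef_end. Qed.

Lemma axialE u (i : 'I_n.-1) : axial u i = content u (lo i) - content u (hi i).
Proof. by []. Qed.

Lemma index_ex j : P j -> exists i : 'I_n.-1, i = j :> nat.
Proof.
move=> /P_lt lt_j; have lt_i : (j < n.-1)%N by lia.
by exists (Ordinal lt_i).
Qed.

(* When entry [k] already sits in its final box, T_k acts by its diagonal part. *)
Lemma coef_settled t u (k : 'I_n) : standard lam t ->
    (forall l : 'I_n, (k < l)%N -> u l = t l) -> u k = conj_tab t k ->
    (exists l : 'I_n, (l <= k)%N /\ t l = conj_tab t k) ->
  word_coef (letters k) u (conj_tab t) =
  oapp (fun l : 'I_n => link_weight q (P k) (content u k) (content t l)) 1 (insub k.+1)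
    * word_coef (letters k.+1) u (conj_tab t).
Proof.
move=> st u_t u_k [m [m_k t_m]].
have [Pk|nPk] := boolP (P k); last first.
  by rewrite letters_skip //; case: insub => [l|] /=; rewrite mul1r.
have [i def_i] := index_ex Pk; rewrite (letters_cons def_i Pk) /=.
have lo_i : lo i = k by apply: val_inj.
have hi_i : hi i = k.+1 :> nat by rewrite /= def_i.
rewrite -hi_i valK /= axialE lo_i [content u (hi i)](content_eq (u_t _ _)) ?hi_i //.
rewrite [X in _ + al _ * X](@coef_stuck t _ _ k) ?mulr0 ?addr0 //; last first.
  by move=> l /letters_ge; rewrite def_i.
rewrite ffunE -{1}lo_i simple_lo u_t; last by rewrite /= def_i.
rewrite -t_m; apply: contraTneq m_k => /(std_inj st) e.
by rewrite -e -ltnNge /= def_i.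
Qed.

Lemma linked_coef_diag lk (k : 'I_n) y t : standard lam t -> diag_box t k ->
  linked_coef lk k y t = link_weight q lk y 0 * linked_coef (P k) k.+1 0 t.
Proof.
move=> st dk; rewrite linked_coefE content_diag //; congr (_ * _).
have e : conj_tab t k = t k by apply/eqP; rewrite conj_diag.
have m_k : midway t k k = t k by rewrite ffunE ltnn.
rewrite /tail_coef (@coef_settled t _ k) //.
- rewrite (content_eq m_k) (content_diag dk) -(midway_diag dk).
  by rewrite /linked_coef /tail_coef.
- by move=> l lt_l; rewrite ffunE ltnNge (ltnW lt_l).
- by rewrite m_k e.
by exists k; rewrite e.
Qed.

Lemma linked_coef_unpaired lk (k : 'I_n) y t : ~~ diag_box t k -> ~~ P k ->
  linked_coef lk k y t = 0.
Proof.
move=> dk nPk; rewrite linked_coefE /tail_coef letters_skip //.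
rewrite (@coef_stuck t _ _ k) ?mulr0 //; last by move=> i /letters_ge.
by rewrite [midway _ _ _]ffunE ltnn eq_sym conj_diag.
Qed.

(** Among the remaining generators only T_k moves entry [k], and it gives it the box of [k'], which
    must then be the mirror box. Afterwards [k'] holds the former box of [k], so the next link sees
    the content of [k]. *)
Lemma linked_coef_pair lk (k k' : 'I_n) y t : standard lam t -> ~~ diag_box t k ->
    P k -> k' = k.+1 :> nat ->
  linked_coef lk k y t =
  if t k' == conj_tab t k then
    link_weight q lk y (content t k) * al (content t k + content t k) *
      linked_coef (P k.+1) k.+2 (content t k) t
  else 0.
Proof.
move=> st dk Pk def_k'; rewrite linked_coefE.
have [i def_i] := index_ex Pk; rewrite /tail_coef (letters_cons def_i Pk) /=.
have lo_i : lo i = k by apply: val_inj.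
have hi_i : hi i = k' by apply: val_inj; rewrite /= def_i def_k'.
have s_k : simple_refl i k = k' by rewrite -lo_i simple_lo hi_i.
have s_k' : simple_refl i k' = k by rewrite -hi_i simple_hi lo_i.
have m_k : midway t k k = t k by rewrite ffunE ltnn.
have m_k' : midway t k k' = t k' by rewrite ffunE def_k' ltnNge leqnSn.
have gt_k m : m \in letters k.+1 -> (k < m)%N by move/letters_ge.
rewrite [X in x _ * X](@coef_stuck t _ _ k) //; last by rewrite m_k eq_sym conj_diag.
rewrite mulr0 add0r axialE lo_i hi_i (content_eq m_k) (content_eq m_k').
case: eqP => [e|/eqP ne]; last first.
  rewrite (@coef_stuck t _ _ k) ?mulr0 //.
  by rewrite [swap_tab _ _ _]ffunE s_k m_k'.
have e' : t k = conj_tab t k' by rewrite ffunE e ffunE; case: (t k).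
rewrite (content_mirror e) opprK mulrA; congr (_ * _).
have -> : swap_tab (midway t k) i = midway t k.+2.
  apply/ffunP=> l; have [->|ne_k] := eqVneq l k.
    by rewrite [LHS]ffunE s_k m_k' e [RHS]ffunE leqnSn.
  have [->|ne_k'] := eqVneq l k'.
    by rewrite [LHS]ffunE s_k' m_k e' [RHS]ffunE def_k' ltnSn.
  rewrite [LHS]ffunE simple_out; last 2 first.
  - by rewrite def_i; apply: contraNneq ne_k => /ord_inj ->.
  - by rewrite def_i -def_k'; apply: contraNneq ne_k' => /ord_inj ->.
  rewrite !ffunE !ltnS; congr (if _ then _ else _).
  by move: ne_k ne_k'; rewrite -!val_eqE /= def_k'; lia.
have w_k' : midway t k'.+1 k' = t k by rewrite ffunE ltnSn -e'.
rewrite -def_k' (@coef_settled t _ k') //.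
- by rewrite /linked_coef /tail_coef (content_eq w_k').
- by move=> l lt_l; rewrite ffunE ltnS leqNgt lt_l.
- by rewrite w_k' -e'.
by exists k; rewrite def_k' leqnSn -e'.
Qed.

Lemma trace_linked_coef (lam_part : is_partition n lam)
  (fd : field_data q n im sq) (lam_conj : conj_part lam = lam) :
  \tr (\prod_(i <- incr_word (fun i : 'I_n.-1 => P i)) @seminormal_mx F q n im sq lam i *m @tau_mx F n lam) =
  \sum_(t in Std n lam) linked_coef false 0 0 t.
Proof.
rewrite (trace_tau lam_part fd lam_conj); apply: eq_bigr => t _; rewrite linked_coef_unlinked /tail_coef.
by congr word_coef; apply/ffunP=> k; rewrite ffunE.
Qed.

End TailCoefficients.

(** * Self-conjugate diagrams built box by box *)

Section ShiftedShape.
Variable D : nat.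
Local Notation config := {ffun 'I_D -> nat}.
Implicit Types (B : config) (r : 'I_D) (b : nat * nat) (p : seq (nat * nat)).

Definition shifted_row B (r : nat) : nat := oapp B 0 (insub r).
Definition mirror b : nat * nat := (b.2, b.1).
(** The first free box of row [r]; the shifted rows start on the diagonal. *)
Definition corner B r : nat * nat := (val r, r + B r).

(* The self-conjugate diagram whose part above the diagonal has rows [B]. *)
Definition in_shape B b : bool :=
  if b.1 <= b.2 then b.2 - b.1 < shifted_row B b.1 else b.1 - b.2 < shifted_row B b.2.

Lemma mirrorK : involutive mirror. Proof. by case. Qed.

Lemma shifted_row_ord B r : shifted_row B r = B r.
Proof. by rewrite /shifted_row valK. Qed.

Lemma shifted_row_out B s : D <= s -> shifted_row B s = 0.
Proof. by move=> le_D; rewrite /shifted_row insubF // ltnNge le_D. Qed.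

Lemma in_shape_mirror B b : in_shape B (mirror b) = in_shape B b.
Proof. by case: b => r c; rewrite /in_shape /=; case: (ltngtP r c) => [||->]. Qed.

Lemma shifted_row_add B r s :
  shifted_row (add_at B r 1) s = shifted_row B s + (s == r :> nat).
Proof.
have [lt_s|le_s] := ltnP s D; last first.
  by rewrite !shifted_row_out // (_ : (s == r :> nat) = false) //; have := ltn_ord r; lia.
by rewrite -[s]/(val (Ordinal lt_s)) !shifted_row_ord ffunE muln1.
Qed.

Lemma in_shape_add B r b : in_shape (add_at B r 1) b =
  [|| in_shape B b, b == corner B r | b == mirror (corner B r)].
Proof.
wlog le_b : b / b.1 <= b.2 => [IH|].
  case: (leqP b.1 b.2) => [|/ltnW le_b]; first exact: IH.
  rewrite -in_shape_mirror IH // in_shape_mirror; congr (_ || _).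
  by rewrite -(inj_eq (inv_inj mirrorK)) mirrorK orbC -(inj_eq (inv_inj mirrorK)) mirrorK.
rewrite /in_shape le_b shifted_row_add; case: b le_b => s c /= le_sc.
rewrite !xpair_eqE /=; have [eq_s|ne] := eqVneq s (val r).
  rewrite eq_s in le_sc *.
  by rewrite shifted_row_ord; move: le_sc; rewrite /=; lia.
by move: ne; rewrite addn0 /=; lia.
Qed.

Definition nw b b' : bool := (b.1 <= b'.1) && (b.2 <= b'.2).

Lemma good_gap a B (i j : 'I_D) : good a B -> i <= j -> j < a -> B j + (j - i) <= B i.
Proof.
move=> gB; move def_d : (j - i) => d; elim: d j def_d => [|d IHd] j def_d ij ja.
  by rewrite addn0 (_ : i = j) //; apply: ord_inj; lia.
have lt_D : j.-1 < D by have := ltn_ord j; lia.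
have := IHd (Ordinal lt_D); have := good_decr gB (i := Ordinal lt_D) (j := j).
by rewrite /=; lia.
Qed.

Lemma legal_gap a B r (i : 'I_D) : good a B -> legal B r -> r <= a -> i < r ->
  B r + (r - i) < B i.
Proof.
move=> gB leg ra ir; have lt_D : r.-1 < D by have := ltn_ord r; lia.
have := legal_lt (i := Ordinal lt_D) gB leg ra.
have := good_gap (i := i) (j := Ordinal lt_D) gB; rewrite /=; lia.
Qed.

Lemma nw_corner a B r b : good a B -> legal B r -> r <= a ->
  nw b (corner B r) -> b != corner B r -> in_shape B b.
Proof.
case: b => s c gB leg ra /andP[/= le_s le_c] ne; rewrite /in_shape /=.
have gap m : m < r -> B r + (r - m) < shifted_row B m.
  move=> lt_m; have lt_D : m < D by apply: ltn_trans lt_m _.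
  by rewrite -[m]/(val (Ordinal lt_D)) shifted_row_ord; apply: (legal_gap gB leg ra).
case: ifP => le_sc; last by have := gap c; lia.
have [lt_s|eq_s] := ltnP s r; first by have := gap s lt_s; lia.
have e : s = val r by rewrite /=; lia.
by move: ne; rewrite e shifted_row_ord xpair_eqE eqxx /=; lia.
Qed.

(** Standardness of the filling: a box comes after all boxes weakly north-west of it. *)
Definition ordered p : Prop := forall k b', k < size p ->
  b' != nth (0, 0) p k -> nw b' (nth (0, 0) p k) -> b' \in take k p.

(* [p] fills the diagram of [B] box by box, staying a diagram throughout. *)
Record built B p : Prop := Built {
  built_good : exists a, good a B;
  built_mem : forall b, (b \in p) = in_shape B b;
  built_uniq : uniq p;
  built_ordered : ordered p
}.

Lemma ordered_rcons p b : ordered p ->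
  (forall b', b' != b -> nw b' b -> b' \in p) -> ordered (rcons p b).
Proof.
move=> ord_p nw_b k b'; rewrite size_rcons ltnS leq_eqVlt => /orP[/eqP->|lt_k].
  by rewrite nth_rcons ltnn eqxx -cats1 take_size_cat //; apply: nw_b.
by rewrite nth_rcons lt_k -cats1 takel_cat ?(ltnW lt_k) //; apply: ord_p.
Qed.

Lemma built_nil : built [ffun=> 0] [::].
Proof.
split=> //; first by exists 0; split=> // i _; rewrite ffunE.
move=> b; rewrite /in_shape; have z s : shifted_row [ffun=> 0] s = 0.
  by rewrite /shifted_row; case: insub => //= i; rewrite ffunE.
by rewrite !z if_same.
Qed.

Lemma good_add_any a B r : good a B -> legal B r ->
  r <= a /\ exists a', good a' (add_at B r 1).
Proof.
move=> gB leg; have [ra|] := boolP (B r == 0).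
  have := legal_inject r gB; rewrite leg ra /= => /esym/andP[/eqP e _].
  by split; [rewrite e | exists a.+1; apply: good_inject].
rewrite (good_zero _ gB) -ltnNge => ra; split; first exact: ltnW.
by exists a; apply: good_add.
Qed.

Lemma corner_notin B r : ~~ in_shape B (corner B r).
Proof. by rewrite /in_shape /= leq_addr addKn shifted_row_ord ltnn. Qed.

Lemma built_diag B p r : built B p -> legal B r -> B r = 0 ->
  built (add_at B r 1) (rcons p (corner B r)).
Proof.
case=> [[a gB] mem_p uniq_p ord_p] leg Br; have [ra ex_a'] := good_add_any gB leg.
have mir : mirror (corner B r) = corner B r by rewrite /mirror /corner /= Br addn0.
split=> // [b||].
- by rewrite mem_rcons inE mem_p in_shape_add mir orbb orbC.
- by rewrite rcons_uniq mem_p corner_notin.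
by apply: ordered_rcons => // b' ne nw_b'; rewrite mem_p (nw_corner gB leg ra).
Qed.

Lemma built_pair B p r (e : bool) : built B p -> legal B r -> B r != 0 ->
  let b := if e then mirror (corner B r) else corner B r in
  built (add_at B r 1) (rcons (rcons p b) (mirror b)).
Proof.
case=> [[a gB] mem_p uniq_p ord_p] leg Br b; have [ra ex_a'] := good_add_any gB leg.
have mir : mirror (corner B r) != corner B r.
  by rewrite xpair_eqE /= negb_and; move: Br; case: (B r) => // c _; lia.
have b_notin : b \notin p /\ mirror b \notin p.
  by rewrite /b !mem_p; case: (e); rewrite !in_shape_mirror corner_notin.
have mir_b : mirror b != b by rewrite /b; case: (e) => //; rewrite mirrorK eq_sym.
have nw_in b' c : b' \in [:: corner B r; mirror (corner B r)] -> c != b' ->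
    nw c b' -> c \in p.
  rewrite !inE mem_p => /orP[/eqP->|/eqP->] ne nw_c; first exact: (nw_corner gB leg ra).
  rewrite -in_shape_mirror; apply: (nw_corner gB leg ra); first by case/andP: nw_c => *; apply/andP.
  by rewrite -(inj_eq (inv_inj mirrorK)) mirrorK.
have b_in : (b \in [:: corner B r; mirror (corner B r)]) &&
            (mirror b \in [:: corner B r; mirror (corner B r)]).
  by rewrite /b; case: (e); rewrite ?mirrorK !inE !eqxx ?orbT.
have [b_in1 b_in2] := andP b_in.
split=> // [c||].
- rewrite mem_rcons inE mem_rcons inE mem_p in_shape_add orbA orbC; congr (_ || _).
  by rewrite /b; case: (e); rewrite ?mirrorK // orbC.
- rewrite !rcons_uniq mem_rcons inE negb_or mir_b uniq_p.
  by case: b_notin => -> ->.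
apply: ordered_rcons => [|c ne nw_c]; last first.
  by rewrite mem_rcons inE (nw_in _ c b_in2) ?orbT.
by apply: ordered_rcons => // c; apply: nw_in.
Qed.

End ShiftedShape.

(** * Prefixes of standard tableaux *)

Section Prefixes.
Variables (n : nat) (lam : seq nat).
Hypotheses (lam_part : is_partition n lam) (lam_conj : conj_part lam = lam).
Implicit Types (t : tableau n) (p : seq (nat * nat)) (b : nat * nat).
Local Notation D := (diag_len lam).
Implicit Types (B : {ffun 'I_D -> nat}) (r : 'I_D).

Lemma lt_diag_len (c : nat) : (c < diag_len lam) = (c < nth 0 lam c).
Proof.
apply/idP/idP=> [|lt_c].
  rewrite ltnNge => /bigmax_leqP H; rewrite ltnNge; apply/negP => le_c.
  case: H => i le_i; rewrite leqNgt; apply/negP => lt_ci.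
  have := lam_mono lam_part (r := c) (r' := i); lia.
have lt_sz := nth_lam_size lt_c.
exact: (@leq_bigmax_cond _ (fun i : 'I_(size lam) => i < nth 0 lam i)
  (fun i => i.+1) (Ordinal lt_sz)).
Qed.

(** The part of each row from the diagonal on. By symmetry a row of length [k] here has diagonal
    hook [2k - 1]. *)
Definition diag_rows : {ffun 'I_D -> nat} := [ffun r : 'I_D => nth 0 lam r - r].
Local Notation mu := diag_rows.

Lemma diag_row_lt r : r < nth 0 lam r. Proof. by rewrite -lt_diag_len. Qed.

Lemma diag_rows_decr (i j : 'I_D) : i < j -> mu j < mu i.
Proof.
rewrite !ffunE => ij; have := lam_mono lam_part (ltnW ij).
by have := diag_row_lt i; have := diag_row_lt j; lia.
Qed.

Lemma diag_rows_gt0 r : 0 < mu r.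
Proof. by rewrite ffunE subn_gt0 diag_row_lt. Qed.

Lemma diag_rows_le r : mu r <= nth 0 lam 0.
Proof. by rewrite ffunE (leq_trans (leq_subr _ _)) // (lam_mono lam_part). Qed.

(** The first row and the first column form a hook of [2 L - 1] boxes. This is the bound that keeps
    the quantum integers of the hop weights nonzero. *)
Lemma first_row_le : (nth 0 lam 0).*2 <= n.+1.
Proof.
case def_L : (nth 0 lam 0) => [|L] //.
have lt1 : L < nth 0 lam 0 by rewrite def_L.
have lt2 : 0 < nth 0 lam L by rewrite (lam_sym lam_part lam_conj).
by have := box_bound lam_part lt1 lt2; lia.
Qed.

Lemma in_shape_lam b : in_shape mu b = (b.2 < nth 0 lam b.1).
Proof.
wlog le_b : b / b.1 <= b.2 => [IH|].
  case: (leqP b.1 b.2) => [|/ltnW le_b]; first exact: IH.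
  by rewrite -in_shape_mirror IH // (lam_sym lam_part lam_conj).
case: b le_b => r c /= le_rc; rewrite /in_shape /= le_rc.
have [lt_r|le_D] := ltnP r D.
  rewrite -{2}[r]/(val (Ordinal lt_r)) shifted_row_ord ffunE /=.
  by have := lt_r; rewrite lt_diag_len; lia.
rewrite shifted_row_out // ltn0; apply/esym/negbTE.
by move: le_D; rewrite leqNgt lt_diag_len; lia.
Qed.

Definition box t (k : 'I_n) : nat * nat := (val (t k).1, val (t k).2).
Definition boxes t j : seq (nat * nat) := [seq box t k | k <- take j (enum 'I_n)].

Lemma box_inj_std t : standard lam t -> injective (box t).
Proof. by move=> st i j [e1 e2]; apply: (box_inj st). Qed.

Lemma box_ex t b : standard lam t -> b.2 < nth 0 lam b.1 -> exists k, box t k = b.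
Proof.
move=> st lt_b; have [k [e1 e2]] := std_surj lam_part st lt_b.
by exists k; rewrite /box /= e1 e2 -surjective_pairing.
Qed.

Lemma mem_boxes t j (k : 'I_n) : standard lam t -> (box t k \in boxes t j) = (k < j).
Proof.
move=> st; rewrite mem_map; last exact: box_inj_std.
by rewrite in_take ?mem_enum // index_enum_ord.
Qed.

Lemma boxes_rcons t (k : 'I_n) : boxes t k.+1 = rcons (boxes t k) (box t k).
Proof.
rewrite /boxes (take_nth k) ?size_enum_ord // map_rcons.
by rewrite nth_ord_enum.
Qed.

Definition extends p t : bool := standard lam t && (boxes t (size p) == p).

Lemma extends_rcons p b t (k : 'I_n) : size p = k ->
  extends (rcons p b) t = extends p t && (box t k == b).
Proof.
move=> sz; rewrite /extends size_rcons sz boxes_rcons eqseq_rcons andbA.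
by [].
Qed.

(** Every other box north-west of entry [k] carries a smaller entry, hence lies in the shape of [B],
    so entry [k] is addable; by symmetry it may be taken on or above the diagonal. *)
Lemma next_box B p t (k : 'I_n) : built B p -> extends p t -> size p = k ->
  exists2 r, legal B r & (box t k = corner B r) \/ (box t k = mirror (corner B r)).
Proof.
case=> [[a gB] mem_p uniq_p ord_p] /andP[st /eqP pref] sz.
have in_p m : in_shape B (box t m) = (m < k) by rewrite -mem_p -pref mem_boxes // sz.
have box_lam : (box t k).2 < nth 0 lam (box t k).1 by apply: std_box.
have smaller b : nw b (box t k) -> b != box t k -> in_shape B b.
  move=> /andP[nw1 nw2] ne; have lt_b : b.2 < nth 0 lam b.1.
    by apply: leq_ltn_trans nw2 (leq_trans box_lam _); apply: (lam_mono lam_part).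
  have [m def_b] := box_ex st lt_b; rewrite -def_b in_p.
  apply: (std_nw lam_part st); first by apply: contraNneq ne => <-; rewrite def_b.
    by rewrite -def_b in nw1.
  by rewrite -def_b in nw2.
have nin : ~~ in_shape B (box t k) by rewrite in_p ltnn.
move: (box t k) smaller nin box_lam => b smaller nin lam_b.
suff main c : (forall c', nw c' c -> c' != c -> in_shape B c') -> ~~ in_shape B c ->
    c.2 < nth 0 lam c.1 -> c.1 <= c.2 -> exists2 r, legal B r & c = corner B r.
  case: (leqP b.1 b.2) => [/main|/ltnW le_b].
    by case=> // r leg e; exists r => //; left.
  case: (main (mirror b)) => //.
  - move=> c' nw_c' ne; rewrite -in_shape_mirror; apply: smaller.
      by case/andP: nw_c' => *; apply/andP.
    by apply: contraNneq ne => <-; rewrite mirrorK.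
  - by rewrite in_shape_mirror.
  - by rewrite (lam_sym lam_part lam_conj).
  by move=> r leg e; exists r => //; right; rewrite -e mirrorK.
case: c => s c /= small nin_c lam_c le_sc.
have s_D : s < D.
  by rewrite lt_diag_len (leq_ltn_trans le_sc).
pose r := Ordinal s_D.
have row_s : shifted_row B s = B r := shifted_row_ord B r.
have B_r : s + B r = c.
  apply/eqP; rewrite eqn_leq; apply/andP; split.
    by move: nin_c; rewrite /in_shape /= le_sc row_s; lia.
  have [e|lt_sc] := eqVneq s c; first by rewrite {1}e leq_addr.
  have := small (s, c.-1); rewrite /nw xpair_eqE /in_shape /= row_s.
  have -> : s <= c.-1 by lia.
  by lia.
exists r; last by rewrite /corner B_r.
apply/forallP=> r'; apply/implyP=> /eqP def_s.
have := small (val r', c); rewrite /nw xpair_eqE /in_shape /= shifted_row_ord eqxx andbT leqnn andbT.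
have def_s' : r'.+1 = s := def_s.
have [-> ->] : r' <= s /\ r' <= c by lia.
have -> : (r' == s :> nat) = false by lia.
by move=> /(_ isT isT); lia.
Qed.

End Prefixes.

(** * From tableaux to fillings *)

Section FillSum.
Variables (F : fieldType) (q : F) (n : nat) (im : F) (sq : nat -> F).
Variable lam : seq nat.
Hypotheses (lam_part : is_partition n lam) (fd : field_data q n im sq).
Hypothesis lam_conj : conj_part lam = lam.
Local Notation D := (diag_len lam).
Local Notation mu := (diag_rows lam).
Implicit Types (t : tableau n) (p : seq (nat * nat)) (b : nat * nat).
Implicit Types (B : {ffun 'I_D -> nat}) (r : 'I_D).

Lemma extends_full B p t : built B p -> extends lam p t -> size p = n -> B = mu.
Proof.
case=> _ mem_p _ _ /andP[st /eqP pref] sz.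
have shapeE b : in_shape B b = in_shape mu b.
  rewrite (in_shape_lam lam_part lam_conj) -mem_p -pref.
  apply/mapP/idP=> [[k _ ->]|lt_b]; first exact: std_box.
  have [k def_b] := box_ex lam_part st lt_b.
  by exists k; rewrite // in_take ?mem_enum // index_enum_ord sz.
apply/ffunP=> r; have lt_shape (C : {ffun 'I_D -> nat}) c : in_shape C (val r, r + c) = (c < C r).
  by rewrite /in_shape /= leq_addr addKn shifted_row_ord.
apply/eqP; rewrite eqn_leq.
have := shapeE (val r, r + B r); have := shapeE (val r, r + mu r).
by rewrite !lt_shape !ltnn; case: ltngtP.
Qed.

Lemma extends_unique p t u : size p = n -> extends lam p t -> extends lam p u -> t = u.
Proof.
move=> sz /andP[_ /eqP pt] /andP[_ /eqP pu].
have := etrans pt (esym pu); rewrite /boxes sz !take_oversize ?size_enum_ord //.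
move/eq_in_map=> e; apply/ffunP=> k; have [] := e k (mem_enum _ k).
by case: (t k) (u k) => r c [r' c'] /= /ord_inj-> /ord_inj->.
Qed.

(** Entry [k] is put into the [k]-th box of [p]; [ordered] gives standardness. *)
Lemma extends_ex p : built mu p -> size p = n -> exists t, extends lam p t.
Proof.
case=> _ mem_p uniq_p ord_p sz.
have p_lam k : k < n -> (nth (0, 0) p k).2 < nth 0 lam (nth (0, 0) p k).1.
  by move=> lt_k; rewrite -(in_shape_lam lam_part lam_conj) -mem_p mem_nth // sz.
have lt_n k : k < n -> (nth (0, 0) p k).1 < n /\ (nth (0, 0) p k).2 < n.
  move=> /p_lam lt_k; have := box_bound lam_part lt_k lt_k; lia.
pose t : tableau n := [ffun k : 'I_n =>
  (Ordinal (proj1 (lt_n k (ltn_ord k))), Ordinal (proj2 (lt_n k (ltn_ord k))))].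
have box_t k : box t k = nth (0, 0) p k by rewrite /box ffunE -surjective_pairing.
have nw_lt (i j : 'I_n) : box t i != box t j -> nw (box t i) (box t j) -> i < j.
  rewrite !box_t => ne nw_ij; have := ord_p j _ _ ne nw_ij; rewrite sz ltn_ord => /(_ isT).
  by rewrite in_take ?mem_nth ?sz // index_uniq ?sz.
exists t; apply/andP; split; last first.
  rewrite /boxes sz take_oversize ?size_enum_ord //.
  apply/eqP/(@eq_from_nth _ (0, 0)); first by rewrite size_map size_enum_ord sz.
  move=> k; rewrite size_map size_enum_ord => lt_k.
  rewrite (nth_map (Ordinal lt_k)) ?size_enum_ord // box_t; congr nth.
  by rewrite -[k in LHS]/(val (Ordinal lt_k)) nth_ord_enum.
apply/and4P; split.
- apply/injectiveP=> i j e; have : box t i = box t j by rewrite /box e.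
  rewrite !box_t => /eqP; rewrite nth_uniq ?sz // => /eqP; exact: ord_inj.
- by apply/forallP=> k; have := p_lam k (ltn_ord k); rewrite -box_t.
- apply/forallP=> i; apply/forallP=> j; apply/implyP=> /andP[/eqP e lt_ij].
  apply: nw_lt; last by rewrite /nw /box /= e leqnn ltnW.
  by rewrite xpair_eqE negb_and /= (ltn_eqF lt_ij) orbT.
apply/forallP=> i; apply/forallP=> j; apply/implyP=> /andP[/eqP e lt_ij].
apply: nw_lt; last by rewrite /nw /box /= e leqnn ltnW.
by rewrite xpair_eqE negb_and /= (ltn_eqF lt_ij).
Qed.

Local Open Scope ring_scope.
Local Notation al := (alpha q im sq).
Variable g : seq bool.
Hypotheses (size_g : size g = n) (g_last : forall j, nth false g j -> (j.+1 < n)%N).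
Local Notation P := (nth false g).
Local Notation weight := (@linked_coef F q n im sq P).

Lemma content_box t k : content t k = (box t k).2%:Z - (box t k).1%:Z.
Proof. by []. Qed.

Lemma content_corner t k B r : box t k = corner B r -> content t k = (B r)%:Z.
Proof. by rewrite content_box => -> /=; lia. Qed.

Lemma content_mirror_corner t k B r : box t k = mirror (corner B r) ->
  content t k = - (B r)%:Z.
Proof. by rewrite content_box => -> /=; lia. Qed.

Lemma diag_box_box t k : diag_box t k = ((box t k).1 == (box t k).2).
Proof. by []. Qed.

Lemma box_mirror t (k l : 'I_n) : (t l == conj_tab t k) = (box t l == mirror (box t k)).
Proof. by rewrite ffunE /box /mirror; case: (t l) => r c; rewrite !xpair_eqE. Qed.

(** A legal row offers its corner and the mirror image. For an empty row these coincide on the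
    diagonal and are counted once. *)
Lemma sum_next p B (k : 'I_n) (f : tableau n -> F) : built B p -> size p = k ->
  \sum_(t | extends lam p t) f t =
  \sum_(r | legal B r && (B r == 0)%N)
     \sum_(t | extends lam (rcons p (corner B r)) t) f t +
  \sum_(r | legal B r && (B r != 0)%N)
    (\sum_(t | extends lam (rcons p (corner B r)) t) f t +
     \sum_(t | extends lam (rcons p (mirror (corner B r))) t) f t).
Proof.
move=> bB sz.
pose at_box b t := if box t k == b then f t else 0.
have sumE b : \sum_(t | extends lam (rcons p b) t) f t =
              \sum_(t | extends lam p t) at_box b t.
  by rewrite -big_mkcondr; apply: eq_bigl => t; rewrite (@extends_rcons _ _ p b t k).
under [X in _ = X + _]eq_bigr do rewrite sumE.
under [X in _ = _ + X]eq_bigr do rewrite !sumE -big_split.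
rewrite [X in _ = X + _]exchange_big [X in _ = _ + X]exchange_big -big_split /=.
apply: eq_bigr => t ext_t; have [r leg box_r] := next_box lam_part lam_conj bB ext_t sz.
have box_eq : box t k = corner B r \/ B r != 0 /\ box t k = mirror (corner B r).
  have [Br|Br] := eqVneq (B r) 0; last by case: box_r => ?; [left | right].
  by left; case: box_r => ->; rewrite // /mirror /corner /= Br addn0.
have miss r' : (r' != r) || (B r' == 0) && (B r != 0) ->
    (box t k == corner B r') = false /\ (box t k == mirror (corner B r')) = false.
  rewrite -val_eqE /= => hit.
  by case: box_eq => [->|[_ ->]]; split; rewrite xpair_eqE /=;
     apply/negP => /andP[/eqP e1 /eqP e2]; move: hit e1 e2 => /=; lia.
have [Br|Br] := eqVneq (B r) 0.
  rewrite [X in _ + X]big1 ?addr0 => [|r' /andP[_ Br']]; last first.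
    have ne : r' != r by apply: contraNneq Br' => ->; rewrite Br.
    by rewrite /at_box; case: (miss r'); rewrite ?ne // => -> ->; rewrite addr0.
  rewrite (bigD1 r) ?leg ?Br //= big1 ?addr0 => [|r' /andP[_ ne]]; last first.
    by rewrite /at_box; case: (miss r'); rewrite ?ne // => ->.
  by rewrite /at_box; case: box_eq => [->|[]]; rewrite ?Br ?eqxx.
rewrite [X in X + _]big1 ?add0r => [|r' /andP[_ Br']]; last first.
  by rewrite /at_box; case: (miss r'); rewrite ?Br' ?Br ?orbT // => ->.
rewrite (bigD1 r) ?leg ?Br //= [X in _ + X]big1 ?addr0 => [|r' /andP[_ ne]]; last first.
  by rewrite /at_box; case: (miss r'); rewrite ?ne // => -> ->; rewrite addr0.
have ne_mir : mirror (corner B r) != corner B r by rewrite xpair_eqE /=; lia.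
rewrite /at_box; case: box_eq => [->|[_ ->]]; rewrite eqxx.
  by rewrite eq_sym (negPf ne_mir) addr0.
by rewrite (negPf ne_mir) add0r.
Qed.

Lemma extends_mirror p b t (k k' : 'I_n) : size p = k -> k' = k.+1 :> nat ->
  extends lam (rcons (rcons p b) (mirror b)) t =
  extends lam (rcons p b) t && (t k' == conj_tab t k).
Proof.
move=> sz def_k'; rewrite (@extends_rcons _ _ (rcons p b) _ t k') ?size_rcons ?sz //.
rewrite box_mirror (@extends_rcons _ _ p b t k) // -[LHS]andbA -[RHS]andbA.
by case: (box t k =P b) => [->|].
Qed.

Lemma drop_links j : (j < n)%N -> drop j g = P j :: drop j.+1 g.
Proof. by move=> lt_j; rewrite (drop_nth false) ?size_g. Qed.

(** The local rules match the recursion of [fill]. A pair consumes two entries at once, because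
    tableaux whose next entry is not in the mirror box contribute 0; thus only self-conjugate
    prefixes are ever extended. *)
Lemma sum_fill lk y p B : built B p -> (size p <= n)%N ->
  \sum_(t | extends lam p t) weight lk (size p) y t =
  fill q im sq mu lk (drop (size p) g) y B.
Proof.
have [m] := ubnP (n - size p); elim: m lk y p B => // m IHm lk y p B lt_m bB.
rewrite leq_eqVlt => /orP[/eqP sz|lt_sz].
  rewrite sz drop_oversize ?size_g //=.
  under eq_bigr => t _ do rewrite linked_coef_end.
  have [eB|neB] := eqVneq B mu; last first.
    rewrite big_pred0 // => t; apply/negP => /(extends_full bB)/(_ sz) e.
    by rewrite e eqxx in neB.
  have [t ext_t] : exists t, extends lam p t by apply: extends_ex; rewrite -?eB.
  rewrite (big_pred1 t) // => u; apply/idP/eqP => [ext_u|-> //].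
  exact: extends_unique ext_u ext_t.
pose k := Ordinal lt_sz; have sz_k : size p = k by [].
rewrite (sum_next _ bB sz_k) drop_links //= sz_k; congr (_ + _).
  apply: eq_bigr => r /andP[leg /eqP Br].
  have sz' : size (rcons p (corner B r)) = k.+1 by rewrite size_rcons.
  have IH := IHm (P k) 0 (rcons p (corner B r)) (add_at B r 1); rewrite sz' in IH.
  rewrite -IH //; [|by rewrite /=; lia|exact: built_diag].
  rewrite mulr_sumr; apply: eq_bigr => t; rewrite (extends_rcons _ _ _ sz_k).
  case/andP=> /andP[st _] /eqP box_k; rewrite (linked_coef_diag _ _ _ g_last _ _ st) //.
  by rewrite diag_box_box box_k /= Br addn0.
have pair_zero b : ~~ P k -> (b.1 != b.2) ->
    \sum_(t | extends lam (rcons p b) t) weight lk k y t = 0.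
  move=> nPk ne; rewrite big1 // => t; rewrite (extends_rcons _ _ _ sz_k).
  by case/andP=> _ /eqP box_k; rewrite linked_coef_unpaired // diag_box_box box_k.
have [Pk|nPk] := boolP (P k); last first.
  rewrite big1 => [|r /andP[_ Br]]; first by case: drop.
  by rewrite !pair_zero ?addr0 //=; lia.
have lt_k' := g_last Pk; rewrite (drop_links lt_k').
pose k' := Ordinal lt_k'; have def_k' : k' = k.+1 :> nat by [].
apply: eq_bigr => r /andP[leg Br].
have pair (e : bool) (c := if e then - (B r)%:Z else (B r)%:Z)
    (b := if e then mirror (corner B r) else corner B r) :
    \sum_(t | extends lam (rcons p b) t) weight lk k y t =
    link_weight q lk y c * al (c + c) *
      fill q im sq mu (P k.+1) (drop k.+2 g) c (add_at B r 1).
  have sz' : size (rcons (rcons p b) (mirror b)) = k.+2 by rewrite !size_rcons.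
  have IH := IHm (P k.+1) c (rcons (rcons p b) (mirror b)) (add_at B r 1).
  rewrite sz' in IH; rewrite -IH //; [|by rewrite /=; lia|exact: built_pair].
  rewrite mulr_sumr; under [RHS]eq_bigl => t do rewrite (extends_mirror _ _ sz_k def_k').
  rewrite [RHS]big_mkcondr; apply: eq_bigr => t; rewrite (extends_rcons _ _ _ sz_k).
  case/andP=> /andP[st _] /eqP box_k.
  have content_k : content t k = c.
    rewrite /c; rewrite /b in box_k; case: (e) box_k; first exact: content_mirror_corner.
    exact: content_corner.
  have ndk : ~~ diag_box t k.
    by rewrite diag_box_box box_k /b; case: (e) => /=; lia.
  by rewrite (linked_coef_pair _ _ _ g_last _ _ st _ _ def_k') // content_k.
have := pair false; have := pair true; rewrite /= => -> ->.
by rewrite -opprD.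
Qed.

Lemma trace_fill :
  \tr (\prod_(i <- incr_word (fun i : 'I_n.-1 => P i)) seminormal_mx q im sq lam i
        *m @tau_mx F n lam) = fill q im sq mu false g 0 [ffun=> 0%N].
Proof.
rewrite trace_linked_coef //.
have := sum_fill false 0 (built_nil D) (leq0n n); rewrite drop0 => <-.
by apply: eq_bigl => t; rewrite inE /extends /boxes take0 eqxx andbT.
Qed.

End FillSum.

(** * The polynomials *)

Local Open Scope ring_scope.

Lemma nth_links_lt kappa j : 0%N \notin kappa ->
  nth false (links kappa) j -> (j.+1 < sumn kappa)%N.
Proof.
elim: kappa j => [|m kappa IH] j; first by rewrite nth_nil.
rewrite inE negb_or => /andP[]; case: m => // m _ pos.
rewrite /links /= -/(links kappa) nth_cat size_cat size_nseq addn1.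
case: (ltnP j m.+1) => [le_jm|lt_mj]; last by move/(IH _ pos); rewrite /=; lia.
rewrite nth_cat size_nseq nth_nseq; case: (ltnP j m) => [lt_jm _|le_mj]; first by rewrite /=; lia.
by have -> : (j - m)%N = 0%N by lia.
Qed.

Lemma diag_hooksE n lam (lam_part : is_partition n lam) (lam_conj : conj_part lam = lam) :
  diag_hooks lam = [seq (diag_rows lam i).*2.-1 | i <- enum 'I_(diag_len lam)].
Proof.
rewrite /diag_hooks /mkseq -val_enum_ord -map_comp; apply/eq_map => i /=.
rewrite /diag_hook lam_conj ffunE; have := diag_row_lt lam_part i; lia.
Qed.

Lemma sorted_diag_hooks n lam (lam_part : is_partition n lam)
  (lam_conj : conj_part lam = lam) : sorted geq (diag_hooks lam).
Proof.
rewrite (diag_hooksE lam_part lam_conj) sorted_map.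
have : sorted ltn (map val (enum 'I_(diag_len lam))).
  by rewrite val_enum_ord iota_ltn_sorted.
rewrite sorted_map; apply: sub_sorted => i j /= /(diag_rows_decr lam_part); lia.
Qed.

Section BaseCase.
Variables (F : fieldType) (q : F) (n : nat) (im : F) (sq : nat -> F).
Variable lam : seq nat.
Hypotheses (lam_part : is_partition n lam) (fd : field_data q n im sq).
Hypothesis lam_conj : conj_part lam = lam.
Local Notation M := (@seminormal_mx F q n im sq lam).
Local Notation tau := (@tau_mx F n lam).
Local Notation hooks := (diag_hooks lam).
Local Notation h := (w_comp n hooks).

Definition twisted_char w : F := \tr (\prod_(i <- reduced_word w) M i *m tau).

Lemma seminormal_commE (i j : 'I_n.-1) : (i.+1 < j)%N -> M i * M j = M j * M i.
Proof. exact: (seminormal_comm lam_part fd). Qed.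

Lemma seminormal_braidE (i j : 'I_n.-1) : j = i.+1 :> nat ->
  M i * M j * M i = M j * M i * M j.
Proof. exact: (seminormal_braid lam_part fd). Qed.

Lemma twisted_char_comp kappa : is_composition n kappa ->
  exists c : int,
    twisted_char (w_comp n kappa) =
      c%:~R * (- im) ^+ (n - diag_len lam)./2 * sq 1%N ^- n * \prod_(m <- hooks) sq m
  /\ (c != 0 -> partition_of kappa = hooks).
Proof.
case/andP=> pos /eqP sum_n.
have mu_decr := diag_rows_decr lam_part.
have mu_le := diag_rows_le lam_part.
have L_le := first_row_le lam_part lam_conj.
have [c [val_c perm_c]] := closed_fill_value fd mu_decr mu_le L_le sum_n.
rewrite -(diag_hooksE lam_part lam_conj) in perm_c.
exists c; split; last first.
  move/perm_c => perm_k; have geq_tr : transitive geq.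
    by move=> a b d /= ab /leq_trans; apply.
  have geq_tot : total geq by move=> a b; apply: leq_total.
  have geq_asym : antisymmetric geq by move=> a b /anti_leq.
  rewrite /partition_of (perm_sortP geq_tot geq_tr geq_asym _ _ perm_k).
  exact/sorted_sort/(sorted_diag_hooks lam_part lam_conj).
transitivity (closed_fill q im sq (diag_rows lam) kappa 0 [ffun=> 0%N]); last first.
  rewrite val_c; have [->|/perm_c perm_k] := eqVneq c 0; first by rewrite !mul0r.
  by rewrite (perm_big _ perm_k).
have good0 : good 0 ([ffun=> 0%N] : {ffun 'I_(diag_len lam) -> nat}).
  by split=> // i _; rewrite ffunE.
rewrite -(fill_links fd mu_decr (diag_rows_gt0 lam_part) mu_le L_le 0 pos good0).
rewrite -(trace_fill lam_part fd lam_conj); first last.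
- by move=> j /(nth_links_lt pos); rewrite sum_n.
- by rewrite size_links.
rewrite /twisted_char w_compE (prod_reduced_word seminormal_commE seminormal_braidE); last first.
  exact: incr_word_reduced.
congr (\tr (_ *m _)); congr bigop.body.
by apply: incr_word_ext => i; rewrite -nth_links ?sum_n //; have := ltn_ord i; lia.
Qed.

(** The degree bound is written additively, [size P] being one more than the degree, so that no
    subtraction is truncated. *)
Definition char_poly_prop (w : 'S_n) (P : {poly int}) : Prop :=
  [/\ P != 0 -> (size P + cox_len h <= (cox_len w).+1)%N,
      twisted_char w =
        (map_poly intr P).[q - q^-1] *
          ((- im) ^+ (n - diag_len lam)./2 * sq 1%N ^- n * \prod_(m <- hooks) sq m)
    & P != 0 ->
        exists kappa : seq nat,
          [/\ is_composition n kappa, leads w (w_comp n kappa)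
            & partition_of kappa = hooks]].

(** The polynomial is constant. If it is nonzero, [kappa] has as many parts as there are hooks, so
    both elements have the same length and the degree bound is attained. *)
Lemma char_poly_comp kappa : is_composition n kappa ->
  exists P, char_poly_prop (w_comp n kappa) P.
Proof.
move=> comp; have [c [val_c part_c]] := twisted_char_comp comp.
have nz_c : c%:P != 0 -> c != 0 by rewrite polyC_eq0.
exists c%:P; split=> [/nz_c c_nz||/nz_c /part_c part_k].
- have e := part_c c_nz; rewrite size_polyC c_nz add1n ltnS.
  have comp_h : is_composition n hooks.
    have perm_k : perm_eq hooks kappa by rewrite -e perm_sort.
    by rewrite /is_composition (perm_mem perm_k) (perm_sumn perm_k).
  have := cox_len_w_comp comp_h; have := cox_len_w_comp comp.
  have -> : size hooks = size kappa by rewrite -e size_sort.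
  lia.
- by rewrite map_polyC hornerC val_c -!mulrA.
exists kappa; split=> //; apply: t_step; left; exact: connect0.
Qed.

Lemma rdesc_mul (x : 'S_n) i : rdesc x i -> ~~ rdesc (x * s i)%g i.
Proof. by move=> d; rewrite rdesc_lt mul_simpleK -leqNgt (len_rdesc d). Qed.

Lemma ldesc_mul (x : 'S_n) i : ldesc x i -> ~~ ldesc (s i * x)%g i.
Proof. by move=> d; rewrite ldesc_lt simple_mulK -leqNgt (len_ldesc d). Qed.

Lemma twisted_char_rmul (x : 'S_n) i : rdesc x i ->
  twisted_char x = \tr (\prod_(k <- reduced_word (x * s i)%g) M k *m M i *m tau).
Proof.
move=> d; rewrite /twisted_char -{1}(mul_simpleK i x).
by rewrite (prod_reduced_word_rmul seminormal_commE seminormal_braidE) ?rdesc_mul.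
Qed.

Lemma leads_arrow (x y z : 'S_n) : arrow x y -> leads y z -> leads x z.
Proof. by move=> xy; apply: t_trans; apply: t_step; left. Qed.

Lemma cyc_step_len (x y : 'S_n) : cyc_step x y -> (cox_len y <= cox_len x)%N.
Proof.
case=> i d ->; rewrite (len_rdesc d) -mulgA; set v := (x * s i)%g.
have [/len_ldesc->|/len_lasc->//] := boolP (ldesc v i).
by rewrite !leqW.
Qed.

Lemma cyc_step_arrow (x y : 'S_n) : cyc_step x y -> arrow x y.
Proof.
move=> xy; have le_yx := cyc_step_len xy; case: xy => i _ def_y.
apply: connect1; apply/existsP; exists (s i); rewrite le_yx def_y eqxx !andbT.
by apply/existsP; exists i.
Qed.

Lemma char_poly_step (x y : 'S_n) :
    (forall v : 'S_n, (cox_len v < cox_len x)%N -> exists P, char_poly_prop v P) ->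
  cyc_step x y -> (exists P, char_poly_prop y P) -> exists P, char_poly_prop x P.
Proof.
move=> IHlen xy [Py [bound_y val_y lead_y]].
have arr := cyc_step_arrow xy; case: xy => i d def_y.
have len_x := len_rdesc d; set v := (x * s i)%g in len_x.
have def_y' : y = (s i * v)%g by rewrite def_y mulgA.
(* If [i] is a left descent of [v], the length drops by two and [twisted_conj] applies. Otherwise
   [x] and [y] have equal length and [twisted_cyc] brings in the shorter [v], which [x] reaches by
   the second kind of [leads_step]. *)
have [dv|nv] := boolP (ldesc v i).
  have len_v := len_ldesc dv; rewrite -def_y' in len_v.
  exists (- Py); split=> [||]; rewrite ?oppr_eq0.
  - rewrite size_polyN => /bound_y /leq_trans -> //.
    by rewrite ltnS len_x len_v !leqW.
  - rewrite raddfN hornerN mulNr -val_y (twisted_char_rmul d) -/v -{1}(simple_mulK i v).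
    rewrite -def_y' (prod_reduced_word_lmul seminormal_commE seminormal_braidE).
      exact: (twisted_conj lam_part fd lam_conj).
    by rewrite def_y' ldesc_mul.
  move/lead_y => [kappa [comp lead part]]; exists kappa; split=> //.
  exact: leads_arrow lead.
have len_y := len_lasc nv; rewrite -def_y' in len_y.
have [|Pv [bound_v val_v lead_v]] := IHlen v; first by rewrite len_x.
exists (Pv * 'X - Py).
have nz : Pv * 'X - Py != 0 -> Pv != 0 \/ Py != 0.
  have [->|nzv] := eqVneq Pv 0; last by left.
  by rewrite mul0r sub0r oppr_eq0; right.
split.
- move=> nzP; have bv : (size (Pv * 'X)%R + cox_len h <= (cox_len x).+1)%N \/ Pv = 0.
    have [->|nzv] := eqVneq Pv 0; [by right | left].
    by rewrite size_mulX //; have := bound_v nzv; lia.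
  have by_ : (size Py + cox_len h <= (cox_len x).+1)%N \/ Py = 0.
    have [->|nzy] := eqVneq Py 0; [by right | left].
    by have := bound_y nzy; lia.
  have := size_polyD (Pv * 'X) (- Py); rewrite size_polyN => le_sz.
  case: bv => [bv|v0]; case: by_ => [by_|y0].
  + apply: leq_trans (leq_add le_sz (leqnn _)) _.
    by rewrite addn_maxl geq_max bv by_.
  + by rewrite y0 subr0.
  + by rewrite v0 mul0r sub0r size_polyN.
  by rewrite v0 y0 mul0r subr0 eqxx in nzP.
- rewrite rmorphB rmorphM /= map_polyX hornerD hornerN hornerM hornerX mulrBl.
  rewrite -val_y mulrAC -val_v mulrC (twisted_char_rmul d).
  rewrite (twisted_cyc lam_part fd lam_conj) -/v; congr (_ - _).
  rewrite /twisted_char def_y'.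
  by rewrite (prod_reduced_word_lmul seminormal_commE seminormal_braidE nv) mulmxE.
move/nz => [/lead_v|/lead_y] [kappa [comp lead part]]; exists kappa; split=> //; last first.
  exact: leads_arrow lead.
apply: t_trans lead; apply: t_step; right; exists (s i); split.
- by apply/existsP; exists i.
- by rewrite -mulgA -def_y' len_x len_y.
- by rewrite !inE eqxx orbT.
by rewrite len_x.
Qed.

(** Steps of the chain may preserve the length, so the induction along the chain is nested in one on
    the length, which supplies the polynomials of shorter elements. *)
Lemma char_poly_ex w : exists P, char_poly_prop w P.
Proof.
have [k] := ubnP (cox_len w); elim: k w => // k IHk w lt_k.
have [kappa comp /clos_rt_rt1n_iff] := cyc_chain w.
move def_z: (w_comp n kappa) => z chain.
elim: chain def_z lt_k => [x <- _|x y z' xy _ IHy def_z lt_x]; first exact: char_poly_comp.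
have le_yx := cyc_step_len xy.
apply: char_poly_step xy _ => [v lt_v|].
  by apply: IHk; apply: leq_trans lt_v _; rewrite -ltnS.
by apply: IHy => //; apply: leq_ltn_trans le_yx lt_x.
Qed.

End BaseCase.

Theorem theorem6p11 (F : fieldType) (q im : F) (sq : nat -> F) (n : nat)
    (fd : field_data q n im sq)
    (lam : seq nat) (lam_part : is_partition n lam)
    (lam_conj : conj_part lam = lam) (w : 'S_n) :
  exists P : {poly int},
    [/\ P != 0 ->
          ((size P).-1%:Z <=
             (cox_len w)%:Z - (cox_len (w_comp n (diag_hooks lam)))%:Z),
        chi_tau lam_part fd (hecke_T q w) =
          (- im) ^+ (n - diag_len lam)./2 * (map_poly intr P).[q - q^-1]
            * sq 1%N ^- n * \prod_(h <- diag_hooks lam) sq h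
      & P != 0 ->
          exists kappa : seq nat,
            [/\ is_composition n kappa, leads w (w_comp n kappa)
              & partition_of kappa = diag_hooks lam]].
Proof.
have [P [bound val_P lead]] := char_poly_ex lam_part fd lam_conj w.
exists P; split=> //.
  move=> nzP; have := bound nzP; rewrite -(prednK (n := size P)) ?size_poly_gt0 //.
  by move: (size P).-1 => d; lia.
rewrite chi_tauE -[LHS]/(twisted_char q im sq lam w) val_P.
by rewrite [in RHS]mulrC !mulrA; ring.
Qed.
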